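(* Let $\{\phi_t\}_{t\in\mathbb T^d}$ be a non-singular $\mathbb T^d$-action on a standard Lebesgue space $(S,\mathcal B,\mu)$ with $\sigma$-finite $\mu$, let $w(t,s)$ be as in the context, let $f_0\in L^1(S,\mu)$ and define $f(t,s)=(\widehat\phi_{-t}f_0)(s):=w(t,s)\,f_0(\phi_t(s))$. Then there exists $\widetilde f\in L^1(S,\mu)$ such that $$A_Tf(s)=\frac1{C(T)}\int_{B(T)}f(t,s)\,\lambda(dt)\ \longrightarrow\ \widetilde f(s)$$ stochastically (locally in measure) as $T\to\infty$. Moreover $\widetilde f$ is invariant: $\widehat\phi_t\widetilde f=\widetilde f$ $\mu$-a.e. for all $t\in\mathbb T^d$.
   Context: $\mathbb T$ denotes either $\mathbb Z$ or $\mathbb R$; $\lambda$ is counting measure on $\mathbb Z^d$ or Lebesgue measure on $\mathbb R^d$. $B(T)=(-T,T]^d\cap\mathbb T^d$ and $C(T)=(2T)^d$. A non-singular $\mathbb T^d$-action is a family $\{\phi_t\}_{t\in\mathbb T^d}$ of invertible bi-measurable maps with $\mu\circ\phi_t^{-1}\sim\mu$, $\phi_0=\mathrm{id}$, $\phi_{u+v}=\phi_u\circ\phi_v$, and $(t,s)\mapsto\phi_t(s)$ jointly measurable. $w(t,s)$ is a strictly positive jointly measurable function such that for each $t$, $w(t,\cdot)=\frac{d\mu\circ\phi_t}{d\mu}$ $\mu$-a.e., and $w(t+h,s)=w(h,s)\,w(t,\phi_h(s))$ for all $t,h\in\mathbb T^d$, $s\in S$ (such a version exists). The dual operator of a non-singular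 $\phi$ is $\widehat\phi g=\frac{d\mu\circ\phi^{-1}}{d\mu}\,g\circ\phi^{-1}$. Stochastic convergence $g_T\to g$ means $\mu(\{|g_T-g|>\epsilon\}\cap B)\to0$ for all $\epsilon>0$ and all $B\in\mathcal B$ with $\mu(B)<\infty$. *)

(* Defs.v *)
From HB Require Import structures.
From mathcomp Require Import all_boot all_order all_algebra.
From mathcomp Require Import all_classical all_reals all_analysis.
Set Implicit Arguments. Unset Strict Implicit. Unset Printing Implicit Defensive.
Import Order.TTheory GRing.Theory Num.Theory.
Local Open Scope classical_set_scope.
Local Open Scope ring_scope.

(* [disc = true]  : T = Z, T^d is the set of integer points of R^d;
   [disc = false] : T = R, T^d is all of R^d.
   R^d is n.-tuple R, equipped with its product (Borel) sigma-algebra.      *)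

Definition tadd (R : realType) (n : nat) (u v : n.-tuple R) : n.-tuple R :=
  [tuple tnth u i + tnth v i | i < n].
Definition topp (R : realType) (n : nat) (u : n.-tuple R) : n.-tuple R :=
  [tuple - tnth u i | i < n].
Definition tzero (R : realType) (n : nat) : n.-tuple R := [tuple 0 | i < n].

Definition Tgrp (R : realType) (n : nat) (disc : bool) : set (n.-tuple R) :=
  if disc then [set t | forall i : 'I_n, exists k : int, tnth t i = k%:~R]
  else [set: n.-tuple R].
Arguments Tgrp : clear implicits.

(* lambda: counting measure on Z^d (discrete case), Lebesgue measure on R^d
   (continuous case; characterized by giving every box (a,b] its volume,
   which determines it uniquely on the Borel sets). *)
Definition is_lambda (R : realType) (n : nat) (disc : bool)
  (lam : {measure set (n.-tuple R) -> \bar R}) : Prop :=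
  if disc then
    forall A : set (n.-tuple R), measurable A ->
      lam A = counting (A `&` Tgrp R n true)
  else
    forall a b : n.-tuple R, (forall i, tnth a i <= tnth b i) ->
      lam [set t | forall i, tnth a i < tnth t i <= tnth b i]
      = (\prod_(i < n) (tnth b i - tnth a i))%:E.

Definition Bbox (R : realType) (n : nat) (disc : bool) (T : R) :
  set (n.-tuple R) :=
  [set t | forall i, - T < tnth t i <= T] `&` Tgrp R n disc.

Arguments Bbox : clear implicits.

Definition Cvol (R : realType) (n : nat) (T : R) : R := (2 * T) ^+ n.
Arguments Cvol : clear implicits.

(* (S, B) is isomorphic (as a measurable space) to a Borel subset of R:
   an injective measurable map into R sending measurable sets to Borel sets *)
Definition standard_borel (dS : measure_display) (S : measurableType dS)
  (R : realType) : Prop :=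
  exists f : S -> R, [/\ injective f, measurable_fun setT f &
    forall A : set S, measurable A -> measurable (f @` A)].

Definition nonsingular_action (R : realType) (n : nat) (disc : bool)
  (dS : measure_display) (S : measurableType dS)
  (mu : {measure set S -> \bar R}) (phi : n.-tuple R -> S -> S) : Prop :=
  [/\ (forall t, Tgrp R n disc t ->
         [/\ bijective (phi t), measurable_fun setT (phi t),
             (forall A, measurable A -> measurable (phi t @` A)) &
             (forall A, measurable A ->
                (mu (phi t @^-1` A) = 0%E <-> mu A = 0%E))]),
      (forall s, phi (tzero R n) s = s),
      (forall u v, Tgrp R n disc u -> Tgrp R n disc v ->
         forall s, phi (tadd u v) s = phi u (phi v s)) &
      measurable_fun (Tgrp R n disc `*` [set: S])
        (fun p : n.-tuple R * S => phi p.1 p.2)].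

Definition rn_cocycle (R : realType) (n : nat) (disc : bool)
  (dS : measure_display) (S : measurableType dS)
  (mu : {measure set S -> \bar R}) (phi : n.-tuple R -> S -> S)
  (w : n.-tuple R -> S -> R) : Prop :=
  [/\ (forall t, Tgrp R n disc t -> forall s, 0 < w t s),
      measurable_fun (Tgrp R n disc `*` [set: S])
        (fun p : n.-tuple R * S => w p.1 p.2),
      (forall t, Tgrp R n disc t -> forall A, measurable A ->
         (mu (phi t @` A) = \int[mu]_(s in A) (w t s)%:E)%E) &
      (forall t h, Tgrp R n disc t -> Tgrp R n disc h -> forall s,
         w (tadd t h) s = w h s * w t (phi h s))].

(* dual operator: (hat phi_t g)(s) = d(mu o phi_t^{-1})/dmu (s) * g(phi_t^{-1} s);
   with phi_t^{-1} = phi_{-t}, d(mu o phi_{-t})/dmu = w(-t, .) *)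
Definition dual_op (R : realType) (n : nat) (dS : measure_display)
  (S : measurableType dS) (phi : n.-tuple R -> S -> S)
  (w : n.-tuple R -> S -> R) (t : n.-tuple R) (g : S -> R) : S -> R :=
  fun s => w (topp t) s * g (phi (topp t) s).

Definition ergodic_avg (R : realType) (n : nat) (disc : bool)
  (lam : {measure set (n.-tuple R) -> \bar R})
  (dS : measure_display) (S : measurableType dS)
  (phi : n.-tuple R -> S -> S) (w : n.-tuple R -> S -> R) (f0 : S -> R)
  (T : R) (s : S) : R :=
  (Cvol R n T)^-1 * Rintegral lam (Bbox R n disc T) (fun t => w t s * f0 (phi t s)).

Definition stoch_cvg (R : realType) (dS : measure_display)
  (S : measurableType dS) (mu : {measure set S -> \bar R})
  (g : R -> S -> R) (h : S -> R) : Prop :=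
  forall (eps : R), 0 < eps -> forall B : set S, measurable B ->
    (mu B < +oo)%E ->
    mu ([set s | eps < `|g T s - h s|] `&` B) @[T --> +oo] --> 0%E.

(* Main.v *)
Require Import Defs.
From HB Require Import structures.
From mathcomp Require Import all_boot all_order all_algebra finmap.
From mathcomp Require Import all_classical all_reals all_analysis.
From mathcomp Require Import measurable_realfun.
From mathcomp Require Import ring lra zify.
Set Implicit Arguments.
Unset Strict Implicit.
Unset Printing Implicit Defensive.
Import Order.TTheory GRing.Theory Num.Theory.
Import numFieldNormedType.Exports.
Local Open Scope classical_set_scope.
Local Open Scope ring_scope.

(** Write U_t g = w_t (g o phi_t), an isometry of L^1, and
    V_t g = sqrt(w_t) (g o phi_t), an isometry of L^2, with averages A_T over
    the boxes B_T. Translating B_T by u in B_m leaves a set containing B_(T-m),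
    so U_u A_T g is at least the unnormalised average over B_(T-m); this lower
    bound is the only way the group structure enters.

    For k >= 0 in L^2 it makes the energies ||A_T k||^2 converge to their
    infimum and bounds those of the midpoints from below, so V_u A_T k is
    Cauchy in L^2 by the parallelogram identity, uniformly in u. Apply this to
    a strictly positive weight rho; the limit h is V-invariant.

    On {h > 0}, functions h k with k in L^2 are dense in L^1, and
    U_t (h k) = h V_t k, so the averages converge in L^1 to an invariant limit.

    On {h = 0}, let F >= 0 live there and v_T = sqrt(A_T F). The lower bound
    and duality give, up to a factor close to 1,
    int v_(T-m-1) rho <= int v_T (A_m rho), and A_m rho is L^2-close to h while
    v_T h = 0. Hence int v_T rho -> 0 and A_T F -> 0 in measure. *)

(** * Nonnegative integrals and completeness of L^1 and L^2 *)

(** A finite invariant measure equivalent to mu need not exist, and then convergence in L^1 can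
    fail: under translation on the line A_T F keeps its mass but spreads it out, and only
    convergence to 0 in measure is left. The density h separates the two behaviours: V-invariance of
    h gives U_u (h^2) = h^2, so h^2 mu is a finite invariant measure, and {h = 0} is where the
    spreading takes place.

    The detour through L^2 is made because there nearly minimal norms force vectors to be close; L^1
    has no such property. On {h = 0} the square root is taken after averaging: it respects order, so
    the lower bound for A_T F becomes one for v_T, and pairing v_T with rho is an L^2 pairing, in
    which the group element can be moved onto rho.

    The lower bound needs positivity, so the functions averaged are nonnegative and extended-real; a
    signed f_0 is split into two such functions only at the end. *)

Section toolbox.
Context {d : measure_display} {X : measurableType d} {R : realType}.
Variable mu : {measure set X -> \bar R}.
Local Open Scope ereal_scope.

Lemma measurable_sqre (D : set X) (F : X -> \bar R) : measurable_fun D F ->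
  measurable_fun D (fun x => F x ^+ 2).
Proof. by move=> mF; under eq_fun do rewrite expe2; exact: emeasurable_funM. Qed.

Lemma amgm_ereal (m : R) (x : \bar R) : (0 <= m)%R -> 0 <= x ->
  (2 * m)%:E * x <= (m ^+ 2)%:E + x ^+ 2.
Proof.
move=> m0; case: x => [x| |//].
  by rewrite lee_fin => x0; rewrite -EFin_expe -EFinM -EFinD lee_fin;
     have := sqr_ge0 (m - x)%R; rewrite !expr2; nra.
by move=> _; rewrite expe2 mulyy addey// leey.
Qed.

(** Jensen for the square. Integrating the tangent inequality 2 m F <= m^2 + F^2 avoids subtracting
    extended reals; the optimal m is the average of [F]. *)
Lemma sqr_average_le (B : set X) (c : R) (F : X -> \bar R) :
  measurable B -> mu B = c%:E -> (0 < c)%R -> measurable_fun B F ->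
  (forall x, 0 <= F x) ->
  (c^-1%:E * \int[mu]_(x in B) F x) ^+ 2 <=
  c^-1%:E * \int[mu]_(x in B) (F x ^+ 2).
Proof.
move=> mB muB c0 mF F0.
have I0 : 0 <= \int[mu]_(x in B) F x by exact: integral_ge0.
have J0 : 0 <= \int[mu]_(x in B) (F x ^+ 2).
  by apply: integral_ge0 => x _; exact: expe_ge0.
have key (m : R) : (0 <= m)%R -> (2 * m)%:E * \int[mu]_(x in B) F x <=
    (m ^+ 2 * c)%:E + \int[mu]_(x in B) (F x ^+ 2).
  move=> m0; rewrite -ge0_integralZl//; last by rewrite lee_fin mulr_ge0.
  have -> : (m ^+ 2 * c)%:E = \int[mu]_(x in B) (cst (m ^+ 2)%:E x).
    by rewrite integral_cst// muB EFinM.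
  rewrite -ge0_integralD//.
  - apply: ge0_le_integral => //.
    + by move=> x _; rewrite mule_ge0// lee_fin mulr_ge0.
    + exact: measurable_funeM.
    + by apply: emeasurable_funD => //; exact: measurable_sqre.
    + by move=> x _; exact: amgm_ereal.
  - by move=> x _; rewrite lee_fin sqr_ge0.
  - by move=> x _; exact: expe_ge0.
  - exact: measurable_sqre.
move: key J0 I0.
case: (\int[mu]_(x in B) (F x ^+ 2)) => [J| |//] key; last first.
  by rewrite gt0_muley ?leey// lte_fin invr_gt0.
rewrite lee_fin => J0; move: key.
case: (\int[mu]_(x in B) F x) => [I| |//] key.
  rewrite lee_fin => I0; rewrite -!EFinM -EFin_expe lee_fin.
  have := key (I / c)%R (divr_ge0 I0 (ltW c0)).
  rewrite -!EFinM -!EFinD lee_fin => {}key.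
  have : (c^-1 * (2 * (I / c) * I) <= c^-1 * ((I / c) ^+ 2 * c + J))%R.
    by rewrite ler_pM2l ?invr_gt0.
  rewrite mulrDr (mulrCA c^-1%R (_ ^+ 2)%R) mulVf ?gt_eqF// mulr1.
  have -> : (c^-1 * (2 * (I / c) * I) = 2 * (c^-1 * I) ^+ 2)%R by rewrite expr2; ring.
  have -> : ((I / c) ^+ 2 = (c^-1 * I) ^+ 2)%R by rewrite mulrC.
  by lra.
(* Here [F] has an infinite integral and its square a finite one; any m > 0 contradicts [key]. *)
by have := key 1%R ler01; rewrite mulr1 gt0_muley.
Qed.

Lemma integral0_ae (F : X -> \bar R) : measurable_fun setT F ->
  (forall x, 0 <= F x) -> \int[mu]_x F x = 0 -> {ae mu, forall x, F x = 0}.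
Proof.
move=> mF F0 IF.
have [+ _] := ae_eq_integral_abs mu measurableT mF.
under eq_integral do rewrite gee0_abs//.
by move=> /(_ IF); apply: filterS => x /(_ I).
Qed.

Lemma ae_fin_num (F : X -> \bar R) : measurable_fun setT F ->
  (forall x, 0 <= F x) -> \int[mu]_x F x < +oo ->
  {ae mu, forall x, F x \is a fin_num}.
Proof.
move=> mF F0 IF; have : mu.-integrable setT F.
  by apply/integrableP; split => //; under eq_integral do rewrite gee0_abs//.
by move/integrable_ae => /(_ measurableT); apply: filterS => x; exact.
Qed.

Lemma ae_fin_num_sqr (F : X -> \bar R) : measurable_fun setT F ->
  (forall x, 0 <= F x) -> \int[mu]_x (F x ^+ 2) < +oo ->
  {ae mu, forall x, F x \is a fin_num}.
Proof.
move=> mF F0 IF.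
have /ae_fin_num : measurable_fun setT (fun x => F x ^+ 2) by exact: measurable_sqre.
move=> /(_ (fun x => expe_ge0 _ (F0 x)) IF); apply: filterS => x.
by have := F0 x; case: (F x).
Qed.

Lemma ge0_ae_eq_int (f g : X -> \bar R) : measurable_fun setT f ->
  measurable_fun setT g -> (forall x, 0 <= f x) -> (forall x, 0 <= g x) ->
  {ae mu, forall x, f x = g x} -> \int[mu]_x f x = \int[mu]_x g x.
Proof.
move=> mf mg f0 g0 fg; apply: ge0_ae_eq_integral => //.
by apply: filterS fg => x + _.
Qed.

Lemma ge0_ae_le_int (f g : X -> \bar R) : measurable_fun setT f ->
  measurable_fun setT g -> (forall x, 0 <= f x) -> (forall x, 0 <= g x) ->
  {ae mu, forall x, f x <= g x} -> \int[mu]_x f x <= \int[mu]_x g x.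
Proof.
move=> mf mg f0 g0 fg; apply: ae_ge0_le_integral => //.
by apply: filterS fg => x + _.
Qed.

Lemma integral_EFin_ge0 (f : X -> R) : (forall x, 0 <= f x)%R ->
  0 <= \int[mu]_x (f x)%:E.
Proof. by move=> f0; apply: integral_ge0 => x _; rewrite lee_fin. Qed.

Definition dyadic (j : nat) : R := (1 / (2 ^ (j + 1))%:R)%R.

Lemma dyadic_gt0 j : (0 < dyadic j)%R.
Proof. by rewrite divr_gt0// ltr0n expn_gt0. Qed.

Lemma sum_dyadic : \sum_(j <oo) (dyadic j)%:E = 1.
Proof.
have := @cvg_geometric_eseries_half R 1 0; rewrite expr0 divr1.
by move/cvg_lim => <-.
Qed.

(** For p = 2 this is Young's inequality, for p = 1 it is c <= 1. It lets one argument serve L^1 and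
    L^2 without Minkowski. *)
Lemma abs_le_pow (p : nat) (c a : R) : (p = 1 \/ p = 2)%N -> (0 < c)%R ->
  (c <= 1)%R -> (0 <= a)%R -> (a <= c + c^-1 * a ^+ p)%R.
Proof.
move=> pE c0 c1 a0; have ci : (1 <= c^-1)%R by rewrite invf_ge1.
case: pE => ->; first by rewrite expr1; nra.
have : (0 <= c^-1 * (a - c) ^+ 2)%R by rewrite mulr_ge0// ?sqr_ge0// ltW// invr_gt0.
have -> : (c^-1 * (a - c) ^+ 2 = c^-1 * a ^+ 2 - 2 * a + c)%R.
  by rewrite !expr2; field; rewrite gt_eqF.
by nra.
Qed.

Lemma dyadic_le1 j : (dyadic j <= 1)%R.
Proof. by rewrite /dyadic div1r invf_le1 ?ltr0n ?expn_gt0// ler1n expn_gt0. Qed.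

Lemma measurable_dist_pow (p : nat) (f g : X -> R) : measurable_fun setT f ->
  measurable_fun setT g ->
  measurable_fun setT (fun x => (`|f x - g x| ^+ p)%:E).
Proof.
move=> mf mg; apply/measurable_EFinP; apply: measurable_funX.
by apply: measurableT_comp => //; exact: measurable_funB.
Qed.

(** The squared budget still leaves the summable [dyadic j] after division by [dyadic j], so the
    weighted sum of the powers is finite a.e.; by [abs_le_pow] the telescoping series then converges
    absolutely. *)
Lemma ae_cvg_increments (p : nat) (u : nat -> X -> R) :
  (p = 1 \/ p = 2)%N -> (forall j, measurable_fun setT (u j)) ->
  (forall j, \int[mu]_x (`|u j.+1 x - u j x| ^+ p)%:E <= (dyadic j ^+ 2)%:E) ->
  exists v : X -> R, measurable_fun setT v /\
    {ae mu, forall x, u j x @[j --> \oo] --> v x}.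
Proof.
move=> pE mu_ inc.
pose D j x := ((dyadic j)^-1 * `|u j.+1 x - u j x| ^+ p)%:E.
have D0 j x : 0 <= D j x.
  by rewrite lee_fin mulr_ge0// ?exprn_ge0// ltW// invr_gt0 dyadic_gt0.
have mD j : measurable_fun setT (D j).
  rewrite /D; under eq_fun do rewrite EFinM.
  by apply: measurable_funeM; exact: measurable_dist_pow.
have sumD : \int[mu]_x (\sum_(j <oo) D j x) < +oo.
  rewrite integral_nneseries//; apply: (@le_lt_trans _ _ 1); last exact: ltry.
  rewrite -sum_dyadic; apply: lee_nneseries => [j _ _|j _].
    exact: integral_ge0.
  rewrite /D; under eq_integral do rewrite EFinM.
  rewrite ge0_integralZl//; last 2 first.
  - exact: measurable_dist_pow.
  - by rewrite lee_fin ltW// invr_gt0 dyadic_gt0.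
  apply: (@le_trans _ _ ((dyadic j)^-1%:E * (dyadic j ^+ 2)%:E)).
    by rewrite lee_pmul2l// lte_fin invr_gt0 dyadic_gt0.
  by rewrite -EFinM expr2 mulrA mulVf ?mul1r// gt_eqF// dyadic_gt0.
(* An upper limit is measurable whether or not the sequence converges, and it is the limit wherever
   there is one. *)
exists (fun x => fine (limn_esup (fun j => (u j x)%:E))); split.
  apply: measurableT_comp => //; apply: measurable_fun_limn_esup => j.
  exact/measurable_EFinP.
have : {ae mu, forall x, \sum_(j <oo) D j x \is a fin_num}.
  apply: ae_fin_num => //; first exact: ge0_emeasurable_sum.
  by move=> x; exact: nneseries_ge0.
apply: filterS => x sDx.
have : cvgn (u ^~ x).
  have : cvgn (series (telescope (u ^~ x))).
    apply: normed_cvg; apply: nnseries_is_cvg => //=.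
    apply: (@le_lt_trans _ _ (\sum_(j <oo) ((dyadic j)%:E + D j x))).
      apply: lee_nneseries => [j _ _|j _]; first by rewrite lee_fin.
      by rewrite lee_fin; apply: abs_le_pow => //; [exact: dyadic_gt0|exact: dyadic_le1].
    rewrite nneseriesD//; last by move=> j _ _; rewrite lee_fin ltW// dyadic_gt0.
    by rewrite sum_dyadic lte_add_pinfty// ?ltry// ltey_eq sDx.
  rewrite telescopeK => cv.
  rewrite (_ : u^~ x = (fun j => (u j x - u 0%N x) + u 0%N x)%R); last first.
    by apply/funext => j; rewrite subrK.
  by apply: is_cvgD => //; exact: is_cvg_cst.
move=> cu.
have -> : fine (limn_esup (fun j => (u j x)%:E)) = limn (u ^~ x).
  have /cvg_limn_einf_sup[_ ->//] :
    (u j x)%:E @[j --> \oo] --> (limn (u ^~ x))%:E.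
  by apply: cvg_EFin; [exact: nearW|].
exact: cu.
Qed.

Lemma fatou_dist (p : nat) (u : nat -> X -> R) (f v : X -> R) (e : R) :
  (forall j, measurable_fun setT (u j)) -> measurable_fun setT f ->
  measurable_fun setT v -> {ae mu, forall x, u j x @[j --> \oo] --> v x} ->
  (\forall j \near \oo, \int[mu]_x (`|f x - u j x| ^+ p)%:E <= e%:E) ->
  \int[mu]_x (`|f x - v x| ^+ p)%:E <= e%:E.
Proof.
move=> mu_ mf mv uv [J _ fu].
pose F j x := (`|f x - u (j + J)%N x| ^+ p)%:E.
have mF j : measurable_fun setT (F j) by exact: measurable_dist_pow.
have F0 j x : 0 <= F j x by rewrite lee_fin.
apply: (@le_trans _ _ (\int[mu]_x limn_einf (F ^~ x))).
  apply: ge0_ae_le_int => //.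
  - exact: measurable_dist_pow.
  - rewrite /limn_einf; apply: measurableT_comp => //.
    apply: measurable_fun_limn_esup => j; exact: measurableT_comp.
  - move=> x; rewrite limn_einf_lim; apply: lime_ge; first exact: is_cvg_einfs.
    by apply: nearW => j; apply: le_ereal_inf_tmp => _ [k _ <-].
  - apply: filterS uv => x cu.
    suff /cvg_limn_einf_sup[-> _//] :
      F j x @[j --> \oo] --> (`|f x - v x| ^+ p)%:E.
    apply: cvg_EFin; first exact: nearW.
    have cs : u (j + J)%N x @[j --> \oo] --> v x.
      by have := cu; rewrite -(cvg_shiftn J).
    have cn : `|f x - u (j + J)%N x|%R @[j --> \oo] --> `|f x - v x|%R.
      by apply: cvg_norm; apply: cvgB => //; exact: cvg_cst.
    exact: (@cvg_comp _ _ _ _ (fun y : R => y ^+ p)%R _ _ _ cn (@exprn_continuous R p _)).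
apply: le_trans (fatou _ _ _ _) _ => //.
rewrite limn_einf_lim; apply: lime_le; first exact: is_cvg_einfs.
apply: nearW => j; apply: (@le_trans _ _ (\int[mu]_x F j x)).
  by apply: ereal_inf_lbound; exists j => /=.
by apply: fu => /=; rewrite leq_addl.
Qed.

(** Riesz-Fischer for families indexed by reals: a fast subsequence converges a.e., and Fatou
    carries the Cauchy bound over to every [T]. *)
Lemma lp_complete (p : nat) (g : R -> X -> R) : (p = 1 \/ p = 2)%N ->
  (forall T, measurable_fun setT (g T)) ->
  (forall e : R, (0 < e)%R -> exists T0 : R, forall T1 T2 : R,
     (T0 <= T1)%R -> (T0 <= T2)%R ->
     \int[mu]_x (`|g T1 x - g T2 x| ^+ p)%:E <= e%:E) ->
  exists v : X -> R, [/\ measurable_fun setT v,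
    (forall e : R, (0 < e)%R -> exists T0 : R, forall T : R, (T0 <= T)%R ->
     \int[mu]_x (`|g T x - v x| ^+ p)%:E <= e%:E) &
    exists t : nat -> R, {ae mu, forall x, g (t j) x @[j --> \oo] --> v x}].
Proof.
move=> pE mg cau.
have /choice[t0 t0P] : forall j, exists T0 : R, forall T1 T2 : R,
     (T0 <= T1)%R -> (T0 <= T2)%R ->
     \int[mu]_x (`|g T1 x - g T2 x| ^+ p)%:E <= (dyadic j ^+ 2)%:E.
  by move=> j; apply: cau; rewrite exprn_gt0// dyadic_gt0.
(* [t] is nondecreasing, passes the Cauchy threshold of step j, and is at least j so that it
   eventually passes any [T0]. *)
pose t := fix t (j : nat) : R :=
  (if j is i.+1 then Num.max (t i) (Num.max (t0 j) j%:R) else Num.max (t0 0%N) 0)%R.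
have t0t j : (t0 j <= t j)%R by case: j => [|j] /=; rewrite !le_max lexx ?orbT.
have nt j : (j%:R <= t j)%R by case: j => [|j] /=; rewrite !le_max lexx ?orbT.
have tS j : (t j <= t j.+1)%R by rewrite /= le_max lexx.
have [v [mv uv]] : exists v : X -> R, measurable_fun setT v /\
    {ae mu, forall x, g (t j) x @[j --> \oo] --> v x}.
  apply: (@ae_cvg_increments p (fun j => g (t j)) pE) => // j; apply: t0P => //.
  exact: le_trans (tS j).
exists v; split => //; last by exists t.
move=> e e0; have [T0 T0P] := cau e e0; exists T0 => T T0T.
apply: (@fatou_dist p (fun j => g (t j)) (g T) v e) => //.
exists (Num.trunc `|T0|).+1 => // j /= Tj; apply: T0P => //.
apply: le_trans (ler_norm _) _; apply: le_trans (nt j).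
apply: le_trans (ltW (truncnS_gt _)) _; by rewrite ler_nat.
Qed.

End toolbox.

(** * Integrable weights and local convergence in measure *)

Section weights.
Context {d : measure_display} {X : measurableType d} {R : realType}.
Variable mu : {measure set X -> \bar R}.
Local Open Scope ereal_scope.

(** Sum the indicators of the sets [F j] with coefficients [c j]: dividing [dyadic j] by 1 + mu(F_j)
    bounds both the sum and its integral by 1. The weight serves as the vector of L^2 and as the
    test weight for convergence in measure. *)
Lemma sigma_finite_weight : sigma_finite setT mu -> exists rho : X -> R,
  [/\ measurable_fun setT rho, forall x, (0 < rho x)%R, forall x, (rho x <= 1)%R &
      \int[mu]_x (rho x)%:E < +oo].
Proof.
move=> [F FT mF].
pose c j : R := (dyadic j / (1 + fine (mu (F j))))%R.
have den j : (1 <= 1 + fine (mu (F j)))%R by rewrite lerDl fine_ge0.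
have c0 j : (0 < c j)%R.
  by rewrite divr_gt0 ?dyadic_gt0//; exact: lt_le_trans ltr01 (den j).
have cd j : (c j <= dyadic j)%R.
  rewrite ler_pdivrMr; last exact: lt_le_trans ltr01 (den j).
  by rewrite ler_peMr// ltW// dyadic_gt0.
pose D j x := (c j * \1_(F j) x)%:E.
have D0 j x : 0 <= D j x by rewrite lee_fin mulr_ge0// ltW.
have mD j : measurable_fun setT (D j).
  apply/measurable_EFinP; apply: measurable_funM => //.
  by apply: measurable_indic; exact: (mF j).1.
pose G x := \sum_(j <oo) D j x.
have mG : measurable_fun setT G by exact: ge0_emeasurable_sum.
have G0 x : 0 <= G x by exact: nneseries_ge0.
have G1 x : G x <= 1.
  rewrite -sum_dyadic; apply: lee_nneseries => // j _.
  rewrite lee_fin; apply: le_trans (cd j).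
  by rewrite ler_piMr ?(ltW (c0 j))// indicE; case: (_ \in _).
have Gfin x : G x \is a fin_num.
  by rewrite ge0_fin_numE//; exact: le_lt_trans (G1 x) (ltry _).
exists (fun x => fine (G x)); split.
- exact: measurableT_comp.
- move=> x; have : [set: X] x by [].
  rewrite FT => -[j _ Fjx].
  rewrite -lte_fin fineK//; apply: (@lt_le_trans _ _ (D j x)).
    by rewrite lte_fin /= indicE mem_set// mulr1.
  apply: (@le_trans _ _ (\sum_(0 <= i < j.+1) D i x)).
    by rewrite big_nat_recr//= leeDr// sume_ge0.
  exact: nneseries_lim_ge.
- by move=> x; rewrite -lee_fin fineK.
- under eq_integral do rewrite fineK//.
  rewrite /G integral_nneseries//.
  apply: (@le_lt_trans _ _ 1); last exact: ltry.
  rewrite -sum_dyadic; apply: lee_nneseries => [j _ _|j _]; first exact: integral_ge0.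
  rewrite /D; under eq_integral do rewrite EFinM.
  rewrite ge0_integralZl//; last 2 first.
  + apply/measurable_EFinP; apply: measurable_indic; exact: (mF j).1.
  + by rewrite lee_fin ltW.
  rewrite integral_indic//; last exact: (mF j).1.
  rewrite setIT -(@fineK _ (mu (F j))); last first.
    by rewrite ge0_fin_numE//; exact: (mF j).2.
  rewrite -EFinM lee_fin /c mulrAC ler_pdivrMr; last exact: lt_le_trans ltr01 (den j).
  by rewrite ler_pM2l ?dyadic_gt0// lerDr.
Qed.

Lemma cvge0P (F : R -> \bar R) : (forall T, 0 <= F T) ->
  (forall e : R, (0 < e)%R -> exists T0 : R, forall T, (T0 <= T)%R -> F T <= e%:E) ->
  F T @[T --> +oo%R] --> 0.
Proof.
move=> F0 Fe; apply/fine_cvgP; split.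
  have [T0 T0P] := Fe 1%R ltr01.
  exists T0; split; first exact: num_real.
  move=> T /ltW /T0P FT1.
  by rewrite ge0_fin_numE//; exact: le_lt_trans FT1 (ltry _).
apply/cvgrPdist_le => e e0; have [T0 T0P] := Fe e e0.
exists T0; split; first exact: num_real.
move=> T /ltW /T0P FTe; rewrite sub0r normrN /=.
rewrite ger0_norm ?fine_ge0//.
by have := FTe; have := F0 T; case: (F T).
Qed.

(** The sets {rho <= 1/(k+1)} inside [B] decrease to the empty set, and mu(B) is finite, so one of
    them has small measure; outside it the weight is bounded below and Chebyshev applies. *)
Lemma weighted_stoch_cvg (g : R -> X -> R) (h rho : X -> R) :
  (forall T, measurable_fun setT (g T)) -> measurable_fun setT h ->
  measurable_fun setT rho -> (forall x, 0 < rho x)%R ->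
  (forall e : R, (0 < e)%R -> exists T0 : R, forall T, (T0 <= T)%R ->
    \int[mu]_x (Num.min 1 `|g T x - h x| * rho x)%:E <= e%:E) ->
  stoch_cvg mu g h.
Proof.
move=> mg mh mr r0 ge0 eps eps0 B mB Bfin.
have mgh T : measurable_fun setT (fun x => `|g T x - h x|)%R.
  by apply: measurableT_comp => //; exact: measurable_funB.
have mrle (k : R) : measurable [set x | (rho x <= k)%R].
  rewrite -[X in measurable X]setTI.
  have := measurable_fun_ler mr (@measurable_cst _ _ _ _ setT k).
  by move=> /(_ measurableT [set true]); exact.
pose E (k : nat) := B `&` [set x | (rho x <= (k.+1%:R)^-1)%R].
have mE k : measurable (E k) by exact: measurableI.
have Ecvg : mu (E k) @[k --> \oo] --> 0.
  have E00 : \bigcap_k E k = set0.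
    apply/seteqP; split => // x Ex.
    have := r0 x; rewrite ltNge => /negP; apply.
    apply/ler_addgt0Pl => e e0; rewrite addr0.
    have [_ /= rx] := Ex (Num.trunc e^-1) I; apply: le_trans rx _.
    by rewrite invf_ple ?posrE// ltW// truncnS_gt.
  have <- : mu (\bigcap_k E k) = 0 by rewrite E00 measure0.
  apply: nonincreasing_cvg_mu => //.
  - by apply: le_lt_trans Bfin; apply: le_measure; rewrite ?inE// => x [].
  - exact: bigcap_measurable.
  - move=> j k jk; apply/subsetPset => x [Bx] /= rx; split => //=.
    by apply: le_trans rx _; rewrite lef_pV2 ?posrE// ler_nat.
apply: cvge0P => // e e0.
have [k Ek] : exists k, mu (E k) <= (e / 2)%:E.
  have /fine_cvgP[Ef /cvgrPdist_le/(_ (e / 2)%R)] := Ecvg.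
  move=> /(_ (divr_gt0 e0 (ltr0n _ 2))) Ed.
  have [k [Efk]] := filter_ex (filterI Ef Ed).
  rewrite sub0r normrN ger0_norm ?fine_ge0// => kd; exists k.
  by rewrite -(fineK Efk) lee_fin.
pose kap := (k.+1%:R^-1 : R)%R.
have kap0 : (0 < kap)%R by rewrite invr_gt0.
(* The level is cut at 1 because the integrand is; on the bad set [A] the integrand is at least
   [m * kap]. *)
pose m := Num.min 1%R eps.
have m0 : (0 < m)%R by rewrite lt_min ltr01.
have [T0 T0P] := ge0 (e / 2 * (m * kap))%R (mulr_gt0 (divr_gt0 e0 (ltr0n _ 2))
    (mulr_gt0 m0 kap0)).
exists T0 => T /T0P IT.
pose A := [set x | (eps < `|g T x - h x|)%R] `&` (B `\` E k).
have meps : measurable [set x | (eps < `|g T x - h x|)%R].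
  rewrite -[X in measurable X]setTI.
  have := measurable_fun_ltr (@measurable_cst _ _ _ _ setT eps) (mgh T).
  by move=> /(_ measurableT [set true]); exact.
have mA : measurable A by apply: measurableI => //; exact: measurableD.
have A2 : mu A <= (e / 2)%:E.
  have mk0 : (0 < (m * kap))%R by exact: mulr_gt0.
  rewrite -(@lee_pmul2r _ (m * kap)%:E)//.
  rewrite -EFinM; apply: le_trans IT.
  rewrite muleC -integral_cst//.
  have mI : measurable_fun setT (fun x => (Num.min 1 `|g T x - h x| * rho x)%:E).
    apply/measurable_EFinP; apply: measurable_funM => //.
    exact: measurable_minr.
  have I0 x : 0 <= (Num.min 1 `|g T x - h x| * rho x)%:E.
    by rewrite lee_fin mulr_ge0// ?(ltW (r0 x))// le_min ler01 normr_ge0.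
  apply: (@le_trans _ _ (\int[mu]_(x in A) (Num.min 1 `|g T x - h x| * rho x)%:E)).
    apply: ge0_le_integral => //.
    - by move=> x _; rewrite lee_fin ltW.
    - exact: measurable_funTS.
    - move=> x [/= ex [Bx nE]]; rewrite lee_fin ler_pM ?(ltW m0) ?(ltW kap0)//.
        by rewrite le_min /m !ge_min lexx (ltW ex) orbT.
      rewrite leNgt; apply/negP => rk; apply: nE; split => //=.
      exact: ltW.
  exact: ge0_subset_integral.
apply: (@le_trans _ _ (mu (A `|` E k))).
  apply: le_measure; rewrite ?inE.
  - exact: measurableI.
  - exact: measurableU.
  - move=> x [ex Bx]; have [Ekx|nE] := pselect (E k x); first by right.
    by left.
apply: le_trans (measureU2 _ _ _) _ => //.
by rewrite [leRHS](_ : _ = (e / 2)%:E + (e / 2)%:E) ?leeD// -EFinD -splitr.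
Qed.

End weights.

(** * Tonelli *)

Section tonelli.
Context {R : realType} {dG dS : measure_display}.
Context {G : measurableType dG} {S : measurableType dS}.
Variables (lam : {sigma_finite_measure set G -> \bar R}).
Variables (mu : {sigma_finite_measure set S -> \bar R}).
Local Open Scope ereal_scope.

Definition jointly (F : G -> S -> \bar R) := measurable_fun setT (fun p : G * S => F
    p.1 p.2).

Lemma jointly1 F s : jointly F -> measurable_fun setT (F ^~ s).
Proof. by move=> mF; exact: (measurableT_comp mF (pair2_measurable s)). Qed.

Lemma jointly2 F t : jointly F -> measurable_fun setT (F t).
Proof. by move=> mF; exact: (measurableT_comp mF (pair1_measurable t)). Qed.

Let restr (D : set G) (F : G -> S -> \bar R) : G * S -> \bar R :=
  fun p => (F p.1 p.2) * (\1_D p.1)%:E.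

Let restr_ge0 D F : (forall t s, 0 <= F t s) -> forall p, 0 <= restr D F p.
Proof. by move=> F0 p; rewrite mule_ge0// lee_fin. Qed.

Let measurable_restr D F : measurable D -> jointly F ->
  measurable_fun setT (restr D F).
Proof.
move=> mD mF; apply: emeasurable_funM => //.
apply/measurable_EFinP.
by apply: (measurableT_comp (f := \1_D : G -> R)) => //; exact: measurable_indic.
Qed.

Let integral_restr D F s :
  \int[lam]_(t in D) F t s = \int[lam]_t restr D F (t, s).
Proof.
rewrite integral_mkcond; apply: eq_integral => t _; rewrite /restr patchE indicE /=.
by case: ifPn; rewrite ?mule1 ?mule0.
Qed.

Lemma measurable_integral_section (D : set G) F : measurable D -> jointly F ->
  (forall t s, 0 <= F t s) ->
  measurable_fun setT (fun s => \int[lam]_(t in D) F t s).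
Proof.
move=> mD mF F0; under eq_fun do rewrite integral_restr.
apply: (@measurable_fun_fubini_tonelli_G _ _ _ _ _ lam) => //.
  exact: measurable_restr.
exact: restr_ge0.
Qed.

Lemma measurable_integral_section2 F : jointly F -> (forall t s, 0 <= F t s) ->
  measurable_fun setT (fun t => \int[mu]_s F t s).
Proof.
move=> mF F0.
exact: (@measurable_fun_fubini_tonelli_F _ _ _ _ _ mu _ mF (fun p => F0 p.1 p.2)).
Qed.

Lemma tonelli_swap (D : set G) F : measurable D -> jointly F ->
  (forall t s, 0 <= F t s) ->
  \int[mu]_s \int[lam]_(t in D) F t s = \int[lam]_(t in D) \int[mu]_s F t s.
Proof.
move=> mD mF F0; under eq_integral do rewrite integral_restr.
rewrite -(@fubini_tonelli _ _ _ _ _ lam mu (restr D F) (measurable_restr mD mF)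
    (restr_ge0 D F0)).
rewrite [RHS]integral_mkcond; apply: eq_integral => t _; rewrite patchE.
have E s : restr D F (t, s) = F t s * (t \in D)%:R%:E by rewrite /restr indicE.
under eq_integral do rewrite E; case: ifPn => tD.
  by under eq_integral do rewrite mule1.
by under eq_integral do rewrite mule0; rewrite integral0.
Qed.

Lemma tonelli_swap_in (D : set G) (E : set S) F : measurable D -> measurable E ->
  jointly F -> (forall t s, 0 <= F t s) ->
  \int[mu]_(s in E) \int[lam]_(t in D) F t s =
  \int[lam]_(t in D) \int[mu]_(s in E) F t s.
Proof.
move=> mD mE mF F0.
have patchM (f : S -> \bar R) s : (f \_ E) s = f s * (\1_E s)%:E.
  by rewrite patchE indicE; case: ifPn; rewrite ?mule1 ?mule0.
have mI : measurable_fun setT (fun s => (\1_E s)%:E : \bar R).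
  by apply/measurable_EFinP; exact: measurable_indic.
have jF : jointly (fun t s => F t s * (\1_E s)%:E).
  by apply: emeasurable_funM => //; exact: (measurableT_comp mI measurable_snd).
rewrite integral_mkcond.
transitivity (\int[mu]_s \int[lam]_(t in D) (F t s * (\1_E s)%:E)).
  apply: eq_integral => s _; rewrite patchM ge0_integralZr//.
  exact/measurable_funTS/jointly1.
rewrite tonelli_swap//; last by move=> t s; rewrite mule_ge0// lee_fin.
apply: eq_integral => t _; rewrite [RHS]integral_mkcond.
by apply: eq_integral => s _; rewrite patchM.
Qed.

(** The null set in the hypothesis may depend on [t]. The indicator of disagreement has zero double
    integral, so for a.e. [s] the two sections agree for a.e. [t] in [D]. *)
Lemma ae_integral_section_eq (D : set G) F1 F2 : measurable D -> jointly F1 ->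
  jointly F2 -> (forall t s, 0 <= F1 t s) -> (forall t s, 0 <= F2 t s) ->
  (forall t, D t -> {ae mu, forall s, F1 t s = F2 t s}) ->
  {ae mu, forall s, \int[lam]_(t in D) F1 t s = \int[lam]_(t in D) F2 t s}.
Proof.
move=> mD mF1 mF2 F10 F20 F12.
pose E t s : \bar R := (F1 t s != F2 t s)%:R%:E.
have E0 t s : 0 <= E t s by rewrite lee_fin.
have mE : jointly E.
  apply/measurable_EFinP; apply: (@measurableT_comp _ _ _ _ _ _ (fun b : bool => b%:R
      : R)) => //.
  by apply: measurable_neg; exact: measurable_fun_eqe.
have : \int[mu]_s \int[lam]_(t in D) E t s = 0.
  rewrite tonelli_swap//; apply: integral0_eq => t Dt.
  rewrite (@ge0_ae_eq_int _ _ _ mu _ (cst 0))// ?integral0//.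
    exact: jointly2.
  by apply: filterS (F12 t Dt) => s e; rewrite /E e eqxx.
move=> /integral0_ae -/(_ (measurable_integral_section mD mE E0)).
move=> /(_ (fun s => integral_ge0 _ (fun t _ => E0 t s))).
apply: filterS => s Es; apply: ge0_ae_eq_integral => //.
- exact/measurable_funTS/jointly1.
- exact/measurable_funTS/jointly1.
have [+ _] := @ae_eq_integral_abs _ _ _ lam D mD (E ^~ s)
  (measurable_funTS (jointly1 s mE)).
under eq_integral do rewrite gee0_abs//.
move=> /(_ Es); apply: filterS => t /= /[apply] /eqP.
by rewrite /E eqe pnatr_eq0 eqb0 negbK => /eqP.
Qed.

End tonelli.

(** * Averages along a Folner sequence *)

(* Translation invariance of [lam] enters only through [B_shift]. *)
Record folner_flow (R : realType) (dG dS : measure_display)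
  (G : measurableType dG) (S : measurableType dS)
  (lam : {measure set G -> \bar R}) (mu : {measure set S -> \bar R})
  (zero : G) (add : G -> G -> G) (opp : G -> G) (B : R -> set G) (ell : R -> R)
  (phi : G -> S -> S) (w : G -> S -> R) : Prop := FolnerFlow {
  B_meas : forall T, measurable (B T);
  B_mono : forall T T', T <= T' -> B T `<=` B T';
  B_lam : forall T, lam (B T) = (ell T)%:E;
  ell_gt0 : forall T, 1 <= T -> 0 < ell T;
  ell_folner : forall m e : R, 0 < e -> exists T0 : R, forall T : R, T0 <= T ->
    (1 - e) * ell T <= ell (T - m);
  B_shift : forall (m T : R) u (F : G -> \bar R), measurable_fun setT F ->
    (forall t, (0 <= F t)%E) -> B m u ->
    (\int[lam]_(t in B (T - m)%R) F t <= \int[lam]_(t in B T) F (add t u))%E;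
  B_zero : B 1 zero;
  B_add : forall m m' u v, B m u -> B m' v -> B (m + m') (add u v);
  B_opp : forall m u, B m u -> B (m + 1) (opp u);
  flow_addC : commutative add;
  flow_addA : associative add;
  add_meas : measurable_fun setT (fun p : G * G => add p.1 p.2);
  phi_meas : measurable_fun setT (fun p : G * S => phi p.1 p.2);
  w_meas : measurable_fun setT (fun p : G * S => w p.1 p.2);
  w_ge0 : forall t s, 0 <= w t s;
  phi_zero : forall s, phi zero s = s;
  w_zero : forall s, w zero s = 1;
  phi_add : forall m m' t u s, B m t -> B m' u ->
    phi (add t u) s = phi t (phi u s);
  w_add : forall m m' t u s, B m t -> B m' u ->
    w (add t u) s = w u s * w t (phi u s);
  phi_opp : forall m u s, B m u -> phi (opp u) (phi u s) = s;
  w_opp : forall m u s, B m u -> w (opp u) (phi u s) * w u s = 1;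
  w_iso : forall m u (g : S -> \bar R), B m u -> measurable_fun setT g ->
    (forall s, (0 <= g s)%E) ->
    (\int[mu]_s ((w u s)%:E * g (phi u s)) = \int[mu]_s g s)%E }.

Section averages.
Context {R : realType} {dG dS : measure_display}.
Context {G : measurableType dG} {S : measurableType dS}.
Variables (lam : {sigma_finite_measure set G -> \bar R}).
Variables (mu : {sigma_finite_measure set S -> \bar R}).
Variables (zero : G) (add : G -> G -> G) (opp : G -> G) (B : R -> set G).
Variables (ell : R -> R) (phi : G -> S -> S) (w : G -> S -> R).
Hypothesis H : folner_flow lam mu zero add opp B ell phi w.
Local Open Scope ereal_scope.

(** The cocycle [a] is left free: [w] gives U_t on L^1 and [sqrtw w] gives V_t on L^2. Extended
    values spare any integrability condition on averages. *)
Definition transfer (a : G -> S -> R) (t : G) (g : S -> \bar R) (s : S) : \bar R :=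
  (a t s)%:E * g (phi t s).

Definition average (a : G -> S -> R) (T : R) (g : S -> \bar R) (s : S) : \bar R :=
  (ell T)^-1%:E * \int[lam]_(t in B T) transfer a t g s.

Lemma measurable_phi t : measurable_fun setT (phi t).
Proof. exact: (measurableT_comp (phi_meas H) (pair1_measurable t)). Qed.

Lemma measurable_add2 d (Z : measurableType d) (f g : Z -> G) :
  measurable_fun setT f -> measurable_fun setT g ->
  measurable_fun setT (fun z => add (f z) (g z)).
Proof.
move=> mf mg.
exact: (measurableT_comp (add_meas H) (measurable_fun_pair mf mg)).
Qed.

Lemma ell_inv_ge0 T : (1 <= T)%R -> 0 <= (ell T)^-1%:E.
Proof. by move=> T1; rewrite lee_fin ltW// invr_gt0 (ell_gt0 H). Qed.

Section cocycle.
Variable a : G -> S -> R.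
Hypothesis a_meas : measurable_fun setT (fun p : G * S => a p.1 p.2).
Hypothesis a_ge0 : forall t s, (0 <= a t s)%R.
Hypothesis a_add : forall m m' t u s, B m t -> B m' u ->
  a (add t u) s = (a u s * a t (phi u s))%R.
Variable g : S -> \bar R.
Hypothesis mg : measurable_fun setT g.
Hypothesis g0 : forall s, 0 <= g s.

Lemma transfer_ge0 t s : 0 <= transfer a t g s.
Proof. by rewrite mule_ge0// lee_fin. Qed.

Lemma jointly_transfer : jointly (fun t s => transfer a t g s).
Proof.
apply: emeasurable_funM; first exact/measurable_EFinP.
exact: (measurableT_comp mg (phi_meas H)).
Qed.

Lemma measurable_transfer t : measurable_fun setT (transfer a t g).
Proof. exact: (jointly2 t jointly_transfer). Qed.

Lemma average_ge0 T s : (1 <= T)%R -> 0 <= average a T g s.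
Proof.
move=> T1; rewrite mule_ge0 ?ell_inv_ge0//.
by apply: integral_ge0 => t _; exact: transfer_ge0.
Qed.

Lemma measurable_average T : measurable_fun setT (average a T g).
Proof.
apply: measurable_funeM; apply: measurable_integral_section.
- exact: (B_meas H).
- exact: jointly_transfer.
- exact: transfer_ge0.
Qed.

Lemma transferA m m' t u s : B m t -> B m' u ->
  transfer a u (transfer a t g) s = transfer a (add t u) g s.
Proof.
move=> Bt Bu; rewrite /transfer muleA -EFinM.
by rewrite (a_add _ Bt Bu) (phi_add H _ Bt Bu).
Qed.

Lemma transfer_average m u T s : B m u -> transfer a u (average a T g) s =
  (ell T)^-1%:E * \int[lam]_(t in B T) transfer a (add t u) g s.
Proof.
move=> Bu; rewrite /average {1}/transfer muleCA -ge0_integralZl//.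
- congr (_ * _); apply: eq_integral => t /[!inE] Bt.
  by rewrite -(transferA s Bt Bu).
- exact: (B_meas H).
- by apply: measurable_funTS; exact: (jointly1 _ jointly_transfer).
- by move=> t _; exact: transfer_ge0.
- by rewrite lee_fin.
Qed.

Lemma transfer_average_ge m u T s : (1 <= T)%R -> B m u ->
  (ell T)^-1%:E * \int[lam]_(t in B (T - m)%R) transfer a t g s <=
  transfer a u (average a T g) s.
Proof.
move=> T1 Bu; rewrite (transfer_average _ _ Bu) lee_wpmul2l ?ell_inv_ge0//.
apply: (B_shift H) => //; first exact: (jointly1 _ jointly_transfer).
by move=> t; exact: transfer_ge0.
Qed.

(** The composition averages, over [v] in [B T], integrals translated by v + u, which lies in
    [B (T + m)]. Each of them is bounded below by the same constant, so averaging over [v] loses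
    nothing. *)
Lemma average_transfer_average_ge m u T T' s : (1 <= T)%R -> (1 <= T')%R ->
  B m u ->
  (ell T')^-1%:E * \int[lam]_(t in B (T' - (T + m))%R) transfer a t g s <=
  average a T' (transfer a u (average a T g)) s.
Proof.
move=> T1 T'1 Bu; rewrite {1}/average lee_wpmul2l ?ell_inv_ge0//.
have mF : measurable_fun setT (fun t => transfer a t g s).
  exact: (jointly1 _ jointly_transfer).
set c := \int[lam]_(t in B (T' - (T + m))%R) _.
pose F t v := transfer a (add t (add v u)) g s.
have jF : jointly (fun v t => F t v).
  apply: (measurableT_comp mF).
  apply: measurable_add2 => //; apply: measurable_add2 => //.
have F0 v t : 0 <= F t v by exact: transfer_ge0.
have -> : \int[lam]_(t in B T') transfer a t (transfer a u (average a T g)) s =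
    \int[lam]_(t in B T') ((ell T)^-1%:E * \int[lam]_(v in B T) F t v).
  apply: eq_integral => t /[!inE] Bt.
  have Bw := B_add H Bu Bt.
  transitivity (transfer a (add u t) (average a T g) s).
    rewrite /transfer muleA -EFinM.
    by rewrite (a_add _ Bu Bt) (phi_add H _ Bu Bt).
  rewrite (transfer_average _ _ Bw); congr (_ * _).
  apply: eq_integral => v _; rewrite /F.
  by rewrite (flow_addC H t) (flow_addA H).
rewrite ge0_integralZl ?ell_inv_ge0//; last 3 first.
- exact: (B_meas H).
- apply: measurable_funTS; apply: (@measurable_integral_section _ _ _ _ _ lam _ (fun
    v t => F t v)) => //.
  exact: (B_meas H).
- by move=> t _; exact: integral_ge0.
(* The constant [c] is rewritten as its own average over [B T]. *)
apply: (@le_trans _ _ ((ell T)^-1%:E * \int[lam]_(v in B T) cst c v)).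
  rewrite integral_cst; last exact: (B_meas H).
  rewrite (B_lam H) muleCA -EFinM mulVf ?mule1//.
  by rewrite gt_eqF// (ell_gt0 H).
rewrite lee_wpmul2l ?ell_inv_ge0//.
(* After the swap v + u is fixed while [t] varies, which is the form of [B_shift]. *)
rewrite (@tonelli_swap_in _ _ _ _ _ lam lam _ _ (fun v t => F t v))//; [|exact:
    (B_meas H)..].
apply: ge0_le_integral => //.
- exact: (B_meas H).
- by move=> v _; apply: integral_ge0 => t _; exact: transfer_ge0.
- apply: measurable_funTS.
  apply: (@measurable_integral_section _ _ _ _ _ lam _ F) => //.
    exact: (B_meas H).
  apply: (measurableT_comp mF).
  by apply: measurable_add2 => //; apply: measurable_add2.
- move=> v Bv; apply: (B_shift H T' mF _ (B_add H Bv Bu)).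
  by move=> t; exact: transfer_ge0.
Qed.

End cocycle.

End averages.

(** * Mean ergodic theorem for the square-root action *)

(** Finite energies make both functions finite a.e., so the difference may be taken through [fine]
    and the identity is pointwise. Half the sum appears because its energy is the one bounded below
    later. *)
Lemma parallelogram_integral (R : realType) (d : measure_display)
  (X : measurableType d) (mu : {measure set X -> \bar R}) (x y : X -> \bar R) :
  measurable_fun setT x -> measurable_fun setT y ->
  (forall s, 0 <= x s)%E -> (forall s, 0 <= y s)%E ->
  (\int[mu]_s (x s ^+ 2) < +oo)%E -> (\int[mu]_s (y s ^+ 2) < +oo)%E ->
  (\int[mu]_s (`|fine (x s) - fine (y s)| ^+ 2)%:E +
   4%:E * \int[mu]_s ((2^-1%:E * (x s + y s)) ^+ 2) =
   2%:E * \int[mu]_s (x s ^+ 2) + 2%:E * \int[mu]_s (y s ^+ 2))%E.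
Proof.
move=> mx my x0 y0 Nx Ny.
have mxy : measurable_fun setT (fun s => 2^-1%:E * (x s + y s))%E.
  by apply: measurable_funeM; exact: emeasurable_funD.
have xy0 s : (0 <= 2^-1%:E * (x s + y s))%E.
  by rewrite mule_ge0// ?adde_ge0// lee_fin.
have md : measurable_fun setT (fun s => (`|fine (x s) - fine (y s)| ^+ 2)%:E).
  by apply: measurable_dist_pow; exact: measurableT_comp.
rewrite -!ge0_integralZl//;
  [|first [exact: measurable_sqre|by move=> s _; apply: expe_ge0]..].
rewrite -!ge0_integralD//;
  [|first [by apply: measurable_funeM; exact: measurable_sqre
          |by move=> s _; rewrite mule_ge0//; apply: expe_ge0]..].
apply: ge0_ae_eq_int.
- apply: emeasurable_funD => //.
  by apply: measurable_funeM; exact: measurable_sqre.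
- by apply: emeasurable_funD; apply: measurable_funeM; exact: measurable_sqre.
- by move=> s; rewrite adde_ge0// mule_ge0//; apply: expe_ge0.
- by move=> s; rewrite adde_ge0// mule_ge0//; apply: expe_ge0.
have fx := ae_fin_num_sqr mx x0 Nx; have fy := ae_fin_num_sqr my y0 Ny.
apply: filterS2 fx fy => s; case: (x s) => [a| |]//; case: (y s) => [b| |]// _ _ /=.
have e : (`|a - b| ^+ 2 + 4 * ((2^-1 * (a + b)) * (2^-1 * (a + b))) =
          2 * (a * a) + 2 * (b * b))%R.
  by rewrite real_normK ?num_real// expr2; field.
exact: (congr1 EFin e).
Qed.

Lemma energy_arith (R : realFieldType) (x y c e K del : R) :
  y < c + e / 2 -> (1 - del) * (1 - del) * x <= y -> del * x <= del * K ->
  0 <= del * del * x -> del * (4 * (K + 1)) <= e -> 0 < del -> x <= c + e.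
Proof. lra. Qed.

Lemma midpoint_arith (R : realFieldType) (c d N : R) : d * (4 * c) = c - N ->
  (1 - d) * (1 - d) * c <= N -> 0 <= d * d * c -> c <= N.
Proof. lra. Qed.

Lemma parallelogram_arith (R : realFieldType) (c e J N x y : R) : c <= N ->
  y <= c + e / 4 -> x <= c + e / 4 -> J + 4 * N = 2 * x + 2 * y -> J <= e.
Proof. lra. Qed.

Section mean_ergodic.
Context {R : realType} {dG dS : measure_display}.
Context {G : measurableType dG} {S : measurableType dS}.
Variables (lam : {sigma_finite_measure set G -> \bar R}).
Variables (mu : {sigma_finite_measure set S -> \bar R}).
Variables (zero : G) (add : G -> G -> G) (opp : G -> G) (B : R -> set G).
Variables (ell : R -> R) (phi : G -> S -> S) (w : G -> S -> R).
Hypothesis H : folner_flow lam mu zero add opp B ell phi w.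
Local Open Scope ereal_scope.

Definition sqrtw (t : G) (s : S) : R := Num.sqrt (w t s).

Local Notation V := (transfer phi sqrtw).
Local Notation A := (average lam B ell phi sqrtw).

Lemma sqrtw_meas : measurable_fun setT (fun p : G * S => sqrtw p.1 p.2).
Proof.
apply: (measurableT_comp (f := @Num.sqrt R)); last exact: (w_meas H).
by apply: continuous_measurable_fun; exact: sqrt_continuous.
Qed.

Lemma sqrtw_ge0 t s : (0 <= sqrtw t s)%R. Proof. exact: sqrtr_ge0. Qed.

Lemma sqrtw_add m m' t u s : B m t -> B m' u ->
  sqrtw (add t u) s = (sqrtw u s * sqrtw t (phi u s))%R.
Proof. by move=> Bt Bu; rewrite /sqrtw (w_add H s Bt Bu) sqrtrM ?(w_ge0 H). Qed.

(** Reduces the L^2 isometry of V to the isometry [w_iso] of U. *)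
Lemma sqr_transfer t g s : V t g s ^+ 2 = transfer phi w t (fun s => g s ^+ 2) s.
Proof.
rewrite /transfer !expe2 muleACA -EFinM -expr2 sqr_sqrtr//.
exact: (w_ge0 H).
Qed.

Section function.
Variable g : S -> \bar R.
Hypothesis mg : measurable_fun setT g.
Hypothesis g0 : forall s, 0 <= g s.

Lemma measurable_sqrt_transfer t : measurable_fun setT (V t g).
Proof. exact: (measurable_transfer H sqrtw_meas). Qed.

Lemma sqrt_transfer_ge0 t s : 0 <= V t g s. Proof. exact: (transfer_ge0 _ sqrtw_ge0). Qed.

Lemma measurable_sqrt_average T : measurable_fun setT (A T g).
Proof. exact: (measurable_average H sqrtw_meas sqrtw_ge0). Qed.

Lemma sqrt_average_ge0 T s : (1 <= T)%R -> 0 <= A T g s.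
Proof. exact: (average_ge0 H sqrtw_ge0). Qed.

Lemma energy_transfer m u : B m u ->
  \int[mu]_s (V u g s ^+ 2) = \int[mu]_s (g s ^+ 2).
Proof.
move=> Bu; under eq_integral do rewrite sqr_transfer.
apply: (w_iso H Bu); first exact: measurable_sqre.
by move=> s; exact: expe_ge0.
Qed.

(** Jensen at each point, then Tonelli and the isometry of each V_t. *)
Lemma energy_average T : (1 <= T)%R ->
  \int[mu]_s (A T g s ^+ 2) <= \int[mu]_s (g s ^+ 2).
Proof.
move=> T1.
have e0 := ell_gt0 H T1.
have jV2 : jointly (fun t s => V t g s ^+ 2).
  exact: measurable_sqre (jointly_transfer H sqrtw_meas mg).
have V20 t s : 0 <= V t g s ^+ 2 by apply: expe_ge0; exact: sqrt_transfer_ge0.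
have mI : measurable_fun setT (fun s => \int[lam]_(t in B T) (V t g s ^+ 2)).
  by apply: measurable_integral_section => //; exact: (B_meas H).
apply: (@le_trans _ _ (\int[mu]_s ((ell T)^-1%:E * \int[lam]_(t in B T) (V t g s ^+ 2)))).
  apply: ge0_le_integral => //.
  - by move=> s _; apply: expe_ge0; exact: sqrt_average_ge0.
  - by apply: measurable_sqre; exact: measurable_sqrt_average.
  - exact: measurable_funeM.
  - move=> s _; apply: sqr_average_le => //.
    + exact: (B_meas H).
    + exact: (B_lam H).
    + apply: measurable_funTS.
      exact: (jointly1 _ (jointly_transfer H sqrtw_meas mg)).
    + by move=> t; exact: sqrt_transfer_ge0.
rewrite ge0_integralZl//; last 2 first.
- by move=> s _; exact: integral_ge0.
- by rewrite lee_fin ltW// invr_gt0.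
rewrite tonelli_swap//; last exact: (B_meas H).
rewrite (eq_integral (cst (\int[mu]_s (g s ^+ 2)))); last first.
  by move=> t /[!inE] Bt; exact: (energy_transfer Bt).
rewrite integral_cst; last exact: (B_meas H).
by rewrite (B_lam H) muleCA -EFinM mulVf ?gt_eqF// mule1.
Qed.

End function.

Lemma average_half T x y s : measurable_fun setT x -> measurable_fun setT y ->
  (forall s, 0 <= x s) -> (forall s, 0 <= y s) -> (1 <= T)%R ->
  A T (fun s => 2^-1%:E * (x s + y s)) s = 2^-1%:E * (A T x s + A T y s).
Proof.
move=> mx my x0 y0 T1.
have mVx z : measurable_fun setT z -> measurable_fun (B T) (fun t => V t z s).
  move=> mz; apply: measurable_funTS.
  exact: (jointly1 _ (jointly_transfer H sqrtw_meas mz)).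
have V0 z t : (forall s, 0 <= z s) -> 0 <= V t z s.
  by move=> z0; exact: sqrt_transfer_ge0.
rewrite /average -ge0_muleDr; [|by apply: integral_ge0 => t _; exact: V0..].
rewrite [RHS]muleCA; congr (_ * _).
rewrite -ge0_integralD//;
  [|first [exact: (B_meas H)|by move=> t _; exact: V0|exact: mVx]..].
rewrite -ge0_integralZl//;
  [|first [exact: (B_meas H)|by apply: emeasurable_funD; exact: mVx
          |by move=> t _; rewrite adde_ge0// V0]..].
by apply: eq_integral => t _; rewrite /transfer muleCA ge0_muleDr.
Qed.

Section energy.
Variable k : S -> \bar R.
Hypothesis mk : measurable_fun setT k.
Hypothesis k0 : forall s, 0 <= k s.
Hypothesis Nk : \int[mu]_s (k s ^+ 2) < +oo.

Let al T := \int[mu]_s (A T k s ^+ 2).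

Let al_ge0 T : (1 <= T)%R -> 0 <= al T.
Proof. by move=> T1; apply: integral_ge0 => s _; apply: expe_ge0; exact:
    sqrt_average_ge0. Qed.

Let al_fin T : (1 <= T)%R -> al T \is a fin_num.
Proof.
move=> T1; rewrite ge0_fin_numE ?al_ge0//.
exact: le_lt_trans (energy_average mk k0 T1) Nk.
Qed.

Let c : R := inf [set fine (al T) | T in [set T | 1 <= T]%R].

Let c_lb : has_inf [set fine (al T) | T in [set T | 1 <= T]%R].
Proof.
split; first by exists (fine (al 1)), 1%R => //=.
by exists 0%R => _ [T /= T1 <-]; rewrite fine_ge0// al_ge0.
Qed.

Let c_le T : (1 <= T)%R -> c%:E <= al T.
Proof.
move=> T1; rewrite -(fineK (al_fin T1)) lee_fin.
by apply: ge_inf; [exact: c_lb.2|exists T].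
Qed.

(** Averaging contracts, so [z] has at least the energy of its average over the box T' = T + M. By
    hypothesis that average is at least ell T / ell T' times A_T k, and the Folner property makes
    the factor at least 1 - e. *)
Let energy_lower (z : S -> \bar R) (M e : R) : measurable_fun setT z ->
  (forall s, 0 <= z s) -> (0 < e < 1)%R ->
  (forall T s, (1 <= T)%R ->
    (ell T)^-1%:E * \int[lam]_(t in B (T - M)%R) V t k s <= A T z s) ->
  exists T0, forall T, (T0 <= T)%R ->
    ((1 - e) ^+ 2)%:E * al T <= \int[mu]_s (z s ^+ 2).
Proof.
move=> mz z0 /andP[e0 e1] zM.
have [T1 T1P] := ell_folner H M e0.
exists (Num.max 1 (Num.max (T1 - M) (1 - M)))%R => T.
rewrite !ge_max => /andP[T1le /andP[T1T MT]].
pose T' := (T + M)%R.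
have T'1 : (1 <= T')%R by rewrite -lerBlDr.
have TM : (T' - M)%R = T by rewrite addrK.
apply: le_trans (energy_average mz z0 T'1).
rewrite /al -ge0_integralZl//; last 3 first.
- by apply: measurable_sqre; exact: measurable_sqrt_average.
- by move=> s _; apply: expe_ge0; exact: sqrt_average_ge0.
- by rewrite lee_fin sqr_ge0.
apply: ge0_le_integral => //.
- by move=> s _; rewrite mule_ge0 ?lee_fin ?sqr_ge0//; apply: expe_ge0; exact:
    sqrt_average_ge0.
- by apply: measurable_funeM; apply: measurable_sqre; exact: measurable_sqrt_average.
- by apply: measurable_sqre; exact: measurable_sqrt_average.
move=> s _.
have -> : ((1 - e) ^+ 2)%:E * A T k s ^+ 2 = ((1 - e)%:E * A T k s) ^+ 2.
  by rewrite !expe2 [RHS]muleACA -EFinM -expr2.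
have e1' : (0 <= 1 - e)%R by rewrite subr_ge0 ltW.
rewrite lee_sqr; last 2 first.
- by rewrite mule_ge0 ?sqrt_average_ge0// lee_fin.
- exact: sqrt_average_ge0.
apply: le_trans (zM T' s T'1); rewrite TM /average muleA.
apply: lee_wpmul2r; first by apply: integral_ge0 => t _; exact: sqrt_transfer_ge0.
rewrite -EFinM lee_fin ler_pdivrMr ?(ell_gt0 H)//.
rewrite mulrC ler_pdivlMr ?(ell_gt0 H)//.
have := T1P T'; rewrite TM; apply.
by rewrite -lerBlDr.
Qed.

(** A_T1 k is presented as its own transfer by [zero], which lies in [B 1], to fit the iterated
    bound; hence the margin T1 + 1. *)
Let average_zero_ge T1 T s : (1 <= T1)%R -> (1 <= T)%R ->
  (ell T)^-1%:E * \int[lam]_(t in B (T - (T1 + 1))%R) V t k s <=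
  A T (V zero (A T1 k)) s.
Proof.
move=> T11 T1'.
exact: (average_transfer_average_ge H sqrtw_meas sqrtw_ge0 sqrtw_add mk k0 _ T11 T1'
    (B_zero H)).
Qed.

(** Energies are almost monotone: [energy_lower] with z = A_T1 k, for a nearly minimising T1, bounds
    all later energies, so the infimum is a limit. *)
Let energy_limit (e : R) : (0 < e)%R ->
  exists T0, forall T, (T0 <= T)%R -> (1 <= T)%R /\ al T <= (c + e)%:E.
Proof.
move=> e0.
have e20 : (0 < e / 2)%R by rewrite divr_gt0.
have [_ [T1 /= T11 <-] aT1] := inf_adherent e20 c_lb.
pose K := fine (\int[mu]_s (k s ^+ 2)).
have Kfin : \int[mu]_s (k s ^+ 2) = K%:E.
  rewrite fineK// ge0_fin_numE//; apply: integral_ge0 => s _; exact: expe_ge0.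
have K0 : (0 <= K)%R.
  by rewrite fine_ge0//; apply: integral_ge0 => s _; exact: expe_ge0.
(* All energies are at most [K], so the loss 2 del K is at most e / 2; the other half is the defect
   of [T1]. *)
pose del : R := Num.min (2^-1)%R (e / (4 * (K + 1)))%R.
have K40 : (0 < 4 * (K + 1))%R by nra.
have del0 : (0 < del)%R by rewrite lt_min invr_gt0 ltr0n divr_gt0.
have del1 : (del < 1)%R by rewrite gt_min invf_lt1 ?ltr1n.
have delK : (del * (4 * (K + 1)) <= e)%R.
  by rewrite -ler_pdivlMr// ge_min lexx orbT.
have mA1 := measurable_sqrt_average mk k0 T1; have A10 s := sqrt_average_ge0 k0 s T11.
have [|T0 T0P] := @energy_lower (V zero (A T1 k)) (T1 + 1)%R del
   (measurable_sqrt_transfer mA1 zero) (sqrt_transfer_ge0 A10 zero) _ (fun T s =>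
       @average_zero_ge T1 T s T11).
  by rewrite del0.
exists (Num.max 1 T0)%R => T; rewrite ge_max => /andP[T1' T0T]; split => //.
have := T0P T T0T; rewrite (energy_transfer mA1 A10 (B_zero H)).
have := energy_average mk k0 T1'; rewrite -/(al T) -/(al T1) Kfin.
rewrite -(fineK (al_fin T1')) -(fineK (al_fin T11)) -EFinM !lee_fin.
have := fine_ge0 (al_ge0 T1'); move: aT1; rewrite -/c.
move: (fine (al T)) (fine (al T1)) => x y yc x0 xK.
rewrite expr2 => xy.
have dxK : (del * x <= del * K)%R by rewrite ler_pM2l.
have ddx : (0 <= del * del * x)%R by rewrite !mulr_ge0// ltW.
exact: (energy_arith yc xy dxK ddx delK del0).
Qed.

(** [T0] does not depend on [u1] and [u2]: transfers preserve energy and only enlarge the margin in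
    the midpoint bound. The choice u1 = u, u2 = [zero] will give the invariance of the limit. *)
Lemma mean_ergodic_cauchy (e : R) : (0 < e)%R -> exists T0 : R,
  forall T1 T2 m1 m2 u1 u2, (T0 <= T1)%R -> (T0 <= T2)%R -> B m1 u1 -> B m2 u2 ->
  [/\ (1 <= T1)%R, (1 <= T2)%R &
  \int[mu]_s (`|fine (V u1 (A T1 k) s) - fine (V u2 (A T2 k) s)| ^+ 2)%:E <= e%:E].
Proof.
move=> e0; have e40 : (0 < e / 4)%R by rewrite divr_gt0.
have [T0 T0P] := energy_limit e40.
exists T0 => T1 T2 m1 m2 u1 u2 /T0P[T11 a1] /T0P[T21 a2] Bu1 Bu2; split => //.
have mA1 := measurable_sqrt_average mk k0 T1; have A10 s := sqrt_average_ge0 k0 s T11.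
have mA2 := measurable_sqrt_average mk k0 T2; have A20 s := sqrt_average_ge0 k0 s T21.
set x := V u1 (A T1 k); set y := V u2 (A T2 k).
have mx : measurable_fun setT x by exact: measurable_sqrt_transfer.
have my : measurable_fun setT y by exact: measurable_sqrt_transfer.
have x0 s : 0 <= x s by exact: sqrt_transfer_ge0.
have y0 s : 0 <= y s by exact: sqrt_transfer_ge0.
have Nx : \int[mu]_s (x s ^+ 2) = al T1 by exact: (energy_transfer mA1 A10 Bu1).
have Ny : \int[mu]_s (y s ^+ 2) = al T2 by exact: (energy_transfer mA2 A20 Bu2).
have al_lty T : (1 <= T)%R -> al T < +oo by move=> T1'; rewrite ltey_eq al_fin.
have := @parallelogram_integral _ _ _ mu x y mx my x0 y0.
rewrite Nx Ny => /(_ (al_lty _ T11) (al_lty _ T21)).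
set N := \int[mu]_s ((2^-1%:E * (x s + y s)) ^+ 2).
set I := \int[mu]_s _.
have mz : measurable_fun setT (fun s => 2^-1%:E * (x s + y s)).
  by apply: measurable_funeM; exact: emeasurable_funD.
have z0 s : 0 <= 2^-1%:E * (x s + y s) by rewrite mule_ge0// ?adde_ge0// lee_fin.
have I0 : 0 <= I by apply: integral_ge0 => s _; rewrite lee_fin.
have N0 : 0 <= N by apply: integral_ge0 => s _; exact: expe_ge0.
(* Averages of the midpoint dominate integrals of [k] over a box with margin [M], the larger of the
   two margins, so the energy of the midpoint cannot drop below [c]. *)
have cN : c%:E <= N.
  pose M := Num.max (T1 + m1)%R (T2 + m2)%R.
  have zM T s : (1 <= T)%R ->
    (ell T)^-1%:E * \int[lam]_(t in B (T - M)%R) V t k s <=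
    A T (fun s => 2^-1%:E * (x s + y s)) s.
    move=> T1'; rewrite average_half//.
    set L := _ * _.
    have sub z : (z <= M)%R -> L <= (ell T)^-1%:E * \int[lam]_(t in B (T - z)%R) V t k s.
      move=> zM; apply: lee_wpmul2l; first exact: (ell_inv_ge0 H).
      apply: ge0_subset_integral => //; try exact: (B_meas H).
      - apply: measurable_funTS.
        exact: (jointly1 _ (jointly_transfer H sqrtw_meas mk)).
      - by move=> t _; exact: sqrt_transfer_ge0.
      - by apply: (B_mono H); rewrite lerB.
    have L1 : L <= A T x s.
      apply: le_trans (average_transfer_average_ge H sqrtw_meas sqrtw_ge0 sqrtw_add
          mk k0 _ T11 T1' Bu1).
      by apply: sub; rewrite le_max lexx.
    have L2 : L <= A T y s.
      apply: le_trans (average_transfer_average_ge H sqrtw_meas sqrtw_ge0 sqrtw_add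
          mk k0 _ T21 T1' Bu2).
      by apply: sub; rewrite le_max lexx orbT.
    have L0 : 0 <= L.
      rewrite mule_ge0 ?(ell_inv_ge0 H)//.
      by apply: integral_ge0 => t _; exact: sqrt_transfer_ge0.
    move: (A T x s) (A T y s) L1 L2 => p q L1 L2.
    clear sub; clearbody L.
    apply: (@le_trans _ _ (2^-1%:E * (L + L))).
      case: L L0 {L1 L2} => [r| |//] _; last by rewrite gt0_muley// lte_fin.
      by rewrite -EFinD -EFinM lee_fin; lra.
    apply: lee_wpmul2l; first by rewrite lee_fin invr_ge0.
    by apply: leeD.
  move: N0; rewrite /N; set N' := \int[mu]_s _; move=> N0.
  have low (d : R) : (0 < d < 1)%R -> ((1 - d) ^+ 2 * c)%:E <= N'.
    move=> d01; have [T3 T3P] := energy_lower mz z0 d01 zM.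
    apply: le_trans (T3P (Num.max 1 T3)%R _); last by rewrite le_max lexx orbT.
    rewrite EFinM lee_wpmul2l ?lee_fin ?sqr_ge0//.
    by apply: c_le; rewrite le_max lexx.
  move: N0 low; case: N' => [N'| |//] N0 low; last exact: leey.
  rewrite lee_fin leNgt; apply/negP => Nc.
  move: N0; rewrite lee_fin => N0.
  have cc : (0 < c)%R by exact: le_lt_trans N0 Nc.
  (* With this d, (1 - 2 d) c is the mean of c and N', hence larger than N'. *)
  pose d := ((c - N') / (4 * c))%R.
  have dc : (d * (4 * c) = c - N')%R by rewrite /d divfK// gt_eqF// mulr_gt0.
  have d0 : (0 < d)%R by rewrite divr_gt0 ?subr_gt0// mulr_gt0.
  have d1 : (d < 1)%R by rewrite ltr_pdivrMr ?mulr_gt0//; lra.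
  have := low d; rewrite d0 d1 lee_fin => /(_ isT); rewrite expr2 => lowd.
  have ddc : (0 <= d * d * c)%R.
    exact: (mulr_ge0 (mulr_ge0 (ltW d0) (ltW d0)) (ltW cc)).
  by move: Nc; rewrite ltNge (midpoint_arith dc lowd ddc).
(* Parallelogram: 2 (c + e / 4) + 2 (c + e / 4) - 4 c = e. *)
move: a1 a2; rewrite -(fineK (al_fin T11)) -(fineK (al_fin T21)).
rewrite -!EFinM -EFinD !lee_fin => a1 a2.
clearbody I N; move: N N0 cN => [N| |//] _ cN.
  case: I I0 => [J| |//] _; last by rewrite -EFinM addye.
  rewrite -EFinM -EFinD lee_fin => -[] eq1.
  by move: cN; rewrite lee_fin => cN; exact: (parallelogram_arith cN a2 a1 eq1).
by rewrite gt0_muley ?lte_fin// addey//; move: I0; case: I.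
Qed.

End energy.

End mean_ergodic.

(** * The invariant density *)

(** At an infinite [x] both sides are 0, since [fine] sends both infinities to 0. *)
Lemma fine_mulEFin (R : realType) (r : R) (x : \bar R) : fine (r%:E * x)%E = r * fine x.
Proof.
case: x => [x| |] //=; rewrite mulr0.
  by rewrite mulry; case: sgrP => _; rewrite ?mul0e ?mul1e// mulN1e.
by rewrite mulrNy; case: sgrP => _; rewrite ?mul0e ?mul1e// mulN1e.
Qed.

Lemma ae0_of_small_integral (R : realType) (d : measure_display)
  (X : measurableType d) (mu : {measure set X -> \bar R}) (F : X -> \bar R) :
  measurable_fun setT F -> (forall x, 0 <= F x)%E ->
  (forall e : R, 0 < e -> (\int[mu]_x F x <= e%:E)%E) ->
  {ae mu, forall x, F x = 0%E}.
Proof.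
move=> mF F0 small; apply: integral0_ae => //; apply/eqP.
rewrite eq_le integral_ge0// andbT; apply/lee_addgt0Pr => e e0.
by rewrite add0e small.
Qed.

Section nonneg_integrals.
Context {R : realType} {d : measure_display} {X : measurableType d}.
Variable mu : {measure set X -> \bar R}.
Implicit Types f g : X -> \bar R.
Local Open Scope ereal_scope.

Lemma le_int f g : (forall x, 0 <= f x) -> measurable_fun setT f ->
  measurable_fun setT g -> (forall x, f x <= g x) ->
  \int[mu]_x f x <= \int[mu]_x g x.
Proof. by move=> f0 mf mg fg; apply: ge0_le_integral. Qed.

Lemma intD f g : (forall x, 0 <= f x) -> (forall x, 0 <= g x) ->
  measurable_fun setT f -> measurable_fun setT g ->
  \int[mu]_x (f x + g x) = \int[mu]_x f x + \int[mu]_x g x.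
Proof. by move=> f0 g0 mf mg; apply: ge0_integralD. Qed.

Lemma intZ (c : R) f : (0 <= c)%R -> (forall x, 0 <= f x) ->
  measurable_fun setT f -> \int[mu]_x (c%:E * f x) = c%:E * \int[mu]_x f x.
Proof. by move=> c0 f0 mf; apply: ge0_integralZl. Qed.

End nonneg_integrals.

Lemma sqr2_le (R : realFieldType) (a b : R) :
  b ^+ 2 <= 2 * (a * a) + 2 * `|a - b| ^+ 2.
Proof.
rewrite real_normK ?num_real//.
by have := sqr_ge0 (2 * a - b); rewrite !expr2; lra.
Qed.

Lemma sqr3_le (R : realFieldType) (a b c d : R) :
  `|a - d| ^+ 2 <= 3 * `|a - b| ^+ 2 + 3 * `|b - c| ^+ 2 + 3 * `|c - d| ^+ 2.
Proof.
rewrite !real_normK ?num_real//.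
have := sqr_ge0 ((a - b) - (b - c)); have := sqr_ge0 ((b - c) - (c - d)).
have := sqr_ge0 ((a - b) - (c - d)); rewrite !expr2; lra.
Qed.

Section invariant_density.
Context {R : realType} {dG dS : measure_display}.
Context {G : measurableType dG} {S : measurableType dS}.
Variables (lam : {sigma_finite_measure set G -> \bar R}).
Variables (mu : {sigma_finite_measure set S -> \bar R}).
Variables (zero : G) (add : G -> G -> G) (opp : G -> G) (B : R -> set G).
Variables (ell : R -> R) (phi : G -> S -> S) (w : G -> S -> R).
Hypothesis H : folner_flow lam mu zero add opp B ell phi w.
Local Open Scope ereal_scope.

Local Notation V := (transfer phi (sqrtw w)).
Local Notation A := (average lam B ell phi (sqrtw w)).

Lemma transfer_sqrt_zero g : V zero g = g.
Proof. apply/funext => s; by rewrite /transfer /sqrtw (w_zero H) sqrtr1 mul1e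
    (phi_zero H). Qed.

Lemma measurable_w t : measurable_fun setT (w t).
Proof. exact: (measurableT_comp (w_meas H) (pair1_measurable t)). Qed.

Lemma measurable_sqrtw t : measurable_fun setT (sqrtw w t).
Proof. exact: (measurableT_comp (sqrtw_meas H) (pair1_measurable t)). Qed.

(** [rho] is in L^2 because rho^2 <= rho. Invariance compares V_u h with h through V_u A_T rho and
    A_T rho, whose distance is small by the uniform Cauchy bound. *)
Lemma invariant_density (rho : S -> R) : measurable_fun setT rho ->
  (forall s, 0 < rho s)%R -> (forall s, rho s <= 1)%R ->
  \int[mu]_s (rho s)%:E < +oo ->
  exists h : S -> R, [/\ measurable_fun setT h, forall s, (0 <= h s)%R,
    \int[mu]_s (h s ^+ 2)%:E < +oo,
    (forall e : R, (0 < e)%R -> exists T0, forall T, (T0 <= T)%R -> (1 <= T)%R /\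
      \int[mu]_s (`|fine (A T (EFin \o rho) s) - h s| ^+ 2)%:E <= e%:E) &
    forall m u, B m u -> {ae mu, forall s, (sqrtw w u s * h (phi u s))%R = h s}].
Proof.
move=> mr r0 r1 Ir.
pose k : S -> \bar R := EFin \o rho.
have mk : measurable_fun setT k by exact/measurable_EFinP.
have k0 s : 0 <= k s by rewrite lee_fin ltW.
have Nk : \int[mu]_s (k s ^+ 2) < +oo.
  apply: le_lt_trans Ir; apply: ge0_le_integral => //.
  - by move=> s _; exact: expe_ge0.
  - exact: measurable_sqre.
  - by move=> s _; rewrite expe2 lee_fin ler_piMr// ltW.
pose g T s := fine (A T k s).
have mgT T : measurable_fun setT (g T).
  by apply: measurableT_comp => //; exact: (measurable_sqrt_average H).
have cau := mean_ergodic_cauchy H mk k0 Nk.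
have [v [mv gv _]] : exists v : S -> R, [/\ measurable_fun setT v,
    (forall e : R, (0 < e)%R -> exists T0 : R, forall T : R, (T0 <= T)%R ->
     \int[mu]_x (`|g T x - v x| ^+ 2)%:E <= e%:E) &
    exists t : nat -> R, {ae mu, forall x, g (t j) x @[j --> \oo] --> v x}].
  apply: lp_complete => //; first by right.
  move=> e e0; have [T0 T0P] := cau e e0; exists T0 => T1 T2 T01 T02.
  have [_ _] := T0P T1 T2 1%R 1%R zero zero T01 T02 (B_zero H) (B_zero H).
  by rewrite !transfer_sqrt_zero.
(* The absolute value makes the limit nonnegative everywhere; as [g T] is nonnegative for T >= 1, it
   does not increase the distance. *)
pose h (s : S) : R := `|v s|%R.
have mh : measurable_fun setT h by exact: measurableT_comp.
have gh (e : R) : (0 < e)%R -> exists T0, forall T, (T0 <= T)%R -> (1 <= T)%R /\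
      \int[mu]_s (`|g T s - h s| ^+ 2)%:E <= e%:E.
  move=> e0; have [T0 T0P] := gv e e0; exists (Num.max 1 T0)%R => T.
  rewrite ge_max => /andP[T1 T0T]; split => //; apply: le_trans (T0P T T0T).
  apply: ge0_le_integral => //.
  - exact: measurable_dist_pow.
  - exact: measurable_dist_pow.
  - move=> s _; rewrite lee_fin lerXn2r// ?nnegrE//.
    rewrite -{1}[g T s]ger0_norm; first exact: ler_dist_dist.
    by rewrite fine_ge0// (sqrt_average_ge0 H).
have mgh T : measurable_fun setT (fun s => (`|g T s - h s| ^+ 2)%:E).
  exact: measurable_dist_pow.
exists h; split => //.
- by move=> s; exact: normr_ge0.
- have [T0 /(_ T0 (lexx _))[T01 I1]] := gh 1%R ltr01.
  apply: (@le_lt_trans _ _ (\int[mu]_s (2%:E * A T0 k s ^+ 2 +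
     2%:E * (`|g T0 s - h s| ^+ 2)%:E))).
    have mA2 : measurable_fun setT (fun s => A T0 k s ^+ 2).
      by apply: measurable_sqre; exact: (measurable_sqrt_average H).
    apply: le_int.
    + by move=> s; rewrite lee_fin sqr_ge0.
    + by apply/measurable_EFinP; exact: measurable_funX.
    + by apply: emeasurable_funD; exact: measurable_funeM.
    + move=> s; rewrite /g; have := sqrt_average_ge0 H k0 s T01.
      case: (A T0 k s) => [a| |//] /= a0; last first.
        by rewrite gt0_muley// addye// leey.
      by rewrite lee_fin; exact: (@sqr2_le R a (h s)).
  have A20 s : 0 <= A T0 k s ^+ 2 by apply: expe_ge0; exact: (sqrt_average_ge0 H).
  have mA2 : measurable_fun setT (fun s => A T0 k s ^+ 2).
    by apply: measurable_sqre; exact: (measurable_sqrt_average H).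
  rewrite intD; [|by move=> s; rewrite mule_ge0// lee_fin
                 |by move=> s; rewrite mule_ge0// lee_fin
                 |exact: measurable_funeM|exact: measurable_funeM].
  rewrite !intZ//.
  apply: lte_add_pinfty; apply: lte_mul_pinfty => //.
    exact: le_lt_trans (energy_average H mk k0 T01) Nk.
  exact: le_lt_trans I1 (ltry _).
- move=> m u Bu.
  have mhu : measurable_fun setT (fun s => sqrtw w u s * h (phi u s))%R.
    apply: measurable_funM; first exact: measurable_sqrtw.
    exact: (measurableT_comp mh (measurable_phi H u)).
  have : {ae mu, forall s, (`|sqrtw w u s * h (phi u s) - h s| ^+ 2)%:E = 0}.
    apply: ae0_of_small_integral.
    - exact: measurable_dist_pow.
    - by move=> s; rewrite lee_fin.
    (* Three squared distances, each with the factor 3 of [sqr3_le]. *)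
    move=> e e0; have e9 : (0 < e / 9)%R by rewrite divr_gt0.
    have [T0 T0P] := gh _ e9; have [T1 T1P] := cau _ e9.
    pose T := Num.max T0 T1.
    have TT0 : (T0 <= T)%R by rewrite le_max lexx.
    have [T11 I1] := T0P T TT0.
    have TT1 : (T1 <= T)%R by rewrite le_max lexx orbT.
    have [_ _] := T1P T T m 1%R u zero TT1 TT1 Bu (B_zero H).
    rewrite transfer_sqrt_zero -/(g T) => I2.
    have mf2 : measurable_fun setT (fun s => fine (V u (A T k) s)).
      by apply: measurableT_comp => //; apply: (measurable_sqrt_transfer H); exact:
          (measurable_sqrt_average H).
    have I3 : \int[mu]_s (`|sqrtw w u s * h (phi u s) - fine (V u (A T k) s)| ^+ 2)%:E
       <= (e / 9)%:E.
      apply: le_trans I1; rewrite -(w_iso H Bu (mgh T)); last by move=> s; rewrite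
          lee_fin.
      rewrite le_eqVlt; apply/orP; left; apply/eqP; apply: eq_integral => s _.
      rewrite /transfer fine_mulEFin -mulrBr normrM exprMn -EFinM.
      rewrite (real_normK (num_real (sqrtw w u s))) sqr_sqrtr ?(w_ge0 H)//.
      by rewrite distrC.
    apply: (@le_trans _ _ (\int[mu]_s (3%:E * (`|sqrtw w u s * h (phi u s) - fine (V
        u (A T k) s)| ^+ 2)%:E
       + 3%:E * (`|fine (V u (A T k) s) - g T s| ^+ 2)%:E + 3%:E * (`|g T s - h s| ^+
           2)%:E))).
      apply: le_int.
      + by move=> s; rewrite lee_fin.
      + exact: measurable_dist_pow.
      + by do ?apply: emeasurable_funD; apply: measurable_funeM; exact:
          measurable_dist_pow.
      + by move=> s; rewrite -!EFinM -!EFinD lee_fin; exact: sqr3_le.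
    have d3 (x y : S -> R) s : 0 <= 3%:E * (`|x s - y s| ^+ 2)%:E.
      by rewrite mule_ge0// lee_fin.
    have m3 (x y : S -> R) : measurable_fun setT x -> measurable_fun setT y ->
        measurable_fun setT (fun s => 3%:E * (`|x s - y s| ^+ 2)%:E).
      by move=> mx my; apply: measurable_funeM; exact: measurable_dist_pow.
    rewrite intD; [|by move=> s; rewrite adde_ge0//; exact: d3|exact: d3
                   |by apply: emeasurable_funD; exact: m3|exact: m3].
    rewrite intD; [|exact: d3|exact: d3|exact: m3|exact: m3].
    rewrite !intZ//; [|first [exact: measurable_dist_pow|by move=> s; rewrite lee_fin]..].
    have -> : e%:E = 3%:E * (e / 9)%:E + 3%:E * (e / 9)%:E + 3%:E * (e / 9)%:E.
      by rewrite -!EFinM -!EFinD; congr EFin; field.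
    by rewrite !leeD// lee_pmul2l.
  apply: filterS => s /eqP; rewrite eqe sqrf_eq0 normr_eq0 subr_eq0.
  by move/eqP.
Qed.

End invariant_density.

(** * Averages in L^1 *)

Lemma almost_invariant_arith (R : realFieldType) (J r K dl e : R) :
  J + 2 * (r * K) <= K + K -> dl * (2 * (K + 1)) = e -> (1 - dl) * K <= r * K ->
  0 < dl -> J <= e.
Proof. lra. Qed.

Section L1.
Context {R : realType} {dG dS : measure_display}.
Context {G : measurableType dG} {S : measurableType dS}.
Variables (lam : {sigma_finite_measure set G -> \bar R}).
Variables (mu : {sigma_finite_measure set S -> \bar R}).
Variables (zero : G) (add : G -> G -> G) (opp : G -> G) (B : R -> set G).
Variables (ell : R -> R) (phi : G -> S -> S) (w : G -> S -> R).
Hypothesis H : folner_flow lam mu zero add opp B ell phi w.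
Local Open Scope ereal_scope.

Local Notation U := (transfer phi w).
Local Notation AU := (average lam B ell phi w).
Local Notation V := (transfer phi (sqrtw w)).
Local Notation A := (average lam B ell phi (sqrtw w)).

Lemma mass_transfer_ge0 g t s : (forall s, 0 <= g s) -> 0 <= U t g s.
Proof. by move=> g0; exact: (transfer_ge0 _ (w_ge0 H)). Qed.

Lemma jointly_mass_transfer g : measurable_fun setT g -> jointly (fun t s => U t g s).
Proof. by move=> mg; exact: (jointly_transfer H (w_meas H)). Qed.

Lemma mass_average_ge0 g T s : (forall s, 0 <= g s) -> (1 <= T)%R -> 0 <= AU T g s.
Proof. by move=> g0 T1; exact: (average_ge0 H (w_ge0 H)). Qed.

Lemma measurable_mass_average g T : measurable_fun setT g -> (forall s, 0 <= g s) ->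
  measurable_fun setT (AU T g).
Proof. by move=> mg g0; exact: (measurable_average H (w_meas H) (w_ge0 H)). Qed.

Lemma measurable_mass_transfer g t : measurable_fun setT g -> measurable_fun setT (U t g).
Proof. by move=> mg; exact: (measurable_transfer H (w_meas H)). Qed.

Lemma integral_mass_transfer m u g : measurable_fun setT g -> (forall s, 0 <= g s) ->
  B m u -> \int[mu]_s U u g s = \int[mu]_s g s.
Proof. by move=> mg g0 Bu; exact: (w_iso H Bu). Qed.

Lemma mass_average_add g1 g2 T s : measurable_fun setT g1 -> measurable_fun setT g2 ->
  (forall s, 0 <= g1 s) -> (forall s, 0 <= g2 s) ->
  AU T (fun s => g1 s + g2 s) s = AU T g1 s + AU T g2 s.
Proof.
move=> mg1 mg2 g10 g20; rewrite /average -ge0_muleDr; last 2 first.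
- by apply: integral_ge0 => t _; exact: mass_transfer_ge0.
- by apply: integral_ge0 => t _; exact: mass_transfer_ge0.
congr (_ * _).
have mV' z : measurable_fun setT z -> measurable_fun (B T) (fun t => U t z s).
  by move=> mz; apply: measurable_funTS; exact: (jointly1 _ (jointly_mass_transfer mz)).
rewrite -ge0_integralD//;
  [|first [exact: (B_meas H)|by move=> t _; exact: mass_transfer_ge0|exact: mV']..].
by apply: eq_integral => t _; rewrite /transfer ge0_muleDr.
Qed.

Lemma integral_section_scaled (D : set G) g : measurable D -> measurable_fun setT g ->
  (forall s, 0 <= g s) -> (forall t, D t -> exists m, B m t) ->
  \int[mu]_s \int[lam]_(t in D) U t g s = lam D * \int[mu]_s g s.
Proof.
move=> mD mg g0 DB; rewrite tonelli_swap//; last 2 first.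
- exact: jointly_mass_transfer.
- by move=> t s; exact: mass_transfer_ge0.
rewrite (eq_integral (cst (\int[mu]_s g s))); last first.
  by move=> t /[!inE] /DB[m Bt]; exact: (integral_mass_transfer mg g0 Bt).
by rewrite integral_cst// muleC.
Qed.

Lemma integral_mass_average T g : measurable_fun setT g -> (forall s, 0 <= g s) ->
  (1 <= T)%R -> \int[mu]_s AU T g s = \int[mu]_s g s.
Proof.
move=> mg g0 T1; rewrite intZ; last 3 first.
- by rewrite -lee_fin; exact: (ell_inv_ge0 H).
- by move=> s; apply: integral_ge0 => t _; exact: mass_transfer_ge0.
- apply: measurable_integral_section; first exact: (B_meas H).
    exact: jointly_mass_transfer.
  by move=> t s; exact: mass_transfer_ge0.
rewrite integral_section_scaled//; last 2 first.
- exact: (B_meas H).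
- by move=> t Bt; exists T.
by rewrite (B_lam H) muleA -EFinM mulVf ?mul1e// gt_eqF// (ell_gt0 H).
Qed.

(** For finite values |x - y| = x + y - 2 min(x, y); an infinite value makes the right-hand side
    infinite. *)
Lemma fine_dist_le (x y z : \bar R) : 0 <= z -> z <= x -> z <= y ->
  `|fine x - fine y|%:E + 2%:E * z <= x + y.
Proof.
case: z => [z| |//]; last first.
  by move=> _; rewrite !leye_eq => /eqP -> /eqP ->; rewrite leey.
case: x => [x| |]// z0; case: y => [y| |]//; rewrite ?lee_fin ?leey// => zx zy.
clear z0; rewrite /=; by have [xy|xy] := leP x y; [rewrite ler0_norm ?subr_le0|
   rewrite ger0_norm ?subr_ge0 ?(ltW xy)]; lra.
Qed.

(** U_u A_T g and A_T g have the same mass [K] and both dominate [z], whose mass is ell (T - M) /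
    ell T times [K]. Two functions sharing most of their mass are close in L^1. *)
Lemma almost_invariant g m u : measurable_fun setT g -> (forall s, 0 <= g s) ->
  \int[mu]_s g s < +oo -> B m u -> forall e : R, (0 < e)%R ->
  exists T0, forall T, (T0 <= T)%R -> (1 <= T)%R /\
  \int[mu]_s `|fine (U u (AU T g) s) - fine (AU T g s)|%:E <= e%:E.
Proof.
move=> mg g0 Ig Bu e e0.
pose K := fine (\int[mu]_s g s).
have Ig0 : 0 <= \int[mu]_s g s by exact: integral_ge0.
have KE : \int[mu]_s g s = K%:E by rewrite fineK// ge0_fin_numE.
have K0 : (0 <= K)%R by exact: fine_ge0.
(* At least 1, so that the box [B M] contains [zero] as well as [u]. *)
pose M := Num.max m 1%R.
(* The distance is at most 2 K times this tolerance; K + 1 keeps the denominator positive. *)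
have del0 : (0 < e / (2 * (K + 1)))%R.
  by rewrite divr_gt0// mulr_gt0// ltr_wpDl.
have [T0 T0P] := ell_folner H M del0.
exists (Num.max 1 T0)%R => T; rewrite ge_max => /andP[T1 T0T]; split => //.
have Bu' : B M u by apply: (B_mono H _ Bu); rewrite le_max lexx.
have Bz : B M zero by apply: (B_mono H _ (B_zero H)); rewrite le_max lexx orbT.
have U0 g' : U zero g' = g'.
  by apply/funext => s; rewrite /transfer (w_zero H) mul1e (phi_zero H).
pose z s := (ell T)^-1%:E * \int[lam]_(t in B (T - M)%R) U t g s.
have zge v : B M v -> forall s, z s <= U v (AU T g) s.
  by move=> Bv s; exact: (transfer_average_ge H (w_meas H) (w_ge0 H) (w_add H) mg g0
      s T1 Bv).
have z0 s : 0 <= z s.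
  rewrite mule_ge0 ?(ell_inv_ge0 H)//; apply: integral_ge0 => t _; exact:
      mass_transfer_ge0.
have mI : measurable_fun setT (fun s => \int[lam]_(t in B (T - M)%R) U t g s).
  apply: measurable_integral_section; first exact: (B_meas H).
    exact: jointly_mass_transfer.
  by move=> t s; exact: mass_transfer_ge0.
have mz : measurable_fun setT z by exact: measurable_funeM.
have mAT := measurable_mass_average T mg g0.
have AT0 s := @mass_average_ge0 g T s g0 T1.
have md : measurable_fun setT (fun s => `|fine (U u (AU T g) s) - fine (AU T g s)|%:E).
  have := @measurable_dist_pow _ _ R 1 (fun s => fine (U u (AU T g) s)) (fun s =>
      fine (AU T g s)).
  by apply; apply: measurableT_comp => //; exact: measurable_mass_transfer.
have Iz : \int[mu]_s z s = (ell (T - M) / ell T * K)%:E.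
  rewrite intZ//; last 2 first.
  - by rewrite -lee_fin; exact: (ell_inv_ge0 H).
  - by move=> s; apply: integral_ge0 => t _; exact: mass_transfer_ge0.
  rewrite integral_section_scaled//; last 2 first.
  - exact: (B_meas H).
  - by move=> t Bt; exists (T - M)%R.
  by rewrite (B_lam H) KE -!EFinM mulrA (mulrC (_^-1)%R).
have : \int[mu]_s (`|fine (U u (AU T g) s) - fine (AU T g s)|%:E + 2%:E * z s) <=
    \int[mu]_s (U u (AU T g) s + AU T g s).
  apply: le_int.
  - by move=> s; apply: adde_ge0; [rewrite lee_fin|apply: mule_ge0].
  - by apply: emeasurable_funD => //; exact: measurable_funeM.
  - by apply: emeasurable_funD => //; exact: measurable_mass_transfer.
  - move=> s; apply: fine_dist_le => //; first exact: zge.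
    by rewrite -(U0 (AU T g)); exact: zge.
rewrite intD; [|by move=> s; rewrite lee_fin|by move=> s; rewrite mule_ge0|by
    []|exact: measurable_funeM].
rewrite intD; [|by move=> s; apply: mass_transfer_ge0|by []|exact:
    measurable_mass_transfer|by []].
rewrite intZ// (integral_mass_transfer mAT AT0 Bu) integral_mass_average// KE Iz.
have : 0 <= \int[mu]_s `|fine (U u (AU T g) s) - fine (AU T g s)|%:E.
  by apply: integral_ge0 => s _; rewrite lee_fin.
case: (\int[mu]_s _) => [J| |//]; last by rewrite -!EFinM -EFinD addye// leye_eq.
move=> _; rewrite -!EFinM -!EFinD !lee_fin => JK.
have := T0P T T0T => fol.
have rT : (1 - e / (2 * (K + 1)) <= ell (T - M) / ell T)%R.
  by rewrite ler_pdivlMr// (ell_gt0 H).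
move: (ell (T - M) / ell T)%R rT JK => r rT JK.
have eK : (e / (2 * (K + 1)) * (2 * (K + 1)) = e)%R.
  by rewrite divfK// gt_eqF// mulr_gt0// ltr_wpDl.
move: (e / (2 * (K + 1)))%R del0 rT eK => dl dl0 rT eK.
have rK : ((1 - dl) * K <= r * K)%R by rewrite ler_wpM2r.
exact: (almost_invariant_arith JK eK rK dl0).
Qed.

End L1.

(** * L^1 convergence on the support of the invariant density *)

Lemma amgm_weighted (R : realFieldType) (eta x d : R) : 0 < eta ->
  x * d <= eta / 2 * x ^+ 2 + (2 * eta)^-1 * d ^+ 2.
Proof.
move=> eta0; rewrite -subr_ge0.
rewrite (_ : _ - _ = (2 * eta)^-1 * (eta * x - d) ^+ 2).
  by rewrite mulr_ge0 ?sqr_ge0// invr_ge0 mulr_ge0// ltW.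
by rewrite !expr2; field; rewrite gt_eqF.
Qed.

(** Used with x = h(s), with [a1], [a2] two averages of k and [r1], [r2] those of the remainder: the
    product is split between h^2 and the squared L^2 distance. *)
Lemma cauchy_arith (R : realFieldType) (eta x a1 a2 r1 r2 : R) : 0 < eta ->
  0 <= x -> 0 <= r1 -> 0 <= r2 ->
  `|(x * a1 + r1) - (x * a2 + r2)| <=
  (eta / 2 * x ^+ 2 + (2 * eta)^-1 * `|a1 - a2| ^+ 2) + (r1 + r2).
Proof.
move=> eta0 x0 r10 r20.
have -> : (x * a1 + r1) - (x * a2 + r2) = x * (a1 - a2) + (r1 - r2) by ring.
apply: le_trans (ler_normD _ _) _; apply: lerD; last first.
  by apply: le_trans (ler_normB _ _) _; rewrite !ger0_norm.
by rewrite normrM (ger0_norm x0) amgm_weighted.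
Qed.

Lemma le_infty_sum (R : realType) (a c : R) (x y : \bar R) : (0 <= x)%E ->
  (0 <= y)%E -> x = +oo%E \/ y = +oo%E -> (a%:E <= c%:E + (x + y))%E.
Proof.
by case: x => [x| |]//; case: y => [y| |]// _ _ [] //= _; rewrite leey.
Qed.

Lemma eta_arith (R : realFieldType) (eta x e : R) : eta * (2 * (x + 1)) = e ->
  0 < eta -> eta / 2 * x + e / 4 + (e / 4 + e / 4) <= e.
Proof. lra. Qed.

Section positive_part.
Context {R : realType} {dG dS : measure_display}.
Context {G : measurableType dG} {S : measurableType dS}.
Variables (lam : {sigma_finite_measure set G -> \bar R}).
Variables (mu : {sigma_finite_measure set S -> \bar R}).
Variables (zero : G) (add : G -> G -> G) (opp : G -> G) (B : R -> set G).
Variables (ell : R -> R) (phi : G -> S -> S) (w : G -> S -> R).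
Hypothesis H : folner_flow lam mu zero add opp B ell phi w.
Local Open Scope ereal_scope.

Local Notation U := (transfer phi w).
Local Notation AU := (average lam B ell phi w).
Local Notation V := (transfer phi (sqrtw w)).
Local Notation A := (average lam B ell phi (sqrtw w)).

Variable h : S -> R.
Hypothesis mh : measurable_fun setT h.
Hypothesis h0 : forall s, (0 <= h s)%R.
Hypothesis Nh : \int[mu]_s (h s ^+ 2)%:E < +oo.
Hypothesis hinv : forall m u, B m u ->
  {ae mu, forall s, (sqrtw w u s * h (phi u s))%R = h s}.

(** Invariance turns w_t h(phi_t) into h sqrt(w_t), for each [t] off a null set;
    [ae_integral_section_eq] removes the dependence of that set on [t]. *)
Lemma mass_average_density (k : S -> R) T : measurable_fun setT k ->
  (forall s, 0 <= k s)%R ->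
  {ae mu, forall s, AU T (fun s => (h s * k s)%:E) s = (h s)%:E * A T (EFin \o k) s}.
Proof.
move=> mk k0.
have mk' : measurable_fun setT (EFin \o k) by exact/measurable_EFinP.
have jV := jointly_transfer H (sqrtw_meas H) mk'.
have V0 t s : 0 <= V t (EFin \o k) s by rewrite sqrt_transfer_ge0// => s'; rewrite
    lee_fin.
have E : {ae mu, forall s, \int[lam]_(t in B T) U t (fun s => (h s * k s)%:E) s =
    \int[lam]_(t in B T) ((h s)%:E * V t (EFin \o k) s)}.
  apply: ae_integral_section_eq.
  - exact: (B_meas H).
  - apply: (jointly_mass_transfer H); apply/measurable_EFinP; exact: measurable_funM.
  - apply: emeasurable_funM; last exact: jV.
    apply/measurable_EFinP; exact: (measurableT_comp mh measurable_snd).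
  - by move=> t s; apply: (mass_transfer_ge0 H) => s'; rewrite lee_fin mulr_ge0.
  - by move=> t s; rewrite mule_ge0// lee_fin.
  - move=> t Bt; apply: filterS (hinv Bt) => s e.
    rewrite /transfer /= -e -!EFinM; congr EFin.
    have -> : w t s = (sqrtw w t s * sqrtw w t s)%R.
      by rewrite -expr2 sqr_sqrtr// (w_ge0 H).
    by ring.
apply: filterS E => s Es; rewrite /average Es ge0_integralZl//.
- by rewrite muleCA.
- exact: (B_meas H).
- by apply: measurable_funTS; exact: (jointly1 s jV).
- by rewrite lee_fin.
Qed.

Definition on_support (f : S -> R) (s : S) : R := if (0 < h s)%R then f s else 0%R.

Lemma measurable_support : measurable_fun setT (fun s => (0 < h s)%R).
Proof. exact: measurable_fun_ltr. Qed.

Lemma measurable_on_support f : measurable_fun setT f ->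
  measurable_fun setT (on_support f).
Proof. by move=> mf; apply: measurable_fun_ifT => //; exact: measurable_support. Qed.

Lemma on_support_ge0 f : (forall s, 0 <= f s)%R -> forall s, (0 <= on_support f s)%R.
Proof. by move=> f0 s; rewrite /on_support; case: ifP. Qed.

Lemma on_support_le f : (forall s, 0 <= f s)%R -> forall s, (on_support f s <= f s)%R.
Proof. by move=> f0 s; rewrite /on_support; case: ifP. Qed.

Section integrable_function.
Variable f : S -> R.
Hypothesis mf : measurable_fun setT f.
Hypothesis f0 : forall s, (0 <= f s)%R.
Hypothesis If : \int[mu]_s (f s)%:E < +oo.

Let small (n : nat) s : bool := (f s <= n%:R * h s ^+ 2)%R.

Let msmall n : measurable_fun setT (small n).
Proof.
apply: measurable_fun_ler => //; apply: measurable_funM => //.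
exact: measurable_funX.
Qed.

(* k is f / h where f <= n h^2: there k <= n h, so k is in L^2. *)
Lemma density_approximation (e : R) : (0 < e)%R -> exists k r : S -> R,
  [/\ measurable_fun setT k /\ measurable_fun setT r,
      forall s, (0 <= k s)%R, forall s, (0 <= r s)%R &
  [/\ forall s, on_support f s = (h s * k s + r s)%R,
      \int[mu]_s ((EFin \o k) s ^+ 2) < +oo &
      \int[mu]_s (r s)%:E <= e%:E]].
Proof.
move=> e0.
pose k n s : R := if (0 < h s)%R && small n s then (f s * (h s)^-1)%R else 0%R.
pose r n s : R := if (0 < h s)%R && small n s then 0%R else on_support f s.
have mb n : measurable_fun setT (fun s => (0 < h s)%R && small n s).
  by apply: measurable_and => //; exact: measurable_support.
have mk n : measurable_fun setT (k n).
  apply: measurable_fun_ifT => //; apply: measurable_funM => //.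
  rewrite (_ : (fun s => (h s)^-1)%R = (fun s => h s `^ (-1))%R).
    exact: (measurableT_comp (measurable_powR _) mh).
  by apply/funext => s; rewrite powR_inv1.
have mr n : measurable_fun setT (r n).
  by apply: measurable_fun_ifT => //; exact: measurable_on_support.
have r0 n s : (0 <= r n s)%R.
  by rewrite /r; case: ifP => // _; exact: on_support_ge0.
have rf n s : (r n s <= f s)%R.
  by rewrite /r; case: ifP => // _; exact: on_support_le.
(* The remainders are dominated by [f] and vanish at each point from some n on, since f <= n h^2
   eventually wherever h > 0. *)
have rcvg : \int[mu]_s (r n s)%:E @[n --> \oo] --> \int[mu]_s (cst 0 s).
  have [] := @dominated_convergence _ _ _ mu setT measurableT (fun n s => (r n s)%:E)
      (cst 0)
     (EFin \o f) _ _ _ _ _ => //.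
  - by move=> n; exact/measurable_EFinP.
  - apply: aeW => s _; apply: cvg_near_cst.
    have [hs|hs] := ltP 0%R (h s); last first.
      by apply: nearW => n; rewrite /r /on_support ltNge hs.
    exists (Num.trunc (f s / h s ^+ 2)).+1 => // n /= ns.
    rewrite /r hs /small /= ifT//.
    rewrite -ler_pdivrMr ?exprn_gt0//.
    by apply: le_trans (ltW (truncnS_gt _)) _; rewrite ler_nat.
  - apply/integrableP; split; first exact/measurable_EFinP.
    by under eq_integral do rewrite gee0_abs ?lee_fin//.
  - by apply: aeW => s n _; rewrite gee0_abs lee_fin.
have [n rn] : exists n, \int[mu]_s (r n s)%:E <= e%:E.
  move: rcvg; rewrite integral0 => /fine_cvgP[rf' /cvgrPdist_le/(_ _ e0) rd].
  have [n [nf]] := filter_ex (filterI rf' rd).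
  rewrite sub0r normrN ger0_norm ?fine_ge0 ?integral_EFin_ge0// => ne; exists n.
  by rewrite -(fineK nf) lee_fin.
exists (k n), (r n); split => //.
- by move=> s; rewrite /k; case: ifP => // _; rewrite mulr_ge0// invr_ge0.
split => //.
- move=> s; rewrite /k /r /on_support.
  have [hs|hs] /= := ltP 0%R (h s); last by rewrite mulr0 addr0.
  by case: ifP => _; rewrite ?mulr0 ?add0r// addr0 mulrCA mulfV ?mulr1// gt_eqF.
- apply: (@le_lt_trans _ _ (\int[mu]_s ((n%:R ^+ 2)%:E * (h s ^+ 2)%:E))).
    apply: le_int.
    + by move=> s; apply: expe_ge0; rewrite lee_fin /k; case: ifP => // _; rewrite
        mulr_ge0// invr_ge0.
    + by apply: measurable_sqre; exact/measurable_EFinP.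
    + by apply: measurable_funeM; apply/measurable_EFinP; exact: measurable_funX.
    + move=> s; rewrite expe2 -!EFinM lee_fin -expr2 -exprMn lerXn2r ?nnegrE ?mulr_ge0//.
        by rewrite /k; case: ifP => // _; rewrite mulr_ge0// invr_ge0.
      rewrite /k; case: ifP => [/andP[hs]|_]; last by rewrite mulr_ge0.
      by rewrite /small ler_pdivrMr// expr2 mulrA.
  rewrite intZ ?exprn_ge0//; last 2 first.
  + by move=> s; rewrite lee_fin sqr_ge0.
  + by apply/measurable_EFinP; exact: measurable_funX.
  by apply: lte_mul_pinfty => //; rewrite ?lee_fin ?sqr_ge0.
Qed.

Let fP := on_support f.
Let mfP : measurable_fun setT (EFin \o fP).
Proof. by apply/measurable_EFinP; exact: measurable_on_support. Qed.
Let fP0 s : 0 <= (EFin \o fP) s.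
Proof. by rewrite lee_fin; exact: on_support_ge0. Qed.
Let g T s := fine (AU T (EFin \o fP) s).
Let mg T : measurable_fun setT (g T).
Proof. by apply: measurableT_comp => //; exact: (measurable_mass_average H). Qed.
Let IfP : \int[mu]_s (EFin \o fP) s < +oo.
Proof.
apply: le_lt_trans If; apply: le_int => //; first exact/measurable_EFinP.
by move=> s; rewrite lee_fin; exact: on_support_le.
Qed.

(** The function is h k + r: the first term averages to h A_T k, for which the L^2 Cauchy property
    of k suffices, and the remainder keeps its small mass under averaging. *)
Lemma positive_part_cauchy (e : R) : (0 < e)%R -> exists T0, forall T1 T2,
  (T0 <= T1)%R -> (T0 <= T2)%R -> \int[mu]_s (`|g T1 s - g T2 s| ^+ 1)%:E <= e%:E.
Proof.
move=> e0; have e4 : (0 < e / 4)%R by rewrite divr_gt0.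
have [k [r [[mk mr] k0 r0 [fE Nk Ir]]]] := density_approximation e4.
have mk' : measurable_fun setT (EFin \o k) by exact/measurable_EFinP.
have mr' : measurable_fun setT (EFin \o r) by exact/measurable_EFinP.
have k0' s : 0 <= (EFin \o k) s by rewrite lee_fin.
have r0' s : 0 <= (EFin \o r) s by rewrite lee_fin.
pose Hh := fine (\int[mu]_s (h s ^+ 2)%:E).
have Ih0 : 0 <= \int[mu]_s (h s ^+ 2)%:E.
  by apply: integral_EFin_ge0 => s; exact: sqr_ge0.
have Hh0 : (0 <= Hh)%R by exact: fine_ge0.
have HhE : \int[mu]_s (h s ^+ 2)%:E = Hh%:E by rewrite fineK// ge0_fin_numE.
(* Makes eta / 2 times the energy of h at most e / 4. *)
pose eta := (e / (2 * (Hh + 1)))%R.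
have eta0 : (0 < eta)%R by rewrite divr_gt0// mulr_gt0// ltr_wpDl.
have etaE : (eta * (2 * (Hh + 1)) = e)%R.
  by rewrite divfK// gt_eqF// mulr_gt0// ltr_wpDl.
(* Multiplied by (2 eta)^-1 this tolerance is e / 4; the two remainders account for the other
   quarters. *)
have del0 : (0 < eta * e / 2)%R by rewrite divr_gt0// mulr_gt0.
have [T0 T0P] := mean_ergodic_cauchy H mk' k0' Nk del0.
exists T0 => T1 T2 T01 T02.
have [T11 T21] := T0P T1 T2 1%R 1%R zero zero T01 T02 (B_zero H) (B_zero H).
rewrite !(transfer_sqrt_zero H) => Id.
pose d s : R := `|fine (A T1 (EFin \o k) s) - fine (A T2 (EFin \o k) s)|%R.
have md : measurable_fun setT (fun s => (d s ^+ 2)%:E).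
  by apply: measurable_dist_pow; apply: measurableT_comp => //; exact:
      (measurable_sqrt_average H).
have mh2 : measurable_fun setT (fun s => (h s ^+ 2)%:E).
  by apply/measurable_EFinP; exact: measurable_funX.
have mA1 := measurable_mass_average H T1 mr' r0'; have mA2 := measurable_mass_average
    H T2 mr' r0'.
have A10 s : 0 <= AU T1 (EFin \o r) s by exact: (mass_average_ge0 H).
have A20 s : 0 <= AU T2 (EFin \o r) s by exact: (mass_average_ge0 H).
have split_AU T : (1 <= T)%R -> {ae mu, forall s, A T (EFin \o k) s \is a fin_num /\
    AU T (EFin \o fP) s = (h s)%:E * A T (EFin \o k) s + AU T (EFin \o r) s}.
  move=> TT; have fin : {ae mu, forall s, A T (EFin \o k) s \is a fin_num}.
    apply: ae_fin_num_sqr; first exact: (measurable_sqrt_average H).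
      by move=> s; exact: (sqrt_average_ge0 H).
    exact: le_lt_trans (energy_average H mk' k0' TT) Nk.
  apply: filterS2 fin (mass_average_density T mk k0) => s sfin <-; split => //.
  rewrite -(mass_average_add H)//; last 2 first.
  - by apply/measurable_EFinP; exact: measurable_funM.
  - by move=> s'; rewrite lee_fin mulr_ge0.
  by congr (AU T _ s); apply/funext => s' /=; rewrite -EFinD -fE.
have c1 : (0 <= eta / 2)%R by rewrite divr_ge0// ltW.
have c2 : (0 <= (2 * eta)^-1)%R by rewrite invr_ge0 mulr_ge0// ltW.
have c1' : 0 <= (eta / 2)%:E by rewrite lee_fin.
have c2' : 0 <= (2 * eta)^-1%:E by rewrite lee_fin.
have h20 s : 0 <= (h s ^+ 2)%:E by rewrite lee_fin sqr_ge0.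
have d20 s : 0 <= (d s ^+ 2)%:E by rewrite lee_fin sqr_ge0.
apply: (@le_trans _ _ (\int[mu]_s (((eta / 2)%:E * (h s ^+ 2)%:E +
   (2 * eta)^-1%:E * (d s ^+ 2)%:E) +
   (AU T1 (EFin \o r) s + AU T2 (EFin \o r) s)))).
  apply: ge0_ae_le_int.
  - exact: measurable_dist_pow.
  - by do 2?apply: emeasurable_funD => //; exact: measurable_funeM.
  - by move=> s; rewrite lee_fin expr1.
  - by move=> s; do 2?apply: adde_ge0 => //; apply: mule_ge0.
  apply: filterS2 (split_AU T1 T11) (split_AU T2 T21) => s [fin1 E1] [fin2 E2].
  have := A10 s; have := A20 s; rewrite /g expr1 E1 E2 /d.
  case: (AU T1 _ s) => [r1| |//]; last first.
    by move=> x20 x10; rewrite -!EFinM -EFinD; apply: le_infty_sum => //; left.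
  case: (AU T2 _ s) => [r2| |//]; last first.
    by move=> x20 x10; rewrite -!EFinM -EFinD; apply: le_infty_sum => //; right.
  rewrite -(fineK fin1) -(fineK fin2) !lee_fin /= => r20 r10.
  set a1 := fine _; set a2 := fine _.
  exact: cauchy_arith.
rewrite intD; [|by move=> s; apply: adde_ge0; apply: mule_ge0
               |by move=> s; apply: adde_ge0
               |by apply: emeasurable_funD; exact: measurable_funeM
               |exact: emeasurable_funD].
rewrite [X in X + _]intD; [|by move=> s; apply: mule_ge0
               |by move=> s; apply: mule_ge0
               |exact: measurable_funeM|exact: measurable_funeM].
rewrite [X in _ + X]intD// (intZ mu c1 h20 mh2) (intZ mu c2 d20 md) HhE.
rewrite !(integral_mass_average H)//.
apply: (@le_trans _ _ ((eta / 2)%:E * Hh%:E + (2 * eta)^-1%:E * (eta * e / 2)%:E +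
    ((e / 4)%:E + (e / 4)%:E))).
  apply: leeD; last by apply: leeD.
  apply: leeD => //; exact: lee_wpmul2l.
rewrite -!EFinM -!EFinD lee_fin.
have -> : ((2 * eta)^-1 * (eta * e / 2) = e / 4)%R.
  by field; rewrite gt_eqF.
exact: (eta_arith etaE eta0).
Qed.

(** Completeness of L^1 gives [ft]. For its invariance, U_u ft is close to U_u A_T f because U_u
    preserves L^1 distances, and U_u A_T f is close to A_T f by [almost_invariant]. *)
Lemma positive_part_limit : exists ft : S -> R,
  [/\ measurable_fun setT ft, \int[mu]_s `|ft s|%:E < +oo,
    forall e : R, (0 < e)%R -> exists T0, forall T, (T0 <= T)%R -> (1 <= T)%R /\
      \int[mu]_s `|fine (AU T (EFin \o on_support f) s) - ft s|%:E <= e%:E &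
    forall m u, B m u -> {ae mu, forall s, (w u s * ft (phi u s))%R = ft s}].
Proof.
have [ft [mft gft _]] := @lp_complete _ _ _ mu 1 g (or_introl erefl) mg
    positive_part_cauchy.
have mdist (x y : S -> R) : measurable_fun setT x -> measurable_fun setT y ->
    measurable_fun setT (fun s => `|x s - y s|%:E).
  by move=> mx my; exact: (@measurable_dist_pow _ _ R 1 x y).
have cvg (e : R) : (0 < e)%R -> exists T0, forall T, (T0 <= T)%R -> (1 <= T)%R /\
      \int[mu]_s `|g T s - ft s|%:E <= e%:E.
  move=> e0; have [T0 T0P] := gft e e0; exists (Num.max 1 T0)%R => T.
  by rewrite ge_max => /andP[T1 /T0P]; split.
have d0 (x y : S -> R) s : 0 <= `|x s - y s|%:E by rewrite lee_fin.
exists ft; split => //.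
- have [T0 /(_ T0 (lexx _))[T1 I1]] := cvg 1%R ltr01.
  have A0 s : 0 <= AU T0 (EFin \o fP) s by exact: (mass_average_ge0 H).
  have mA0 := measurable_mass_average H T0 mfP fP0.
  apply: (@le_lt_trans _ _ (\int[mu]_s (AU T0 (EFin \o fP) s + `|g T0 s - ft s|%:E))).
    apply: le_int.
    + by move=> s; rewrite lee_fin.
    + by apply/measurable_EFinP; exact: measurableT_comp.
    + by apply: emeasurable_funD => //; exact: mdist.
    + move=> s; rewrite /g; have := A0 s.
      case: (AU T0 _ s) => [a| |//] /= a0; last by rewrite addye// leey.
      rewrite lee_fin in a0; rewrite lee_fin.
      rewrite -{1}[ft s](subrK a) addrC; apply: le_trans (ler_normD _ _) _.
      by rewrite (ger0_norm a0) lerD2r distrC.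
  rewrite intD//; last exact: mdist.
  rewrite (integral_mass_average H)//; apply: lte_add_pinfty => //.
  exact: le_lt_trans I1 (ltry _).
- move=> m u Bu.
  have mwf : measurable_fun setT (fun s => w u s * ft (phi u s))%R.
    apply: measurable_funM; first exact: (measurable_w H).
    exact: (measurableT_comp mft (measurable_phi H u)).
  have : {ae mu, forall s, `|w u s * ft (phi u s) - ft s|%:E = 0}.
    apply: ae0_of_small_integral.
    - exact: mdist.
    - by move=> s; rewrite lee_fin.
    move=> e e0; have e3 : (0 < e / 3)%R by rewrite divr_gt0.
    have [T0 T0P] := cvg _ e3.
    have [T1 T1P] := almost_invariant H mfP fP0 IfP Bu e3.
    pose T := Num.max T0 T1.
    have TT0 : (T0 <= T)%R by rewrite le_max lexx.
    have TT1 : (T1 <= T)%R by rewrite le_max lexx orbT.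
    have [TT I1] := T0P T TT0; have [_ I2] := T1P T TT1.
    have mUA : measurable_fun setT (fun s => fine (U u (AU T (EFin \o fP)) s)).
      by apply: measurableT_comp => //; apply: (measurable_mass_transfer H); exact:
          (measurable_mass_average H).
    have I3 : \int[mu]_s `|w u s * ft (phi u s) - fine (U u (AU T (EFin \o fP)) s)|%:E
        <= (e / 3)%:E.
      apply: le_trans I1; rewrite -(w_iso H Bu (mdist _ _ (mg T) mft)); last exact: d0.
      rewrite le_eqVlt; apply/orP; left; apply/eqP; apply: eq_integral => s _.
      rewrite /transfer fine_mulEFin -mulrBr normrM -EFinM.
      by rewrite (ger0_norm (w_ge0 H u s)) distrC.
    apply: (@le_trans _ _ (\int[mu]_s (`|w u s * ft (phi u s) - fine (U u (AU T (EFin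
        \o fP)) s)|%:E
       + `|fine (U u (AU T (EFin \o fP)) s) - g T s|%:E + `|g T s - ft s|%:E))).
      apply: le_int.
      + exact: d0.
      + exact: mdist.
      + by do 2?apply: emeasurable_funD; exact: mdist.
      + move=> s; rewrite -!EFinD lee_fin.
        apply: le_trans (ler_distD (g T s) _ _) _; rewrite lerD2r.
        exact: ler_distD.
    rewrite intD; [|by move=> s; apply: adde_ge0; rewrite lee_fin|by move=> s;
        rewrite lee_fin
                   |by apply: emeasurable_funD; exact: mdist|exact: mdist].
    rewrite intD; [|by move=> s; rewrite lee_fin|by move=> s; rewrite lee_fin|exact:
        mdist|exact: mdist].
    have -> : e%:E = (e / 3)%:E + (e / 3)%:E + (e / 3)%:E.
      by rewrite -!EFinD; congr EFin; field.
    by rewrite !leeD.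
  apply: filterS => s /eqP; rewrite eqe normr_eq0 subr_eq0.
  by move/eqP.
Qed.

End integrable_function.
End positive_part.

(** * Vanishing of the averages where the invariant density is zero *)

Lemma null_part_arith (R : realFieldType) (eta x e : R) :
  eta * (2 * (x + 1)) = e -> 0 < eta -> eta / 2 * x + e / 4 <= e / 2.
Proof. lra. Qed.

(** Truncation pays off here: min(1, b) <= sqrt b, so control of the square root of an average
    controls its truncated size. *)
Lemma min_sqrt_arith (R : rcfType) (a b c r : R) : 0 <= b -> 0 <= r <= 1 ->
  Num.min 1 `|a + b - c| * r <= `|a - c| + Num.sqrt b * r.
Proof.
move=> b0 /andP[r0 r1].
apply: (@le_trans _ _ ((`|a - c| + Num.sqrt b) * r)); last first.
  by rewrite mulrDl lerD2r ler_piMr.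
rewrite ler_wpM2r//.
have [b1|b1] := leP 1 (Num.sqrt b).
  apply: (@le_trans _ _ 1); first by rewrite ge_min lexx.
  by rewrite -[1]add0r lerD.
apply: (@le_trans _ _ `|a + b - c|); first by rewrite ge_min lexx orbT.
rewrite addrAC; apply: le_trans (ler_normD _ _) _; rewrite lerD2l ger0_norm//.
by rewrite -{1}(sqr_sqrtr b0) expr2 ler_piMl ?sqrtr_ge0// ltW.
Qed.

(** [c] stands for the size of the box over the prescribed normalisation; its deviation from 1 is
    charged to the integrable limit p - q. *)
Lemma min_combination_arith (R : realFieldType) (c x y p q r : R) :
  0 <= c <= 2 -> 0 <= r <= 1 ->
  Num.min 1 `|c * (x - y) - (p - q)| * r <=
  2 * (Num.min 1 `|x - p| * r) + 2 * (Num.min 1 `|y - q| * r) +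
  `|c - 1| * `|p - q|.
Proof.
move=> /andP[c0 c2] /andP[r0 r1].
set D := `|c - 1| * `|p - q|.
have D0 : 0 <= D by rewrite mulr_ge0.
have tri : `|c * (x - y) - (p - q)| <= 2 * `|x - p| + 2 * `|y - q| + D.
  have -> : c * (x - y) - (p - q) = c * (x - p) - c * (y - q) + (c - 1) * (p - q) by ring.
  apply: le_trans (ler_normD _ _) _; rewrite normrM -/D lerD2r.
  apply: le_trans (ler_normB _ _) _; rewrite !normrM (ger0_norm c0).
  by apply: lerD; rewrite ler_wpM2r.
apply: (@le_trans _ _ ((2 * Num.min 1 `|x - p| + 2 * Num.min 1 `|y - q| + D) * r)).
  rewrite ler_wpM2r//; move: tri (normr_ge0 (x - p)) (normr_ge0 (y - q)).
  move: `|x - p| `|y - q| `|_ - (p - q)| => A B E tri A0 B0.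
  by case: (ltP 1 E) => ?; case: (ltP 1 A) => ?; case: (ltP 1 B) => ?; lra.
rewrite mulrDl; apply: lerD; first by rewrite mulrDl !mulrA.
by rewrite ler_piMr.
Qed.

Section null_part.
Context {R : realType} {dG dS : measure_display}.
Context {G : measurableType dG} {S : measurableType dS}.
Variables (lam : {sigma_finite_measure set G -> \bar R}).
Variables (mu : {sigma_finite_measure set S -> \bar R}).
Variables (zero : G) (add : G -> G -> G) (opp : G -> G) (B : R -> set G).
Variables (ell : R -> R) (phi : G -> S -> S) (w : G -> S -> R).
Hypothesis H : folner_flow lam mu zero add opp B ell phi w.
Local Open Scope ereal_scope.

Local Notation U := (transfer phi w).
Local Notation AU := (average lam B ell phi w).
Local Notation V := (transfer phi (sqrtw w)).
Local Notation A := (average lam B ell phi (sqrtw w)).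

Variables h rho : S -> R.
Hypothesis mh : measurable_fun setT h.
Hypothesis h0 : forall s, (0 <= h s)%R.
Hypothesis hinv : forall m u, B m u ->
  {ae mu, forall s, (sqrtw w u s * h (phi u s))%R = h s}.
Hypothesis mrho : measurable_fun setT rho.
Hypothesis rho0 : forall s, (0 <= rho s)%R.
Hypothesis Nrho : \int[mu]_s (rho s ^+ 2)%:E < +oo.
Hypothesis rho_h : forall e : R, (0 < e)%R -> exists T0, forall T, (T0 <= T)%R ->
  (1 <= T)%R /\ \int[mu]_s (`|fine (A T (EFin \o rho) s) - h s| ^+ 2)%:E <= e%:E.

Variable F : S -> R.
Hypothesis mF : measurable_fun setT F.
Hypothesis F0 : forall s, (0 <= F s)%R.
Hypothesis IF : \int[mu]_s (F s)%:E < +oo.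
Hypothesis Fh : forall s, (0 < h s)%R -> F s = 0%R.

Let mF' : measurable_fun setT (EFin \o F). Proof. exact/measurable_EFinP. Qed.
Let F0' s : 0 <= (EFin \o F) s. Proof. by rewrite lee_fin. Qed.
Let mrho' : measurable_fun setT (EFin \o rho). Proof. exact/measurable_EFinP. Qed.
Let rho0' s : 0 <= (EFin \o rho) s. Proof. by rewrite lee_fin. Qed.

Let v T s : R := Num.sqrt (fine (AU T (EFin \o F) s)).

Let mv T : measurable_fun setT (v T).
Proof.
apply: (measurableT_comp (f := @Num.sqrt R)).
  by apply: continuous_measurable_fun; exact: sqrt_continuous.
by apply: measurableT_comp => //; exact: (measurable_mass_average H).
Qed.

Let v0 T s : (0 <= v T s)%R. Proof. exact: sqrtr_ge0. Qed.

(** {h > 0} is invariant up to null sets: where h(s) > 0 also h(phi_t s) > 0, and there [F]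
    vanishes. So A_T F stays on {h = 0}. *)
Lemma average_null_density T : (1 <= T)%R ->
  {ae mu, forall s, (h s)%:E * AU T (EFin \o F) s = 0}.
Proof.
move=> T1.
have jU := jointly_mass_transfer H mF'.
have U0 t s : 0 <= U t (EFin \o F) s by exact: (mass_transfer_ge0 H).
have E : {ae mu, forall s, \int[lam]_(t in B T) ((h s)%:E * U t (EFin \o F) s) =
    \int[lam]_(t in B T) (cst 0 t)}.
  apply: (@ae_integral_section_eq _ _ _ _ _ _ _ _ (fun t s => (h s)%:E * U t (EFin \o
      F) s) (fun _ _ => 0)).
  - exact: (B_meas H).
  - apply: emeasurable_funM; last exact: jU.
    apply/measurable_EFinP; exact: (measurableT_comp mh measurable_snd).
  - exact: measurable_cst.
  - by move=> t s; rewrite mule_ge0// lee_fin.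
  - by [].
  - move=> t Bt; apply: filterS (hinv Bt) => s e.
    rewrite /transfer /= -e -!EFinM; congr EFin.
    have [hs|hs] := ltP 0%R (h (phi t s)); first by rewrite (Fh hs) !mulr0.
    have -> : h (phi t s) = 0%R by apply/eqP; rewrite eq_le hs h0.
    by rewrite mulr0 mul0r.
apply: filterS E => s; rewrite integral0 ge0_integralZl//; last 3 first.
- exact: (B_meas H).
- by apply: measurable_funTS; exact: (jointly1 s jU).
- by rewrite lee_fin.
by rewrite /average muleCA => ->; rewrite mule0.
Qed.

(* V_t is dual to V_(opp t), to which the lower bound applies. *)
Lemma sqrt_average_duality m t T : (1 <= T)%R -> (1 <= T - (m + 1))%R -> B m t ->
  (Num.sqrt (ell (T - (m + 1)) / ell T))%:E *
    \int[mu]_s (v (T - (m + 1)) s * rho s)%:E <=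
  \int[mu]_s ((v T s)%:E * V t (EFin \o rho) s).
Proof.
move=> T1 T'1 Bt.
set T' := (T - (m + 1))%R in T'1 *.
set r := (ell T' / ell T)%R.
have r0 : (0 <= r)%R by rewrite divr_ge0// ltW// (ell_gt0 H).
pose u := opp t.
(* The half-open box is not symmetric, hence radius m + 1 and the loss m + 1 in the statement. *)
have Bu : B (m + 1)%R u by exact: (B_opp H).
pose X := AU T (EFin \o F).
have mX : measurable_fun setT X by exact: (measurable_mass_average H).
have X0 s : 0 <= X s by exact: (mass_average_ge0 H).
have finU : {ae mu, forall s, U u X s \is a fin_num}.
  apply: ae_fin_num; first exact: (measurable_mass_transfer H).
    by move=> s; exact: (mass_transfer_ge0 H).
  by rewrite (integral_mass_transfer H mX X0 Bu) (integral_mass_average H).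
(* This is V_u v_T times rho, with a single square root so that the lower bound for U_u A_T F
   applies under it. *)
pose g s : \bar R := (Num.sqrt (w u s * fine (X (phi u s))) * rho s)%:E.
have mg : measurable_fun setT g.
  apply/measurable_EFinP; apply: measurable_funM => //.
  apply: (measurableT_comp (f := @Num.sqrt R)).
    by apply: continuous_measurable_fun; exact: sqrt_continuous.
  apply: measurable_funM; first exact: (measurable_w H).
  by apply: measurableT_comp => //; exact: (measurableT_comp mX (measurable_phi H u)).
have g0 s : 0 <= g s by rewrite lee_fin mulr_ge0// sqrtr_ge0.
have mvr : measurable_fun setT (fun s => (v T' s * rho s)%:E).
  by apply/measurable_EFinP; exact: measurable_funM.
have vr0 s : 0 <= (v T' s * rho s)%:E by rewrite lee_fin mulr_ge0.
rewrite -(intZ mu (sqrtr_ge0 r) vr0 mvr).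
apply: (@le_trans _ _ (\int[mu]_s g s)).
  apply: ge0_ae_le_int => //.
  - exact: measurable_funeM.
  - by move=> s; rewrite mule_ge0// lee_fin sqrtr_ge0.
  apply: filterS finU => s Ufin.
  rewrite -EFinM lee_fin mulrA ler_wpM2r//.
  rewrite -sqrtrM// ler_wsqrtr// -!fine_mulEFin.
  have le1 : r%:E * AU T' (EFin \o F) s <= U u X s.
    have := transfer_average_ge H (w_meas H) (w_ge0 H) (w_add H) mF' F0' s T1 Bu.
    apply: le_trans; rewrite -/T' /average muleA -EFinM.
    by rewrite /r mulrAC mulfV ?mul1r// gt_eqF// (ell_gt0 H).
  apply: fine_le => //.
  rewrite ge0_fin_numE; first by apply: le_lt_trans le1 _; rewrite ltey_eq Ufin.
  by rewrite mule_ge0 ?lee_fin//; exact: (mass_average_ge0 H).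
(* Change of variables by phi_t: the integrand gains the factor w_t(s), and w_u(phi_t s) w_t(s) = 1
   leaves sqrt(w_t(s)). *)
rewrite -(w_iso H Bt mg g0) le_eqVlt; apply/orP; left; apply/eqP.
apply: eq_integral => s _; rewrite /g /u (phi_opp H s Bt) /transfer /= -!EFinM.
congr EFin; rewrite sqrtrM ?(w_ge0 H)// /v -/X mulrA mulrA; congr (_ * _)%R.
have := w_opp H s Bt; move: (w_ge0 H (opp t) (phi t s)) (w_ge0 H t s).
rewrite /sqrtw; move: (w (opp t) (phi t s)) (w t s) => a b a0 b0 ab.
rewrite mulrA mulrC; congr (_ * _)%R.
by rewrite -{1}(sqr_sqrtr b0) expr2 -mulrA -sqrtrM// mulrC [(b * a)%R]mulrC ab sqrtr1
    mul1r.
Qed.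

(** The bound of [sqrt_average_duality] has the same left side for every [t] in [B m]; averaging
    over [t] and Tonelli turn its right side into the pairing with A_m rho. *)
Lemma null_part_bound m T : (1 <= m)%R -> (1 <= T)%R -> (1 <= T - (m + 1))%R ->
  (Num.sqrt (ell (T - (m + 1)) / ell T))%:E *
    \int[mu]_s (v (T - (m + 1)) s * rho s)%:E <=
  \int[mu]_s ((v T s)%:E * A m (EFin \o rho) s).
Proof.
move=> m1 T1 T'1; set c := _ * _.
have jV := jointly_transfer H (sqrtw_meas H) mrho'.
have V0 t s : 0 <= V t (EFin \o rho) s by exact: sqrt_transfer_ge0.
have jvV : jointly (fun t s => (v T s)%:E * V t (EFin \o rho) s).
  apply: emeasurable_funM; last exact: jV.
  by apply/measurable_EFinP; exact: (measurableT_comp (mv T) measurable_snd).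
have vV0 t s : 0 <= (v T s)%:E * V t (EFin \o rho) s by rewrite mule_ge0// lee_fin.
have em := ell_gt0 H m1.
have -> : \int[mu]_s ((v T s)%:E * A m (EFin \o rho) s) =
   (ell m)^-1%:E * \int[mu]_s \int[lam]_(t in B m) ((v T s)%:E * V t (EFin \o rho) s).
  rewrite -intZ; last 3 first.
  - by rewrite invr_ge0 ltW.
  - by move=> s; exact: integral_ge0.
  - by apply: measurable_integral_section => //; exact: (B_meas H).
  apply: eq_integral => s _; rewrite ge0_integralZl ?lee_fin//; last 2 first.
  - exact: (B_meas H).
  - by apply: measurable_funTS; exact: (jointly1 s jV).
  by rewrite /average muleCA.
rewrite tonelli_swap//; last exact: (B_meas H).
apply: (@le_trans _ _ ((ell m)^-1%:E * \int[lam]_(t in B m) cst c t)).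
  rewrite integral_cst; last exact: (B_meas H).
  by rewrite (B_lam H) muleCA -EFinM mulVf ?mule1// gt_eqF.
apply: lee_wpmul2l; first by rewrite lee_fin invr_ge0 ltW.
apply: ge0_le_integral.
- exact: (B_meas H).
- move=> t _; rewrite /c mule_ge0// ?lee_fin ?sqrtr_ge0//.
  by apply: integral_EFin_ge0 => s; rewrite mulr_ge0.
- exact: measurable_cst.
- apply: measurable_funTS.
  exact: (@measurable_integral_section2 _ _ _ _ _ mu (fun t s => (v T s)%:E * V t
      (EFin \o rho) s)).
- by move=> t Bt; exact: sqrt_average_duality.
Qed.

(** With [m] fixed so that A_m rho is L^2-close to h, the pairing of v_T with A_m rho is one with
    A_m rho - h, while the energy of v_T remains the mass of [F]. *)
Lemma null_part_vanishes (e : R) : (0 < e)%R -> exists T0, forall T, (T0 <= T)%R ->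
  (1 <= T)%R /\ \int[mu]_s (v T s * rho s)%:E <= e%:E.
Proof.
move=> e0.
pose K := fine (\int[mu]_s (F s)%:E).
have IF0 : 0 <= \int[mu]_s (F s)%:E by exact: integral_EFin_ge0.
have KE : \int[mu]_s (F s)%:E = K%:E by rewrite fineK// ge0_fin_numE.
have K0 : (0 <= K)%R by exact: fine_ge0.
(* As in the Cauchy estimate, both terms of the weighted inequality become at most e / 4. *)
pose eta := (e / (2 * (K + 1)))%R.
have eta0 : (0 < eta)%R by rewrite divr_gt0// mulr_gt0// ltr_wpDl.
have etaE : (eta * (2 * (K + 1)) = e)%R.
  by rewrite divfK// gt_eqF// mulr_gt0// ltr_wpDl.
have del0 : (0 < eta * e / 2)%R by rewrite divr_gt0// mulr_gt0.
have [m /(_ m (lexx _))[m1 Im]] := rho_h del0.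
(* Tolerance 3/4 keeps the ratio of sizes at least 1/4, whose square root is the factor 1/2
   below. *)
have t34 : (0 < 3 / 4 :> R)%R by rewrite divr_gt0.
have [T0 T0P] := ell_folner H (m + 1)%R t34.
exists (Num.max 1 (T0 - (m + 1)))%R => T'; rewrite ge_max => /andP[T'1 T0T'].
split => //.
pose T := (T' + (m + 1))%R.
have TT' : (T - (m + 1) = T')%R by rewrite /T addrK.
have T1 : (1 <= T)%R by rewrite /T; lra.
have := @null_part_bound m T m1 T1; rewrite TT' => /(_ T'1).
have sr : (2^-1 <= Num.sqrt (ell T' / ell T))%R.
  have -> : (2^-1 = Num.sqrt (1 - 3 / 4) :> R)%R.
    have -> : (1 - 3 / 4 = 2^-1 ^+ 2 :> R)%R by rewrite expr2; field.
    by rewrite sqrtr_sqr ger0_norm.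
  apply: ler_wsqrtr; rewrite ler_pdivlMr ?(ell_gt0 H)//.
  have := T0P T; rewrite TT'; apply.
  by rewrite /T; lra.
set I := \int[mu]_s (v T' s * rho s)%:E => le1.
have I0 : 0 <= I by apply: integral_EFin_ge0 => s; rewrite mulr_ge0.
have {le1} : 2^-1%:E * I <= \int[mu]_s ((v T s)%:E * A m (EFin \o rho) s).
  by apply: le_trans le1; rewrite lee_wpmul2r// lee_fin.
have mA' : measurable_fun setT (A m (EFin \o rho)) by exact: (measurable_sqrt_average H).
have A0' s : 0 <= A m (EFin \o rho) s by exact: (sqrt_average_ge0 H).
pose dd s : R := `|fine (A m (EFin \o rho) s) - h s|%R.
have mdd : measurable_fun setT (fun s => (dd s ^+ 2)%:E).
  by apply: measurable_dist_pow => //; exact: measurableT_comp.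
have mX := measurable_mass_average H T mF' F0'.
have X0 s : 0 <= AU T (EFin \o F) s by exact: (mass_average_ge0 H).
have dd0 s : 0 <= (dd s ^+ 2)%:E by rewrite lee_fin sqr_ge0.
have c1 : (0 <= eta / 2)%R by rewrite divr_ge0// ltW.
have c2 : (0 <= (2 * eta)^-1)%R by rewrite invr_ge0 mulr_ge0// ltW.
have c1' : 0 <= (eta / 2)%:E by rewrite lee_fin.
have c2' : 0 <= (2 * eta)^-1%:E by rewrite lee_fin.
have le2 : \int[mu]_s ((v T s)%:E * A m (EFin \o rho) s) <=
   \int[mu]_s ((eta / 2)%:E * AU T (EFin \o F) s + (2 * eta)^-1%:E * (dd s ^+ 2)%:E).
  apply: ge0_ae_le_int.
  - apply: emeasurable_funM => //; exact/measurable_EFinP.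
  - by apply: emeasurable_funD; exact: measurable_funeM.
  - by move=> s; rewrite mule_ge0// lee_fin.
  - by move=> s; apply: adde_ge0; apply: mule_ge0.
  have finA : {ae mu, forall s, A m (EFin \o rho) s \is a fin_num}.
    apply: ae_fin_num_sqr => //.
    apply: le_lt_trans (energy_average H mrho' rho0' m1) _.
    by under eq_integral do rewrite expe2 -EFinM -expr2.
  have finX : {ae mu, forall s, AU T (EFin \o F) s \is a fin_num}.
    by apply: ae_fin_num => //; rewrite (integral_mass_average H).
  near=> s.
  have fX : AU T (EFin \o F) s \is a fin_num by near: s.
  have fA : A m (EFin \o rho) s \is a fin_num by near: s.
  have hX : (h s)%:E * AU T (EFin \o F) s = 0.
    by near: s; exact: average_null_density.
  have X0s := X0 s.
  rewrite /dd /v; move: X0s hX; rewrite -(fineK fX) -(fineK fA) /=.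
  move: (fine (AU T _ s)) (fine (A m _ s)) => x a; rewrite !lee_fin => x0 [] hx.
  have hv : (h s * Num.sqrt x = 0)%R.
    by move/eqP: hx; rewrite mulf_eq0 => /orP[/eqP ->|/eqP ->]; rewrite ?mul0r//
        sqrtr0 mulr0.
  have -> : (Num.sqrt x * a = Num.sqrt x * (a - h s))%R.
    by rewrite mulrBr [X in (_ - X)%R]mulrC hv subr0.
  rewrite -{2}(sqr_sqrtr x0).
  apply: le_trans (amgm_weighted (Num.sqrt x) `|a - h s|%R eta0).
  by rewrite ler_wpM2l ?sqrtr_ge0// ler_norm.
move/le_trans => /(_ _ le2).
rewrite intD; [|by move=> s; apply: mule_ge0|by move=> s; apply: mule_ge0
               |exact: measurable_funeM|exact: measurable_funeM].
rewrite (intZ mu c1 X0 mX) (intZ mu c2 dd0 mdd) (integral_mass_average H)// KE => le3.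
have le4 : 2^-1%:E * I <= (e / 2)%:E.
  apply: (le_trans le3).
  apply: (@le_trans _ _ ((eta / 2)%:E * K%:E + (2 * eta)^-1%:E * (eta * e / 2)%:E)).
    by apply: leeD => //; exact: lee_wpmul2l.
  rewrite -!EFinM -EFinD lee_fin.
  have -> : ((2 * eta)^-1 * (eta * e / 2) = e / 4)%R by field; rewrite gt_eqF.
  exact: null_part_arith.
clear le3; clearbody I; move: le4 I0; case: I => [i| |//].
  by rewrite -EFinM !lee_fin => le4 _; lra.
by rewrite gt0_muley ?lte_fin.
Unshelve. all: by end_near. Qed.

End null_part.

(** * Assembling the stochastic limit *)

Lemma final_arith (R : realFieldType) (z K e : R) : 0 < z ->
  z * (2 * (K + 1)) = e -> 2 * (e / 8) + 2 * (e / 8) + z * K <= e.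
Proof. lra. Qed.

Section combination.
Context {R : realType} {dG dS : measure_display}.
Context {G : measurableType dG} {S : measurableType dS}.
Variables (lam : {sigma_finite_measure set G -> \bar R}).
Variables (mu : {sigma_finite_measure set S -> \bar R}).
Variables (zero : G) (add : G -> G -> G) (opp : G -> G) (B : R -> set G).
Variables (ell : R -> R) (phi : G -> S -> S) (w : G -> S -> R).
Hypothesis H : folner_flow lam mu zero add opp B ell phi w.
Local Open Scope ereal_scope.

Local Notation U := (transfer phi w).
Local Notation AU := (average lam B ell phi w).

Variable rho : S -> R.
Hypothesis mrho : measurable_fun setT rho.
Hypothesis rho0 : forall s, (0 < rho s)%R.
Hypothesis rho1 : forall s, (rho s <= 1)%R.
Hypothesis Irho : \int[mu]_s (rho s)%:E < +oo.

Lemma measurable_min_dist (x y : S -> R) : measurable_fun setT x ->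
  measurable_fun setT y ->
  measurable_fun setT (fun s => (Num.min 1 `|x s - y s| * rho s)%:E).
Proof.
move=> mx my; apply/measurable_EFinP; apply: measurable_funM => //.
apply: measurable_minr => //; apply: measurableT_comp => //.
exact: measurable_funB.
Qed.

Lemma min_dist_ge0 (x y : R) s : 0 <= (Num.min 1 `|x - y| * rho s)%:E.
Proof.
by rewrite lee_fin mulr_ge0 ?(ltW (rho0 s))// le_min ler01 normr_ge0.
Qed.

(** The part of [f] on {h > 0} converges in L^1 and provides the limit; the part on {h = 0} has
    vanishing weighted square roots, and [min_sqrt_arith] adds the two. *)
Lemma nonneg_stochastic_limit (f : S -> R) : measurable_fun setT f ->
  (forall s, 0 <= f s)%R -> \int[mu]_s (f s)%:E < +oo -> exists ft : S -> R,
  [/\ measurable_fun setT ft, \int[mu]_s `|ft s|%:E < +oo,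
    forall e : R, (0 < e)%R -> exists T0, forall T, (T0 <= T)%R -> (1 <= T)%R /\
      \int[mu]_s (Num.min 1 `|fine (AU T (EFin \o f) s) - ft s| * rho s)%:E <= e%:E &
    forall m u, B m u -> {ae mu, forall s, (w u s * ft (phi u s))%R = ft s}].
Proof.
move=> mf f0 If.
have [h [mh h0 Nh rho_h hinv]] := invariant_density H mrho rho0 rho1 Irho.
have [ft [mft Ift cvgP inv]] := positive_part_limit H mh h0 Nh hinv mf f0 If.
exists ft; split => // e e0.
pose F s : R := if (0 < h s)%R then 0%R else f s.
have mF : measurable_fun setT F.
  by apply: measurable_fun_ifT => //; exact: measurable_support.
have F0 s : (0 <= F s)%R by rewrite /F; case: ifP.
have mF' : measurable_fun setT (EFin \o F) by exact/measurable_EFinP.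
have F0' s : 0 <= (EFin \o F) s by rewrite lee_fin.
have mP : measurable_fun setT (EFin \o on_support h f).
  by apply/measurable_EFinP; exact: measurable_on_support.
have P0 s : 0 <= (EFin \o on_support h f) s by rewrite lee_fin; exact: on_support_ge0.
have mf' : measurable_fun setT (EFin \o f) by exact/measurable_EFinP.
have IF : \int[mu]_s (F s)%:E < +oo.
  apply: le_lt_trans If; apply: le_int => //.
  by move=> s; rewrite lee_fin /F; case: ifP.
have IP : \int[mu]_s (EFin \o on_support h f) s < +oo.
  apply: le_lt_trans If; apply: le_int => //.
  by move=> s; rewrite lee_fin; exact: on_support_le.
have Nrho : \int[mu]_s (rho s ^+ 2)%:E < +oo.
  apply: le_lt_trans Irho; apply: le_int.
  - by move=> s; rewrite lee_fin sqr_ge0.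
  - by apply/measurable_EFinP; exact: measurable_funX.
  - exact/measurable_EFinP.
  - by move=> s; rewrite lee_fin expr2 ler_piMr// ltW.
have e2 : (0 < e / 2)%R by rewrite divr_gt0.
have [T0 T0P] := cvgP _ e2.
have Fh s : (0 < h s)%R -> F s = 0%R by rewrite /F => ->.
have [T1 T1P] := null_part_vanishes H mh h0 hinv mrho (fun s => ltW (rho0 s)) Nrho
  rho_h mF F0 IF Fh e2.
exists (Num.max T0 T1) => T; rewrite ge_max => /andP[/T0P[TT I1] /T1P[_ I2]].
split => //.
pose v s : R := Num.sqrt (fine (AU T (EFin \o F) s)).
have mA (x : S -> \bar R) : measurable_fun setT x -> (forall s, 0 <= x s) ->
    measurable_fun setT (fun s => fine (AU T x s)).
  by move=> mx x0; apply: measurableT_comp => //; exact: (measurable_mass_average H).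
have mv : measurable_fun setT (fun s => (v s * rho s)%:E).
  apply/measurable_EFinP; apply: measurable_funM => //.
  apply: (measurableT_comp (f := @Num.sqrt R)).
    by apply: continuous_measurable_fun; exact: sqrt_continuous.
  exact: mA.
have md : measurable_fun setT (fun s => `|fine (AU T (EFin \o on_support h f) s) - ft
    s|%:E).
  by apply: (@measurable_dist_pow _ _ R 1 (fun s => fine (AU T (EFin \o on_support h
      f) s)) ft) => //; exact: mA.
have v0 s : 0 <= (v s * rho s)%:E.
  by rewrite lee_fin mulr_ge0 ?sqrtr_ge0// ltW.
apply: (@le_trans _ _ (\int[mu]_s (`|fine (AU T (EFin \o on_support h f) s) - ft s|%:E +
   (v s * rho s)%:E))).
  apply: ge0_ae_le_int.
  - by apply: measurable_min_dist => //; exact: mA.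
  - exact: emeasurable_funD.
  - by move=> s; exact: min_dist_ge0.
  - by move=> s; apply: adde_ge0 => //; rewrite lee_fin.
  have fin1 : {ae mu, forall s, AU T (EFin \o on_support h f) s \is a fin_num}.
    apply: ae_fin_num; first exact: (measurable_mass_average H).
      by move=> s; exact: (mass_average_ge0 H).
    by rewrite (integral_mass_average H).
  have fin2 : {ae mu, forall s, AU T (EFin \o F) s \is a fin_num}.
    apply: ae_fin_num; first exact: (measurable_mass_average H).
      by move=> s; exact: (mass_average_ge0 H).
    by rewrite (integral_mass_average H).
  apply: filterS2 fin1 fin2 => s f1 f2.
  have -> : AU T (EFin \o f) s = AU T (EFin \o on_support h f) s + AU T (EFin \o F) s.
    rewrite -(mass_average_add H)//; congr (AU T _ s); apply/funext => s' /=.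
    by rewrite -EFinD /on_support /F; case: ifP; rewrite ?addr0 ?add0r.
  rewrite fineD// -EFinD lee_fin; apply: min_sqrt_arith.
    by rewrite fine_ge0//; exact: (mass_average_ge0 H).
  by rewrite rho1 ltW.
rewrite intD//.
have -> : e%:E = (e / 2)%:E + (e / 2)%:E by rewrite -EFinD -splitr.
exact: leeD.
Qed.

Lemma integral_section_posneg (f : S -> R) T s :
  \int[lam]_(t in B T) (w t s * f (phi t s))%:E =
  \int[lam]_(t in B T) U t (fun s => (Num.max (f s) 0)%:E) s -
  \int[lam]_(t in B T) U t (fun s => (Num.max (- f s) 0)%:E) s.
Proof.
rewrite integralE; congr (_ - _); apply: eq_integral => t _.
  rewrite /transfer funeposE /= -EFin_max -EFinM; congr EFin.
  by rewrite maxr_pMr ?mulr0// (w_ge0 H).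
rewrite /transfer funenegE /= -EFin_max -EFinM; congr EFin.
by rewrite maxr_pMr ?mulr0 ?mulrN// (w_ge0 H).
Qed.

(** [C] need only be asymptotic to [ell]: on Z^d with non-integer T the box need not contain exactly
    (2T)^d points. *)
Lemma stochastic_limit (f : S -> R) (C : R -> R) :
  mu.-integrable setT (EFin \o f) ->
  (forall e : R, (0 < e)%R -> exists T0, forall T, (T0 <= T)%R ->
    (`|ell T / C T - 1| <= e)%R) ->
  exists ft : S -> R, [/\ mu.-integrable setT (EFin \o ft),
    stoch_cvg mu (fun T s => (C T)^-1 *
      fine (\int[lam]_(t in B T) (w t s * f (phi t s))%:E))%R ft &
    forall m u, B m u -> {ae mu, forall s, (w u s * ft (phi u s))%R = ft s}].
Proof.
move=> /integrableP[mf' If] ellC.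
have mf : measurable_fun setT f by exact/measurable_EFinP.
pose fp s := Num.max (f s) 0%R; pose fn s := Num.max (- f s)%R 0%R.
have mfp : measurable_fun setT fp by exact: measurable_maxr.
have mfn : measurable_fun setT fn.
  by apply: measurable_maxr => //; exact: measurableT_comp.
have fp0 s : (0 <= fp s)%R by rewrite le_max lexx orbT.
have fn0 s : (0 <= fn s)%R by rewrite le_max lexx orbT.
have mabs : measurable_fun setT (fun s => `|(EFin \o f) s|).
  exact: measurableT_comp.
have Ip : \int[mu]_s (fp s)%:E < +oo.
  apply: le_lt_trans If; apply: le_int.
  - by move=> s; rewrite lee_fin.
  - exact/measurable_EFinP.
  - exact: mabs.
  - by move=> s; rewrite lee_fin ge_max ler_norm normr_ge0.
have In : \int[mu]_s (fn s)%:E < +oo.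
  apply: le_lt_trans If; apply: le_int.
  - by move=> s; rewrite lee_fin.
  - exact/measurable_EFinP.
  - exact: mabs.
  - by move=> s; rewrite lee_fin ge_max -normrN ler_norm normr_ge0.
have [p [mp Iabsp cvgp invp]] := nonneg_stochastic_limit mfp fp0 Ip.
have [q [mq Iabsq cvgq invq]] := nonneg_stochastic_limit mfn fn0 In.
pose ft s := (p s - q s)%R.
have mft : measurable_fun setT ft by exact: measurable_funB.
have mabs' (x : S -> R) : measurable_fun setT x -> measurable_fun setT (fun s => `|x
    s|%:E).
  by move=> mx; apply/measurable_EFinP; exact: measurableT_comp.
have Ift : \int[mu]_s `|ft s|%:E < +oo.
  apply: (@le_lt_trans _ _ (\int[mu]_s (`|p s|%:E + `|q s|%:E))).
    apply: le_int.
    - by move=> s; rewrite lee_fin.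
    - exact: mabs'.
    - by apply: emeasurable_funD; exact: mabs'.
    - by move=> s; rewrite -EFinD lee_fin; exact: ler_normB.
  rewrite intD; [|by move=> s; rewrite lee_fin|by move=> s; rewrite lee_fin
                 |exact: mabs'|exact: mabs'].
  exact: lte_add_pinfty.
have mavg T : measurable_fun setT (fun s => (C T)^-1 *
    fine (\int[lam]_(t in B T) (w t s * f (phi t s))%:E))%R.
  apply: measurable_funM => //; apply: measurableT_comp => //.
  under eq_fun do rewrite integral_section_posneg.
  have mI (x : S -> R) : measurable_fun setT x -> (forall s, 0 <= x s)%R ->
      measurable_fun setT (fun s => \int[lam]_(t in B T) U t (EFin \o x) s).
    move=> mx x0; apply: measurable_integral_section; first exact: (B_meas H).
      by apply: (jointly_mass_transfer H); exact/measurable_EFinP.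
    by move=> t s; apply: (mass_transfer_ge0 H) => s'; rewrite lee_fin.
  by apply: emeasurable_funB; exact: mI.
exists ft; split.
- by apply/integrableP; split => //; exact/measurable_EFinP.
- apply: (@weighted_stoch_cvg _ _ _ mu _ _ rho) => //.
  move=> e e0.
  pose K := fine (\int[mu]_s `|ft s|%:E).
  have K0 : (0 <= K)%R by rewrite fine_ge0// integral_EFin_ge0.
  have KE : \int[mu]_s `|ft s|%:E = K%:E by rewrite fineK// ge0_fin_numE//
      integral_EFin_ge0.
  have e8 : (0 < e / 8)%R by rewrite divr_gt0.
  (* The bound 1 keeps the ratio [c] in [0, 2]; the other bound makes its deviation from 1 cost at
     most e / 2. *)
  have dl0 : (0 < Num.min 1 (e / (2 * (K + 1))))%R.
    by rewrite lt_min ltr01 divr_gt0// mulr_gt0// ltr_wpDl.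
  have [T0 T0P] := cvgp _ e8; have [T1 T1P] := cvgq _ e8.
  have [T2 T2P] := ellC _ dl0.
  exists (Num.max T0 (Num.max T1 T2)) => T; rewrite !ge_max.
  move=> /andP[/T0P[TT J1] /andP[/T1P[_ J2] /T2P]].
  set c := (ell T / C T)%R; rewrite le_min => /andP[c1 cK].
  have c02 : (0 <= c <= 2)%R.
    by move: c1; rewrite ler_distl => /andP[]; rewrite subrr => -> /=; rewrite
        -[2%R]/(1 + 1)%R.
  have mA (x : S -> R) : measurable_fun setT x -> (forall s, 0 <= x s)%R ->
      measurable_fun setT (fun s => fine (AU T (EFin \o x) s)).
    move=> mx x0; apply: measurableT_comp => //; apply: (measurable_mass_average H) => //.
    exact/measurable_EFinP.
  have finA (x : S -> R) : measurable_fun setT x -> (forall s, 0 <= x s)%R ->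
      \int[mu]_s (x s)%:E < +oo -> {ae mu, forall s, AU T (EFin \o x) s \is a fin_num}.
    move=> mx x0 Ix; have mx' : measurable_fun setT (EFin \o x) by exact/measurable_EFinP.
    have x0' s : 0 <= (EFin \o x) s by rewrite lee_fin.
    apply: ae_fin_num; first exact: (measurable_mass_average H).
      by move=> s; exact: (mass_average_ge0 H).
    by rewrite (integral_mass_average H).
  pose M (x y : S -> R) s := (Num.min 1 `|x s - y s| * rho s)%:E.
  have M0 x y s : 0 <= M x y s by exact: min_dist_ge0.
  have mM x y : measurable_fun setT x -> measurable_fun setT y -> measurable_fun setT
      (M x y).
    exact: measurable_min_dist.
  pose xp s := fine (AU T (EFin \o fp) s); pose xn s := fine (AU T (EFin \o fn) s).
  have mxp := mA _ mfp fp0; have mxn := mA _ mfn fn0.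
  have d0 : (0 <= `|c - 1|)%R by [].
  apply: (@le_trans _ _ (\int[mu]_s (2%:E * M xp p s + 2%:E * M xn q s + `|c - 1|%:E
      * `|ft s|%:E))).
    apply: ge0_ae_le_int.
    - exact: measurable_min_dist.
    - by do 2?apply: emeasurable_funD; apply: measurable_funeM;
        first [exact: mabs'|exact: mM].
    - by move=> s; exact: min_dist_ge0.
    - by move=> s; do 2?apply: adde_ge0; apply: mule_ge0 => //; rewrite lee_fin.
    apply: filterS2 (finA _ mfp fp0 Ip) (finA _ mfn fn0 In) => s f1 f2.
    (* Undoes the normalisation; finiteness lets the two integrals be subtracted as reals. *)
    have AE (x : S -> R) : AU T (EFin \o x) s \is a fin_num ->
        \int[lam]_(t in B T) U t (EFin \o x) s = (ell T * fine (AU T (EFin \o x) s))%:E.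
      move=> fx; rewrite EFinM fineK// /average muleA -EFinM mulfV ?mul1e//.
      by rewrite gt_eqF// (ell_gt0 H).
    rewrite integral_section_posneg (AE fp f1) (AE fn f2) -EFinB /=.
    rewrite -mulrBr mulrA [((C T)^-1 * _)%R]mulrC -/c -!EFinM -!EFinD lee_fin.
    by apply: min_combination_arith => //; rewrite rho1 ltW.
  have M2 x y s : 0 <= 2%:E * M x y s by exact: mule_ge0.
  have mM2 x y : measurable_fun setT x -> measurable_fun setT y ->
      measurable_fun setT (fun s => 2%:E * M x y s).
    by move=> mx my; apply: measurable_funeM; exact: mM.
  rewrite intD; [|by move=> s; apply: adde_ge0|by move=> s; rewrite mule_ge0 ?lee_fin
                 |by apply: emeasurable_funD; exact: mM2|by apply: measurable_funeM;
                     exact: mabs'].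
  rewrite [X in X + _]intD; [|exact: M2|exact: M2|exact: mM2|exact: mM2].
  have two0 : (0 <= 2 :> R)%R by [].
  rewrite (intZ mu two0 (M0 xp p) (mM _ _ mxp mp)) (intZ mu two0 (M0 xn q) (mM _ _
      mxn mq)).
  have aft0 s : 0 <= `|ft s|%:E by rewrite lee_fin.
  have -> : \int[mu]_s (`|c - 1|%:E * `|ft s|%:E) = `|c - 1|%:E * K%:E.
    by rewrite (intZ mu d0 aft0 (mabs' _ mft)) KE.
  apply: (@le_trans _ _ (2%:E * (e / 8)%:E + 2%:E * (e / 8)%:E + (e / (2 * (K +
      1)))%:E * K%:E)).
    apply: leeD; first by apply: leeD; apply: lee_wpmul2l.
    by rewrite lee_wpmul2r ?lee_fin.
  rewrite -!EFinM -!EFinD lee_fin.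
  have : (e / (2 * (K + 1)) * (2 * (K + 1)) = e)%R.
    by rewrite divfK// gt_eqF// mulr_gt0// ltr_wpDl.
  have : (0 < e / (2 * (K + 1)))%R by rewrite divr_gt0// mulr_gt0// ltr_wpDl.
  move: (e / (2 * (K + 1)))%R => z z0 zE; exact: (final_arith z0 zE).
- move=> m u Bu; apply: filterS2 (invp m u Bu) (invq m u Bu) => s e1 e2.
  by rewrite /ft mulrBr e1 e2.
Qed.

End combination.

(** * Densities and boxes in R^d *)

Section density.
Context {d : measure_display} {X : measurableType d} {R : realType}.
Variables mu nu : {measure set X -> \bar R}.
Variable D : X -> R.
Hypothesis mD : measurable_fun setT D.
Hypothesis D0 : forall x, 0 <= D x.
Hypothesis nuD : forall E, measurable E -> (nu E = \int[mu]_(x in E) (D x)%:E)%E.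
Local Open Scope ereal_scope.
Import HBNNSimple.

Let mD' : measurable_fun setT (EFin \o D). Proof. exact/measurable_EFinP. Qed.

Let integral_density_indic (E : set X) : measurable E ->
  \int[nu]_x (\1_E x)%:E = \int[mu]_x ((D x)%:E * (\1_E x)%:E).
Proof.
move=> mE; rewrite integral_indic// setIT nuD// integral_mkcond.
by apply: eq_integral => x _; rewrite patchE indicE; case: ifPn; rewrite ?mule1 ?mule0.
Qed.

Let integral_density_nnsfun (g : {nnsfun X >-> R}) :
  \int[nu]_x (g x)%:E = \int[mu]_x ((D x)%:E * (g x)%:E).
Proof.
have mI (y : R) : measurable_fun setT (fun x => (\1_(g @^-1` [set y]) x)%:E : \bar R).
  by apply/measurable_EFinP; exact: measurable_indic.
have gE x : (g x)%:E = \sum_(y \in range g) (y%:E * (\1_(g @^-1` [set y]) x)%:E).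
  by rewrite [in LHS]fimfunE -fsumEFin.
have y0 (y : R) : y \in range g -> (0 <= y)%R by rewrite inE => -[x _ <-].
transitivity (\sum_(y \in range g) y%:E * \int[nu]_x (\1_(g @^-1` [set y]) x)%:E).
  under eq_integral do rewrite gE.
  rewrite ge0_integral_fsum//.
  - by apply: eq_fsbigr => y /y0 ?; rewrite ge0_integralZl.
  - by move=> y; exact: measurable_funeM.
  - by move=> y x _; rewrite nnfun_muleindic_ge0.
transitivity (\sum_(y \in range g)
    \int[mu]_x ((D x)%:E * (y%:E * (\1_(g @^-1` [set y]) x)%:E))).
  apply: eq_fsbigr => y /y0 yy.
  rewrite integral_density_indic// -ge0_integralZl ?lee_fin//.
  - by apply: eq_integral => x _; rewrite muleCA.
  - by apply: emeasurable_funM.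
  - by move=> x _; rewrite mule_ge0// lee_fin.
rewrite -ge0_integral_fsum//.
- apply: eq_integral => x _; rewrite gE ge0_mule_fsumr//.
  by move=> y; rewrite nnfun_muleindic_ge0.
- by move=> y; apply: emeasurable_funM => //; exact: measurable_funeM.
- by move=> y x _; apply: mule_ge0; [rewrite lee_fin|exact: nnfun_muleindic_ge0].
Qed.

(** The density hypothesis speaks of sets; simple functions and monotone convergence extend it. *)
Lemma integral_density (f : X -> \bar R) : measurable_fun setT f ->
  (forall x, 0 <= f x) -> \int[nu]_x f x = \int[mu]_x ((D x)%:E * f x).
Proof.
move=> mf f0; pose g := nnsfun_approx measurableT mf.
have gf x : (g n x)%:E @[n --> \oo] --> f x by exact: cvg_nnsfun_approx.
have ndg x (a b : nat) : (a <= b)%N -> (g a x <= g b x)%R.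
  by move=> ab; exact/lefP/nd_nnsfun_approx.
transitivity (limn (fun n => \int[nu]_x (g n x)%:E)).
  rewrite -monotone_convergence//.
  - by apply: eq_integral => x _; apply/esym/cvg_lim.
  - by move=> n; exact/measurable_EFinP.
  - by move=> n x _; rewrite lee_fin.
  - by move=> x _ a b ab; rewrite lee_fin ndg.
transitivity (limn (fun n => \int[mu]_x ((D x)%:E * (g n x)%:E))).
  by congr (limn _); apply/funext => n; exact: integral_density_nnsfun.
rewrite -monotone_convergence//.
- apply: eq_integral => x _; apply/cvg_lim => //.
  by apply: cvgeZl => //; exact: gf.
- by move=> n; apply: emeasurable_funM => //; exact/measurable_EFinP.
- by move=> n x _; rewrite mule_ge0 ?lee_fin.
- by move=> x _ a b ab; rewrite lee_wpmul2l ?lee_fin// ndg.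
Qed.

End density.

Section tuple_translation.
Context {R : realType} {n : nat}.
Implicit Types a b t u : n.-tuple R.

Lemma tnth_tadd t u i : tnth (tadd t u) i = tnth t i + tnth u i.
Proof. by rewrite tnth_mktuple. Qed.
Lemma tnth_topp t i : tnth (topp t) i = - tnth t i.
Proof. by rewrite tnth_mktuple. Qed.
Lemma tnth_tzero i : tnth (tzero R n) i = 0.
Proof. by rewrite tnth_mktuple. Qed.

Lemma taddC : commutative (@tadd R n).
Proof. by move=> t u; apply: eq_from_tnth => i; rewrite !tnth_tadd addrC. Qed.
Lemma taddA : associative (@tadd R n).
Proof. by move=> t u v; apply: eq_from_tnth => i; rewrite !tnth_tadd addrA. Qed.
Lemma taddNt t : tadd (topp t) t = tzero R n.
Proof.
by apply: eq_from_tnth => i; rewrite tnth_tadd tnth_topp tnth_tzero addNr.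
Qed.
Lemma tadd0t t : tadd (tzero R n) t = t.
Proof. by apply: eq_from_tnth => i; rewrite tnth_tadd tnth_tzero add0r. Qed.

Lemma measurable_tadd :
  measurable_fun setT (fun p : n.-tuple R * n.-tuple R => tadd p.1 p.2).
Proof.
apply/measurable_fun_tnthP => i.
rewrite (_ : _ \o _ = (fun p : n.-tuple R * n.-tuple R => tnth p.1 i + tnth p.2 i)).
  by apply: measurable_funD; [apply: (measurableT_comp (@measurable_tnth _ R n i))
                             |apply: (measurableT_comp (@measurable_tnth _ R n i))].
by apply/funext => p; rewrite /= tnth_tadd.
Qed.

Lemma measurable_translate u : measurable_fun setT (fun t => tadd t u).
Proof. exact: (measurableT_comp measurable_tadd (pair2_measurable u)). Qed.

Definition tbox a b : set (n.-tuple R) :=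
  [set t | forall i, tnth a i < tnth t i <= tnth b i].

Lemma measurable_coordinatewise (P : 'I_n -> set R) : (forall i, measurable (P i)) ->
  measurable [set t : n.-tuple R | forall i, P i (tnth t i)].
Proof.
move=> mP; rewrite (_ : [set t | _] = \bigcap_(i in [set: 'I_n]) ((@tnth n R ^~ i)
    @^-1` P i)).
  apply: fin_bigcap_measurable; first exact: finite_finset.
  by move=> i _; rewrite -[X in measurable X]setTI; exact: measurable_tnth.
by apply/seteqP; split => [t tP i _|t tP i]; [exact: tP|exact: (tP i)].
Qed.

Lemma measurable_tbox a b : measurable (tbox a b).
Proof.
rewrite (_ : tbox a b = [set t | forall i, [set` `]tnth a i, tnth b i]] (tnth t i)]).
  apply: (@measurable_coordinatewise (fun i => [set` `]tnth a i, tnth b i]])) => i.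
  exact: measurable_itv.
by apply/seteqP; split => t tP i; have := tP i; rewrite /= in_itv.
Qed.

(** A pi-system. [set0] is listed because the corners of an intersection may be out of order, and a
    <= b is required because [is_lambda] gives volumes only then. *)
Definition tboxes : set (set (n.-tuple R)) :=
  [set A | A = set0 \/ exists a b, (forall i, tnth a i <= tnth b i) /\ A = tbox a b].

Lemma tboxes_setI : setI_closed tboxes.
Proof.
move=> A B [->|[a [b [ab ->]]]]; first by move=> _; left; rewrite set0I.
move=> [->|[a' [b' [ab' ->]]]]; first by left; rewrite setI0.
pose a2 : n.-tuple R := [tuple Num.max (tnth a i) (tnth a' i) | i < n].
pose b2 : n.-tuple R := [tuple Num.min (tnth b i) (tnth b' i) | i < n].
have E : tbox a b `&` tbox a' b' = tbox a2 b2.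
  apply/seteqP; split=> [t [t1 t2] i|t tP]; rewrite ?tnth_mktuple.
    have /andP[p q] := t1 i; have /andP[p' q'] := t2 i.
    by rewrite gt_max le_min p q p' q'.
  by split => i; have := tP i; rewrite !tnth_mktuple gt_max le_min;
    move=> /andP[/andP[p q] /andP[p' q']]; rewrite ?p ?q ?p' ?q'.
have [h|h] := pselect (forall i, tnth a2 i <= tnth b2 i).
  by right; exists a2, b2.
left; rewrite E; apply/seteqP; split => // t tP; apply: h => i.
by have /andP[p q] := tP i; exact: le_trans (ltW p) q.
Qed.

Lemma tboxes_generate : @measurable _ (n.-tuple R) = <<s tboxes >>.
Proof.
apply/seteqP; split; last first.
  apply: smallest_sub; first exact: sigma_algebra_measurable.
  move=> _ [->|[a [b [_ ->]]]]; first exact: measurable0.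
  exact: measurable_tbox.
move=> A mA.
pose idT : g_sigma_algebraType tboxes -> n.-tuple R := fun t => t.
suff mid : measurable_fun setT idT.
  by have := mid measurableT A mA; rewrite setTI.
apply/measurable_fun_tnthP => i.
apply: (@measurability _ _ _ _ _ _ (@RGenOInfty.G R)).
  exact: RGenOInfty.measurableE.
move=> _ [_ [x ->] <-]; rewrite setTI.
(* The half-space x < t_i is exhausted by boxes with i-th side from x to x + k and all other sides
   from -k to k. *)
pose a (k : nat) : n.-tuple R := [tuple if j == i then x else - k%:R | j < n].
pose b (k : nat) : n.-tuple R := [tuple if j == i then x + k%:R else k%:R | j < n].
rewrite (_ : _ @^-1` _ = \bigcup_k tbox (a k) (b k)).
  apply: bigcupT_measurable => k; apply: sub_sigma_algebra; right.
  exists (a k), (b k); split => // j; rewrite !tnth_mktuple.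
  by case: eqP => _; [rewrite lerDl|rewrite -subr_ge0 opprK addr_ge0].
apply/seteqP; split => [t|t [k _ /(_ i)]]; rewrite /= in_itv /= andbT; last first.
  by rewrite !tnth_mktuple eqxx => /andP[].
move=> xt; pose s : R := \sum_(j < n) `|tnth t j| + `|x|.
have ts j : `|tnth t j| <= s.
  by rewrite /s (bigD1 j)//= -!addrA lerDl addr_ge0// sumr_ge0.
have sk : s < (Num.trunc s).+1%:R by exact: truncnS_gt.
exists (Num.trunc s).+1 => // j; rewrite !tnth_mktuple.
case: eqP => [->|_].
  rewrite xt /= -lerBlDl; apply: le_trans (ltW sk).
  apply: le_trans (ler_norm _) _; apply: le_trans (ler_normB _ _) _.
  by rewrite lerD2r (bigD1 i)//= lerDl sumr_ge0.
have := le_lt_trans (ts j) sk; rewrite ltr_norml => /andP[-> /ltW ->].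
by [].
Qed.

End tuple_translation.

(** * The group T^d and its Haar measure *)

Lemma counting_image (R : realType) (T U : choiceType) (f : T -> U) (A : set T) :
  injective f -> @counting U R (f @` A) = counting A.
Proof.
move=> fi; have fA : (f @` A #= A)%card by apply: inj_card_eq => x y _ _; exact: fi.
rewrite /counting; have := eq_finite_set fA.
have [fin|inf] := pselect (finite_set A) => E.
  by rewrite !asboolT ?E//; congr (_%:R%:E); apply/fcard_eq; rewrite ?E.
by rewrite !asboolF ?E.
Qed.

Section lambda.
Context {R : realType} {n : nat} (disc : bool).
Variable lam : {measure set (n.-tuple R) -> \bar R}.
Hypothesis lamP : is_lambda disc lam.
Local Notation D := (Tgrp R n disc).
Local Notation B := (Bbox R n disc).
Implicit Types (t u : n.-tuple R) (T : R).

Lemma tadd_inj u : injective (fun t => tadd t u).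
Proof.
move=> t t' E; apply: eq_from_tnth => i.
by have := congr1 (fun x => tnth x i) E; rewrite !tnth_tadd => /addIr.
Qed.

Lemma Tgrp_add t u : D t -> D u -> D (tadd t u).
Proof.
rewrite /Tgrp; case: disc => //= tZ uZ i; have [k kE] := tZ i; have [l lE] := uZ i.
by exists (k + l); rewrite tnth_tadd kE lE intrD.
Qed.

Lemma Tgrp_opp t : D t -> D (topp t).
Proof.
rewrite /Tgrp; case: disc => //= tZ i; have [k kE] := tZ i.
by exists (- k); rewrite tnth_topp kE intrN.
Qed.

Lemma Tgrp_zero : D (tzero R n).
Proof. by rewrite /Tgrp; case: disc => //= i; exists 0; rewrite tnth_tzero. Qed.

Lemma measurable_Tgrp : measurable D.
Proof.
rewrite /Tgrp; case: disc => //=.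
apply: (@measurable_coordinatewise R n (fun=> [set x | exists k : int, x = k%:~R])) => _.
apply: countable_measurable; first by move=> x; exact: measurable_set1.
rewrite (_ : [set x | _] = (fun k : int => k%:~R) @` setT); last first.
  by apply/seteqP; split => x [k]; [move=> ->; exists k|move=> _ <-; exists k].
exact: (sub_countable (card_image_le _ _) (countableP [set: int])).
Qed.

Definition cube (T : R) : set (n.-tuple R) := [set t | forall i, - T < tnth t i <= T].

Lemma cubeE T : cube T = tbox [tuple - T | i < n] [tuple T | i < n].
Proof. by apply/seteqP; split => t tP i; have := tP i; rewrite !tnth_mktuple. Qed.

Lemma measurable_cube T : measurable (cube T).
Proof. by rewrite cubeE; exact: measurable_tbox. Qed.

Lemma measurable_Bbox T : measurable (B T).
Proof. by apply: measurableI; [exact: measurable_cube|exact: measurable_Tgrp]. Qed.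

Lemma Bbox_mono T T' : T <= T' -> B T `<=` B T'.
Proof.
move=> TT' t [tT Dt]; split => // i; have /andP[p q] := tT i.
by rewrite (le_lt_trans _ p) ?lerN2//= (le_trans q).
Qed.

Lemma cube_cover : \bigcup_k cube k%:R = [set: n.-tuple R].
Proof.
apply/seteqP; split => // t _; pose s : R := \sum_(j < n) `|tnth t j|.
have sk : s < (Num.trunc s).+1%:R by exact: truncnS_gt.
exists (Num.trunc s).+1 => // i.
have : `|tnth t i| < (Num.trunc s).+1%:R.
  by apply: le_lt_trans sk; rewrite /s (bigD1 i)//= lerDl sumr_ge0.
by rewrite ltr_norml => /andP[-> /ltW ->].
Qed.

Lemma Tgrp_Bbox t : D t -> exists m, B m t.
Proof.
move=> Dt; have : [set: n.-tuple R] t by [].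
by rewrite -cube_cover => -[k _ kt]; exists k%:R.
Qed.

(** Discrete case: translation by [u] is a bijection of Z^d. Continuous case: both measures agree on
    boxes, a generating pi-system containing an exhaustion by cubes of finite measure. *)
Lemma lam_translate u (A : set (n.-tuple R)) : D u -> measurable A ->
  lam ((fun t => tadd t u) @^-1` A) = lam A.
Proof.
move=> Du mA; have mtau := measurable_translate u.
have mtA : measurable ((fun t => tadd t u) @^-1` A).
  by rewrite -[X in measurable X]setTI; exact: mtau.
move: lamP; rewrite /is_lambda; case: ifP => [dT lamC|dF lamL].
  rewrite !lamC//.
  rewrite -(@counting_image R _ _ _ ((fun t => tadd t u) @^-1` A `&` Tgrp R n true)
      (@tadd_inj u)).
  congr counting; move: Du; rewrite dT => Du.
  have dZ := Tgrp_add; have oZ := Tgrp_opp; rewrite dT in dZ oZ.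
  apply/seteqP; split => [_ [t [At Dt] <-]|t [At Dt]].
    by split => //; exact: dZ.
  have E : tadd (tadd t (topp u)) u = t by rewrite -taddA taddNt taddC tadd0t.
  exists (tadd t (topp u)) => //; split; first by rewrite /preimage/= E.
  by apply: dZ => //; exact: oZ.
apply/esym; apply: (@measure_unique _ _ _ tboxes (fun k => cube k%:R) tboxes_generate
   tboxes_setI _ cube_cover lam (pushforward lam (fun t => tadd t u))) => //.
- move=> k; right; rewrite cubeE; do 2 eexists; split; last by [].
  by move=> i; rewrite !tnth_mktuple -subr_ge0 opprK addr_ge0.
- move=> _ [->|[a [b [ab ->]]]]; first by rewrite !measure0.
  rewrite lamL// -[RHS]/(lam ((fun t => tadd t u) @^-1` tbox a b)).
  pose a' := tadd a (topp u); pose b' := tadd b (topp u).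
  have -> : (fun t => tadd t u) @^-1` tbox a b = [set t | forall i, tnth a' i < tnth
      t i <= tnth b' i].
    apply/seteqP; split => t tP i; have := tP i.
      by rewrite !tnth_tadd !tnth_topp ltrBlDr lerBrDr.
    by rewrite !tnth_tadd !tnth_topp ltrBlDr lerBrDr.
  rewrite lamL; last by move=> i; rewrite !tnth_tadd lerD2r.
  by congr EFin; apply: eq_bigr => i _; rewrite !tnth_tadd !tnth_topp; ring.
- move=> k; rewrite cubeE lamL ?ltry//.
  by move=> i; rewrite !tnth_mktuple -subr_ge0 opprK addr_ge0.
Qed.

(** For T >= 0, the number of integers k with -T < k <= T. *)
Definition cube_points (T : R) : nat := `|Num.floor T - Num.floor (- T)|%N.

Lemma floor_gap_ge0 (T : R) : 0 <= T -> 0 <= Num.floor T - Num.floor (- T).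
Proof.
move=> T0; rewrite subr_ge0 (@le_trans _ _ 0)// ?floor_ge0//.
by rewrite floor_le0 (le_lt_trans _ ltr01)// oppr_le0.
Qed.

Lemma cube_points_near T : 0 <= T -> `|(cube_points T)%:R - 2 * T| <= 1.
Proof.
move=> T0.
have -> : (cube_points T)%:R = (Num.floor T - Num.floor (- T))%:~R :> R.
  by rewrite -[in RHS](gez0_abs (floor_gap_ge0 T0)).
rewrite intrB; have /andP[p1 p2] := floor_itv T; have /andP[q1 q2] := floor_itv (- T).
rewrite intrD in p2; rewrite intrD in q2.
by rewrite ler_distl; apply/andP; split; lra.
Qed.

Lemma counting_cube T : 0 <= T ->
  @counting _ R (cube T `&` Tgrp R n true) = ((cube_points T)%:R ^+ n)%:E.
Proof.
move=> T0; set N := cube_points T; pose lo := Num.floor (- T).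
have NE : lo + N%:Z = Num.floor T.
  have := floor_gap_ge0 T0; rewrite /N /lo /cube_points.
  move: (Num.floor T) (Num.floor (- T)) => p q pq; lia.
(* The least integer above -T is lo + 1, hence the offset. *)
pose f (g : {ffun 'I_n -> 'I_N}) : n.-tuple R :=
  [tuple (lo + 1 + (g i)%:Z)%:~R | i < n].
have fi : injective f.
  move=> g g' E; apply/ffunP => i; apply/val_inj/eqP.
  have := congr1 (fun x => tnth x i) E; rewrite !tnth_mktuple => /intr_inj /addrI.
  by move=> /eqP; rewrite eqz_nat.
pose F : {fset n.-tuple R} := [fset f g | g in {: {ffun 'I_n -> 'I_N}}]%fset.
have -> : cube T `&` Tgrp R n true = [set` F].
  apply/seteqP; split => [t [tT tZ]|t /=]; last first.
    move=> /imfsetP[g _ ->]; split => i; rewrite tnth_mktuple; last by eexists.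
    have gN : lo + 1 + (g i)%:Z <= lo + N%:Z.
      by rewrite -addrA lerD2l; have := ltn_ord (g i); lia.
    rewrite -floor_lt_int -/lo -floor_ge_int -NE gN andbT.
    by rewrite -addrA ltrDl; lia.
  have /choice[k kE] : forall i, exists k : int, tnth t i = k%:~R by exact: tZ.
  have kb i : lo < k i <= lo + N%:Z.
    have := tT i; rewrite kE -floor_lt_int -/lo -floor_ge_int -NE.
    by move=> /andP[-> ->].
  have kN i : (absz (k i - lo - 1)%R < N)%N by have /andP[] := kb i; lia.
  apply/imfsetP; exists [ffun i => Ordinal (kN i)] => //.
  apply: eq_from_tnth => i; rewrite tnth_mktuple kE ffunE /=; congr (_%:~R).
  by have /andP[] := kb i; lia.
rewrite /counting asboolT; last exact: finite_fset.
rewrite set_fsetK card_imfset//= -cardE card_ffun !card_ord.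
by rewrite natrX.
Qed.

(** Effective side length: for T >= 0 the box has measure [side T ^+ n]. Being within 1 of 2 T, it
    treats both groups at once. *)
Definition side (T : R) : R := if disc then (cube_points T)%:R else 2 * T.

Lemma side_near T : 0 <= T -> `|side T - 2 * T| <= 1.
Proof.
rewrite /side; case: disc; first exact: cube_points_near.
by rewrite subrr normr0.
Qed.

Lemma lam_cube T : 0 <= T -> lam (cube T) = (side T ^+ n)%:E.
Proof.
move=> T0; move: lamP; rewrite /is_lambda /side; case: disc => lamE.
  by rewrite lamE ?counting_cube//; exact: measurable_cube.
rewrite cubeE lamE; last by move=> i; rewrite !tnth_mktuple; lra.
congr EFin; rewrite (eq_bigr (fun=> 2 * T)); last first.
  by move=> i _; rewrite !tnth_mktuple; ring.
by rewrite prodr_const card_ord.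
Qed.

Lemma lam_Bbox T : 0 <= T -> lam (B T) = (side T ^+ n)%:E.
Proof.
move=> T0; have mB := measurable_Bbox T; rewrite -(lam_cube T0).
move: lamP mB; rewrite /is_lambda /Bbox; case: disc => [lamE mB|_ _].
  rewrite !lamE//; last exact: measurable_cube.
  by congr counting; rewrite -setIA setIid.
by rewrite setIT.
Qed.

Lemma lam_sigma_finite : sigma_finite [set: n.-tuple R] lam.
Proof.
exists (fun k => cube k%:R); first by rewrite cube_cover.
by move=> k; split; [exact: measurable_cube|rewrite lam_cube// ltry].
Qed.

Definition Bsize (T : R) : R := fine (lam (B T)).

Lemma lam_Bsize T : lam (B T) = (Bsize T)%:E.
Proof.
rewrite /Bsize fineK// ge0_fin_numE//.
have m0 : 0 <= Num.max T 0 by rewrite le_max lexx orbT.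
apply: (@le_lt_trans _ _ (lam (B (Num.max T 0)))).
  apply: le_measure; rewrite ?inE; try exact: measurable_Bbox.
  by apply: Bbox_mono; rewrite le_max lexx.
by rewrite lam_Bbox// ltry.
Qed.

Lemma BsizeE T : 0 <= T -> Bsize T = side T ^+ n.
Proof. by move=> T0; rewrite /Bsize lam_Bbox. Qed.

Lemma side_ge T : 1 <= T -> T <= side T.
Proof.
move=> T1; have T0 : 0 <= T by exact: le_trans T1.
by have := side_near T0; rewrite ler_distl => /andP[+ _]; lra.
Qed.

Lemma Bsize_gt0 T : 1 <= T -> 0 < Bsize T.
Proof.
move=> T1; have T0 : 0 <= T by exact: le_trans T1.
rewrite BsizeE// exprn_gt0//.
exact: lt_le_trans (lt_le_trans ltr01 T1) (side_ge T1).
Qed.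

Lemma pow_near1 (e : R) : 0 < e -> exists2 dl : R, 0 < dl &
  forall x : R, `|x - 1| <= dl -> `|x ^+ n - 1| <= e.
Proof.
move=> e0; have := @exprn_continuous R n 1.
move=> /cvgrPdist_le /(_ e e0); rewrite expr1n => -[/= dl dl0 near1].
exists (dl / 2); first by rewrite divr_gt0.
move=> x x1; rewrite distrC; apply: near1 => /=.
by rewrite distrC; apply: le_lt_trans x1 _; lra.
Qed.

(** The sides at T and T - m differ by at most 2|m| + 2, so their ratio tends to 1, and so does its
    n-th power. *)
Lemma Bsize_folner (m e : R) : 0 < e -> exists T0, forall T, T0 <= T ->
  (1 - e) * Bsize T <= Bsize (T - m).
Proof.
move=> e0; have [dl dl0 near1] := pow_near1 e0.
(* As side T >= T, beyond [M] the ratio is within [dl] of 1. *)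
pose M : R := (2 * `|m| + 2) / dl.
have M0 : 0 <= M by rewrite divr_ge0 ?addr_ge0// ?mulr_ge0// ltW.
exists (M + `|m| + 1) => T TM.
have mm := ler_norm m; have mp := normr_ge0 m.
have T1 : 1 <= T by lra.
have T0 : 0 <= T by lra.
have Tm0 : 0 <= T - m by lra.
have sT := side_ge T1.
have sT0 : 0 < side T by lra.
rewrite !BsizeE//; set q := side (T - m) / side T.
have -> : side (T - m) = q * side T by rewrite divfK// gt_eqF.
rewrite exprMn ler_wpM2r ?exprn_ge0 ?(ltW sT0)//.
suff /near1 : `|q - 1| <= dl by rewrite ler_distl => /andP[].
have -> : q - 1 = (side (T - m) - side T) / side T.
  by rewrite mulrBl mulfV// gt_eqF.
rewrite normrM normfV (gtr0_norm sT0) ler_pdivrMr//.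
apply: (@le_trans _ _ (2 * `|m| + 2)).
  have := side_near T0; have := side_near Tm0; rewrite !ler_distl.
  move=> /andP[a1 a2] /andP[b1 b2]; have := ler_norm (- m); rewrite normrN => mn.
  by apply/andP; split; lra.
have -> : 2 * `|m| + 2 = dl * M by rewrite [RHS]mulrC divfK// gt_eqF.
by rewrite ler_pM2l//; lra.
Qed.

Lemma Bsize_Cvol (e : R) : 0 < e -> exists T0, forall T, T0 <= T ->
  `|Bsize T / Cvol R n T - 1| <= e.
Proof.
move=> e0; have [dl dl0 near1] := pow_near1 e0.
exists (dl^-1 + 1) => T TM.
have dli : 0 < dl^-1 by rewrite invr_gt0.
have T0 : 0 <= T by lra.
have TT : 0 < 2 * T by lra.
rewrite BsizeE// /Cvol -expr_div_n; apply: near1.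
have -> : side T / (2 * T) - 1 = (side T - 2 * T) / (2 * T).
  by rewrite mulrBl mulfV// gt_eqF.
rewrite normrM normfV (gtr0_norm TT) ler_pdivrMr//.
apply: le_trans (side_near T0) _.
apply: (@le_trans _ _ (dl * dl^-1)); first by rewrite mulfV// gt_eqF.
by rewrite ler_pM2l//; lra.
Qed.

(** By translation invariance the left side integrates F(t + u) over those [t] with t + u in
    [B (T - m)]; as [u] is in [B m], they all lie in [B T]. *)
Lemma Bbox_shift (m T : R) u (F : n.-tuple R -> \bar R) :
  measurable_fun setT F -> (forall t, 0 <= F t)%E -> B m u ->
  (\int[lam]_(t in B (T - m)) F t <= \int[lam]_(t in B T) F (tadd t u))%E.
Proof.
move=> mF F0 Bu; have Du : D u by case: Bu.
have mtau := measurable_translate u.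
have -> : (\int[lam]_(t in B (T - m)) F t =
    \int[lam]_(t in (fun t => tadd t u) @^-1` B (T - m)) F (tadd t u))%E.
  rewrite -(@ge0_integral_pushforward _ _ _ _ _ _ mtau lam (B (T - m)) F)//; last 2 first.
  - exact: measurable_Bbox.
  - exact: measurable_funTS.
  apply: eq_measure_integral => A mA _; exact/esym/lam_translate.
apply: ge0_subset_integral => //.
- by rewrite -[X in measurable X]setTI; apply: mtau => //; exact: measurable_Bbox.
- exact: measurable_Bbox.
- by apply: measurable_funTS; exact: (measurableT_comp mF mtau).
move=> t [/= tT Dt]; split => [i|].
  have := tT i; rewrite tnth_tadd => /andP[p q].
  have /andP[p' q'] := Bu.1 i; apply/andP; split; lra.
have E : tadd (tadd t u) (topp u) = t.
  by rewrite -taddA (taddC u) taddNt taddC tadd0t.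
by rewrite -E; apply: Tgrp_add => //; exact: Tgrp_opp.
Qed.

End lambda.

(** * The action of T^d *)

Section action.
Context {R : realType} {n : nat} (disc : bool).
Variable lam : {sigma_finite_measure set (n.-tuple R) -> \bar R}.
Hypothesis lamP : is_lambda disc lam.
Context {dS : measure_display} {S : measurableType dS}.
Variable mu : {sigma_finite_measure set S -> \bar R}.
Variables (phi : n.-tuple R -> S -> S) (w : n.-tuple R -> S -> R).
Hypothesis act : nonsingular_action disc mu phi.
Hypothesis coc : rn_cocycle disc mu phi w.
Local Notation D := (Tgrp R n disc).
Local Notation B := (Bbox R n disc).

(* The action is only given on T^d; off T^d it is extended trivially so that
   it is jointly measurable on all of R^d x S. *)
Definition total_phi (t : n.-tuple R) (s : S) : S := if `[< D t >] then phi t s else s.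
Definition total_w (t : n.-tuple R) (s : S) : R := if `[< D t >] then w t s else 0.

Lemma total_phiE t : D t -> total_phi t = phi t.
Proof. by move=> Dt; apply/funext => s; rewrite /total_phi asboolT. Qed.

Lemma total_wE t : D t -> total_w t = w t.
Proof. by move=> Dt; apply/funext => s; rewrite /total_w asboolT. Qed.

Let domE (b : bool) : [set: n.-tuple R * S] `&` (fun p => `[< D p.1 >]) @^-1` [set b] =
  (if b then D else ~` D) `*` [set: S].
Proof.
apply/seteqP; split => [[t s] [_ /=]|[t s] /= [+ _]]; case: b.
- by move/asboolP.
- by move/negbT/asboolPn.
- by move=> Dt; split => //; exact: asboolT.
- by move=> Dt; split => //; exact: asboolF.
Qed.

Let measurable_dom : measurable_fun setT (fun p : n.-tuple R * S => `[< D p.1 >]).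
Proof.
apply: (measurable_fun_bool true); rewrite domE.
by apply: measurableX => //; exact: measurable_Tgrp.
Qed.

Lemma measurable_total_phi :
  measurable_fun setT (fun p : n.-tuple R * S => total_phi p.1 p.2).
Proof.
apply: measurable_fun_if => //; rewrite domE; first by case: act.
by apply: measurable_funTS; exact: measurable_snd.
Qed.

Lemma measurable_total_w :
  measurable_fun setT (fun p : n.-tuple R * S => total_w p.1 p.2).
Proof. by apply: measurable_fun_if => //; rewrite domE; case: coc. Qed.

Lemma phi_oppK u s : D u -> phi (topp u) (phi u s) = s.
Proof.
case: act => _ p0 pa _ Du.
by rewrite -pa//; [rewrite taddNt p0|exact: Tgrp_opp].
Qed.

Lemma w_tzero s : w (tzero R n) s = 1.
Proof.
case: act => _ p0 _ _; case: coc => wp _ _ wa.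
have Dz := @Tgrp_zero R n disc; have := wa _ _ Dz Dz s; rewrite tadd0t p0.
move=> /eqP; rewrite -{1}[w _ s]mulr1 => /eqP/mulfI -> //.
by rewrite gt_eqF// wp.
Qed.

Lemma w_oppE u s : D u -> w (topp u) (phi u s) * w u s = 1.
Proof.
case: coc => _ _ _ wa Du; have Do := Tgrp_opp Du.
by rewrite mulrC -wa// taddNt w_tzero.
Qed.

(** [w u] is the density of the pushforward of mu by the inverse of phi_u, and integrating g(phi_u)
    against that pushforward cancels phi_u. *)
Lemma total_iso u (g : S -> \bar R) : D u -> measurable_fun setT g ->
  (forall s, 0 <= g s)%E -> (\int[mu]_s ((w u s)%:E * g (phi u s)) = \int[mu]_s g s)%E.
Proof.
move=> Du mg g0.
have Do := Tgrp_opp Du.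
case: (act) => pm p0 pa _; case: (coc) => wp wm wd wa.
have [_ mpu _ _] := pm u Du; have [_ mpo _ _] := pm _ Do.
have oppK s : phi u (phi (topp u) s) = s.
  by rewrite -pa// taddC taddNt p0.
have mwu : measurable_fun setT (w u).
  have := measurableT_comp measurable_total_w (pair1_measurable u).
  by rewrite (_ : _ \o _ = w u)//; apply/funext => s /=; rewrite total_wE.
have dens := @integral_density _ _ _ mu (pushforward mu (phi (topp u))) (w u) mwu
  (fun s => ltW (wp u Du s)).
rewrite -dens.
- rewrite ge0_integral_pushforward//; last exact: (measurableT_comp mg mpu).
  by rewrite preimage_setT; apply: eq_integral => s _ /=; rewrite oppK.
- move=> E mE; rewrite -wd// /pushforward; congr (mu _).
  apply/seteqP; split => [s Es|_ [s Es <-]]; last by rewrite /preimage /= phi_oppK.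
  by exists (phi (topp u) s).
- exact: (measurableT_comp mg mpu).
- by move=> s; exact: g0.
Qed.

Lemma tuple_flow : folner_flow lam mu (tzero R n) (@tadd R n) (@topp R n) B
  (Bsize disc lam) total_phi total_w.
Proof.
case: (act) => pm p0 pa _; case: (coc) => wp wm wd wa.
have BD m t : B m t -> D t by case.
split.
- exact: measurable_Bbox.
- exact: Bbox_mono.
- exact: lam_Bsize.
- exact: Bsize_gt0.
- exact: Bsize_folner.
- exact: Bbox_shift.
- by split; [move=> i; rewrite tnth_tzero ltrN10 ler01|exact: Tgrp_zero].
- move=> m m' u v [Bu Du] [Bv Dv]; split; last exact: Tgrp_add.
  move=> i; have /andP[a b] := Bu i; have /andP[c d] := Bv i.
  by rewrite tnth_tadd; apply/andP; split; lra.
(* Negation exchanges the open and the closed faces of the box; the extra 1 absorbs this. *)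
- move=> m u [Bu Du]; split; last exact: Tgrp_opp.
  move=> i; have /andP[a b] := Bu i.
  by rewrite tnth_topp; apply/andP; split; lra.
- exact: taddC.
- exact: taddA.
- exact: measurable_tadd.
- exact: measurable_total_phi.
- exact: measurable_total_w.
- by move=> t s; rewrite /total_w; case: asboolP => // Dt; exact/ltW/wp.
- by move=> s; rewrite total_phiE//; exact: Tgrp_zero.
- by move=> s; rewrite total_wE ?w_tzero//; exact: Tgrp_zero.
- move=> m m' t u s /BD Dt /BD Du.
  by rewrite !total_phiE//; [exact: pa|exact: Tgrp_add].
- move=> m m' t u s /BD Dt /BD Du.
  by rewrite !total_wE ?total_phiE//; [exact: wa|exact: Tgrp_add].
- by move=> m u s /BD Du; rewrite !total_phiE ?phi_oppK//; exact: Tgrp_opp.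
- by move=> m u s /BD Du; rewrite !total_wE ?total_phiE ?w_oppE//; exact: Tgrp_opp.
- move=> m u g /BD Du mg g0; rewrite -[RHS](total_iso Du mg g0).
  by apply: eq_integral => s _; rewrite total_wE// total_phiE.
Qed.

Lemma stochastic_ergodic_theorem (f0 : S -> R) :
  mu.-integrable [set: S] (EFin \o f0) ->
  exists ft : S -> R,
    [/\ mu.-integrable [set: S] (EFin \o ft),
        stoch_cvg mu (ergodic_avg disc lam phi w f0) ft &
        forall t, D t -> {ae mu, forall s, dual_op phi w t ft s = ft s}].
Proof.
move=> If0.
have [rho [mrho rho0 rho1 Irho]] := sigma_finite_weight (sigma_finiteT mu).
have [ft [Ift cvg inv]] := stochastic_limit tuple_flow mrho rho0 rho1 Irho If0
  (Bsize_Cvol lamP).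
exists ft; split => //.
  rewrite (_ : ergodic_avg _ _ _ _ _ = (fun T s => (Cvol R n T)^-1 *
    fine (\int[lam]_(t in B T) (total_w t s * f0 (total_phi t s))%:E)%E))//.
  apply/funext => T; apply/funext => s; rewrite /ergodic_avg /Rintegral.
  congr (_ * fine _); apply: eq_integral => t /[!inE] -[_ Dt].
  by rewrite total_wE// total_phiE.
(* [dual_op] at t evaluates w and phi at -t, so invariance is applied to -t. *)
move=> t Dt; have Do := Tgrp_opp Dt; have [m Bm] := Tgrp_Bbox Do.
by apply: filterS (inv m _ Bm) => s; rewrite /dual_op total_wE// total_phiE.
Qed.

End action.

(** * From sigma-finiteness hypotheses to sigma-finite structures *)

Section sigma_finite_copy.
Context {d : measure_display} {X : measurableType d} {R : realType}.
Variable m : {measure set X -> \bar R}.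
Hypothesis mfin : sigma_finite setT m.

(** The dummy [let] makes the constant depend on [mfin], so that an instance using this proof can be
    attached to it, while it stays convertible to [m]. *)
Definition sigma_finite_copy : set X -> \bar R := let _ := mfin in m.

HB.instance Definition _ := isMeasure.Build d X R sigma_finite_copy
  (measure0 m) (@measure_ge0 _ _ _ m) (@measure_semi_sigma_additive _ _ _ m).

HB.instance Definition _ := Measure_isSigmaFinite.Build d X R sigma_finite_copy mfin.

End sigma_finite_copy.

Theorem mainTheorem4 (R : realType) (n : nat) (disc : bool)
  (lam : {measure set (n.-tuple R) -> \bar R})
  (dS : measure_display) (S : measurableType dS)
  (mu : {measure set S -> \bar R})
  (phi : n.-tuple R -> S -> S) (w : n.-tuple R -> S -> R) (f0 : S -> R) :
  is_lambda disc lam ->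
  standard_borel S R ->
  sigma_finite [set: S] mu ->
  nonsingular_action disc mu phi ->
  rn_cocycle disc mu phi w ->
  mu.-integrable [set: S] (EFin \o f0) ->
  exists ft : S -> R,
    [/\ mu.-integrable [set: S] (EFin \o ft),
        stoch_cvg mu (ergodic_avg disc lam phi w f0) ft &
        forall t, Tgrp R n disc t ->
          {ae mu, forall s, dual_op phi w t ft s = ft s}].
Proof.
move=> lamP _ mufin act coc If0.
(* Sigma-finiteness of lambda comes from the finite measure of cubes. Both copies are convertible to
   the given measures, so the result transfers unchanged. *)
pose lamS : {sigma_finite_measure set (n.-tuple R) -> \bar R} :=
  sigma_finite_copy (lam_sigma_finite lamP).
pose muS : {sigma_finite_measure set S -> \bar R} := sigma_finite_copy mufin.
exact: (@stochastic_ergodic_theorem R n disc lamS lamP dS S muS phi w act coc f0 If0).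
Qed.
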